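(* $\mathbf{E}/V(\mathbf{E})\in\mathbb{Z}_3[[w/3,3y]]$; that is, there are $b_{i,j}\in\mathbb{Z}_3$ with $\mathbf{E}/V(\mathbf{E})=\sum_{i,j\ge0}b_{i,j}(w/3)^i(3y)^j$.
   Context: For a commutative ring $R$, $V:R[[q]]\to R[[q]]$ is the $R$-linear map $V(\sum r_nq^n)=\sum r_nq^{3n}$; here it is applied with $R=\mathbb{Z}_3[[w]]$. For even $k\ge 2$, $E_k=1+\frac{2}{(1-3^{k-1})\zeta(1-k)}\sum_{n\ge1}\big(\sum_{0<d\mid n,\,3\nmid d}d^{k-1}\big)q^n$. The Eisenstein family $\mathbf{E}\in\mathbb{Z}_3[[w,q]]$ is the element whose coefficient of $q^n$, for each $n$, is the unique power series in $\mathbb{Z}_3[[w]]$ taking at $w=4^k-1$ the value of the $n$-th coefficient of $E_k$, for all even $k\ge2$; its constant term is $1$. $\theta=\sum_{(a,b)\in\mathbb{Z}^2}q^{a^2+ab+b^2}$ and $y=\frac16\left(\frac{\theta}{V(\theta)}-1\right)=q-5q^4+\cdots\in\mathbb{Z}[[q]]$. Since $y=q+\cdots$, one has $\mathbb{Z}_3[[w,q]]=\mathbb{Z}_3[[w,y]]\subset\mathbb{Z}_3[[w/3,y]]$ (power series ring in the two variables $w/3$ and $y$), and $\mathbb{Z}_3[[w/3,3y]]$ denotes the subring of $\mathbb{Z}_3[[w/3,y]]$ of elements $\sum b_{i,j}(w/3)^i(3y)^j$ with $b_{i,j}\in\mathbb{Z}_3$. *)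

(* Defs.v *)
From HB Require Import structures.
From mathcomp Require Import all_boot all_order all_algebra.
From mathcomp Require Import finmap zify.
From mathcomp Require Import boolp classical_sets functions cardinality.

Set Implicit Arguments.
Unset Strict Implicit.
Unset Printing Implicit Defensive.

Import Order.TTheory GRing.Theory Num.Theory.
Local Open Scope ring_scope.

(* The units and the inverse of a commutative ring, as needed by
   [ComNzRing_hasMulInverse]; by classical choice, [cinv x] is the inverse of
   [x] whenever [x] is invertible. *)
Section ClassicalInverse.
Variable R : comNzRingType.

Definition cunit : {pred R} := [pred x | `[< exists y : R, y * x = 1 >]].

Definition cinv (x : R) : R :=
  if pselect (exists y : R, y * x = 1) is left h then projT1 (cid h) else x.

Lemma cinvVx : {in cunit, left_inverse 1 cinv *%R}.
Proof.
move=> x /asboolP ux; rewrite /cinv; case: pselect => // h.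
exact: projT2 (cid h).
Qed.

Lemma cunitPl (x y : R) : y * x = 1 -> cunit x.
Proof. by move=> yx; apply/asboolP; exists y. Qed.

Lemma cinv_out : {in [predC cunit], cinv =1 id}.
Proof.
by move=> x /asboolPn nux; rewrite /cinv; case: pselect.
Qed.

End ClassicalInverse.

(* {fps R} is the ring R[[X]]; R[[X, Y]] is rendered as {fps {fps R}}, the
   outer variable being the second one. *)
Record fps_of (R : Type) := Fps { coef_fps :> nat -> R }.

Notation "{ 'fps' R }" := (fps_of R) (format "{ 'fps'  R }").

HB.instance Definition _ (R : Type) := gen_eqMixin {fps R}.
HB.instance Definition _ (R : Type) := gen_choiceMixin {fps R}.

Lemma fpsP (R : Type) (f g : {fps R}) : (forall n, f n = g n) <-> f = g.
Proof.
split=> [fg|-> //]; case: f fg => f; case: g => g /= fg.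
by congr Fps; apply/funext.
Qed.

Section PowerSeriesRing.
Variable R : comNzRingType.
Implicit Types f g h : {fps R}.

Definition fpsC (c : R) : {fps R} := Fps (fun n => if n == 0%N then c else 0).
Definition fpsX : {fps R} := Fps (fun n => if n == 1%N then 1 else 0).
Definition fps_add f g : {fps R} := Fps (fun n => f n + g n).
Definition fps_opp f : {fps R} := Fps (fun n => - f n).
Definition fps_mul f g : {fps R} :=
  Fps (fun n => \sum_(i < n.+1) f i * g (n - i)%N).

Lemma fps_addA : associative fps_add.
Proof. by move=> f g h; apply/fpsP => n /=; rewrite addrA. Qed.

Lemma fps_addC : commutative fps_add.
Proof. by move=> f g; apply/fpsP => n /=; rewrite addrC. Qed.

Lemma fps_add0 : left_id (fpsC 0) fps_add.
Proof. by move=> f; apply/fpsP => n /=; rewrite if_same add0r. Qed.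

Lemma fps_addN : left_inverse (fpsC 0) fps_opp fps_add.
Proof. by move=> f; apply/fpsP => n /=; rewrite if_same addNr. Qed.

HB.instance Definition _ := GRing.isZmodule.Build {fps R}
  fps_addA fps_addC fps_add0 fps_addN.

Let trunc N f : {poly R} := \poly_(i < N.+1) f i.

Let coef_trunc N f i : (i <= N)%N -> (trunc N f)`_i = f i.
Proof. by move=> iN; rewrite coef_poly ltnS iN. Qed.

Let mul_trunc N f g i :
  (i <= N)%N -> (trunc N f * trunc N g)`_i = fps_mul f g i.
Proof.
move=> iN; rewrite coefM; apply: eq_bigr => -[j /= ji] _.
by rewrite !coef_trunc // (leq_trans _ iN) ?leq_subr // -ltnS.
Qed.

Lemma fps_mulC : commutative fps_mul.
Proof.
by move=> f g; apply/fpsP => n; rewrite -!(@mul_trunc n) // mulrC.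
Qed.

Lemma fps_mulA : associative fps_mul.
Proof.
move=> f g h; apply/fpsP => n.
have mulE (u v : {fps R}) (p q : {poly R}) :
    (forall i, (i <= n)%N -> p`_i = u i) ->
    (forall i, (i <= n)%N -> q`_i = v i) -> (p * q)`_n = fps_mul u v n.
  move=> pu qv; rewrite coefM; apply: eq_bigr => -[j /= jn] _.
  by rewrite pu ?qv ?leq_subr.
rewrite -(mulE _ _ (trunc n f) (trunc n g * trunc n h)); first last.
- exact: mul_trunc.
- exact: coef_trunc.
rewrite -(mulE _ _ (trunc n f * trunc n g) (trunc n h)) ?mulrA //.
- exact: mul_trunc.
- exact: coef_trunc.
Qed.

Lemma fps_mul1 : left_id (fpsC 1) fps_mul.
Proof.
move=> f; apply/fpsP => n /=; rewrite big_ord_recl /= mul1r subn0.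
by rewrite big1 ?addr0 // => i _; rewrite mul0r.
Qed.

Lemma fps_mulDl : left_distributive fps_mul +%R.
Proof.
move=> f g h; apply/fpsP => n /=; rewrite -big_split /=.
by apply: eq_bigr => i _; rewrite mulrDl.
Qed.

Lemma fps_1neq0 : fpsC 1 != 0.
Proof.
by apply/eqP => /fpsP/(_ 0%N) /= /eqP; rewrite oner_eq0.
Qed.

HB.instance Definition _ := GRing.Zmodule_isComNzRing.Build {fps R}
  fps_mulA fps_mulC fps_mul1 fps_mulDl fps_1neq0.

HB.instance Definition _ := GRing.ComNzRing_hasMulInverse.Build {fps R}
  (@cinvVx {fps R}) (@cunitPl {fps R}) (@cinv_out {fps R}).

Lemma coef_fps0 n : (0 : {fps R}) n = 0. Proof. by rewrite /= if_same. Qed.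
Lemma coef_fps1 n : (1 : {fps R}) n = (n == 0%N)%:R. Proof. by case: n. Qed.
Lemma coef_fpsD f g n : (f + g) n = f n + g n. Proof. by []. Qed.
Lemma coef_fpsN f n : (- f) n = - f n. Proof. by []. Qed.
Lemma coef_fpsM f g n : (f * g) n = \sum_(i < n.+1) f i * g (n - i)%N.
Proof. by []. Qed.

Lemma fps_unit1 f : f 0%N = 1 -> f \is a GRing.unit.
Proof.
move=> f0.
pose inv_seq := fix s n : seq R := if n is m.+1 then
  rcons (s m) (- \sum_(i < m.+1) (s m)`_i * f (m.+1 - i)%N) else [:: 1].
have sz n : size (inv_seq n) = n.+1.
  by elim: n => //= n IH; rewrite size_rcons IH.
have nthE n i : (i <= n)%N -> (inv_seq n)`_i = (inv_seq i)`_i.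
  elim: n => [|n IH]; first by rewrite leqn0 => /eqP->.
  rewrite leq_eqVlt => /predU1P[-> //|]; rewrite ltnS => le_in.
  by rewrite /= nth_rcons sz ltnS le_in IH.
pose g : {fps R} := Fps (fun n => (inv_seq n)`_n).
apply/(@cunitPl _ f g)/fpsP => -[|n].
  by rewrite coef_fpsM big_ord_recl big_ord0 /= f0 mul1r addr0.
rewrite coef_fpsM big_ord_recr /= subnn f0 mulr1 nth_rcons sz ltnn eqxx.
apply/eqP; rewrite subr_eq0; apply/eqP/eq_bigr => -[i /= le_in] _.
by rewrite (nthE n i).
Qed.

End PowerSeriesRing.

(* The quotients [theta / V theta], [E / V E], [_ / 6%:R] and [w / 3%:R] used
   below are thus genuine ones: the constant terms of the denominators are
   invertible. *)
Lemma fps_unitE (R : comUnitRingType) (f : {fps R}) :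
  (f \is a GRing.unit) = (f 0%N \is a GRing.unit).
Proof.
have coef0M (g h : {fps R}) : (g * h) 0%N = g 0%N * h 0%N.
  by rewrite coef_fpsM big_ord_recl big_ord0 addr0.
apply/idP/idP => [/mulVr/fpsP/(_ 0%N)|f0].
  by rewrite coef0M mulrC => h; apply/unitrPr; exists (f^-1 0%N).
have := @fps_unit1 _ (f * fpsC (f 0%N)^-1).
by rewrite coef0M /= divrr // unitrM => /(_ erefl)/andP[].
Qed.

Definition V (R : comNzRingType) (f : {fps R}) : {fps R} :=
  Fps (fun n => if (3 %| n)%N then f (n %/ 3)%N else 0).

Definition fps_map (R S : Type) (phi : R -> S) (f : {fps R}) : {fps S} :=
  Fps (fun n => phi (f n)).

(* The ring Z_3 as the inverse limit of the Z/3^n: the n-th residue is the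
   representative in [0, 3^n[. *)
Record Z3 := MkZ3 {
  residue :> nat -> int;
  residueP : forall n, residue n = (residue n.+1 %% 3 ^+ n)%Z }.

HB.instance Definition _ := gen_eqMixin Z3.
HB.instance Definition _ := gen_choiceMixin Z3.

Lemma Z3P (x y : Z3) : (forall n, x n = y n) <-> x = y.
Proof.
split=> [xy|-> //]; case: x y xy => x xP [y yP] /= xy.
have exy : x = y by apply/funext.
by case: _ / exy yP {xy} => xP'; rewrite (Prop_irrelevance xP xP').
Qed.

Lemma modz3_succ (a : int) n : ((a %% 3 ^+ n.+1)%Z %% 3 ^+ n)%Z = (a %% 3 ^+ n)%Z.
Proof.
rewrite [in RHS](divz_eq a (3 ^+ n.+1)) exprS mulrA.
by rewrite modzMDl.
Qed.

Fact Z3_of_subproof (u : nat -> int) :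
  (forall n, (u n = u n.+1 %[mod 3 ^+ n])%Z) ->
  forall n, (u n %% 3 ^+ n)%Z = ((u n.+1 %% 3 ^+ n.+1)%Z %% 3 ^+ n)%Z.
Proof. by move=> uP n; rewrite modz3_succ. Qed.

Definition Z3_of u uP : Z3 := MkZ3 (@Z3_of_subproof u uP).

Lemma Z3_mod (x : Z3) n : (x n = x n.+1 %[mod 3 ^+ n])%Z.
Proof. by rewrite [x n]residueP modz_mod. Qed.

Lemma Z3_small (x : Z3) n : (x n %% 3 ^+ n)%Z = x n.
Proof. by rewrite [x n]residueP modz_mod. Qed.

Fact Z3_int_subproof (a : int) n : (a = a %[mod 3 ^+ n])%Z.
Proof. by []. Qed.
Definition Z3_int (a : int) : Z3 := Z3_of (Z3_int_subproof a).

Fact Z3_add_subproof (x y : Z3) n :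
  (x n + y n = x n.+1 + y n.+1 %[mod 3 ^+ n])%Z.
Proof. by rewrite -modzDm !(Z3_mod _ n) modzDm. Qed.
Definition Z3_add (x y : Z3) : Z3 := Z3_of (Z3_add_subproof x y).

Fact Z3_opp_subproof (x : Z3) n : (- x n = - x n.+1 %[mod 3 ^+ n])%Z.
Proof. by rewrite -modzNm (Z3_mod _ n) modzNm. Qed.
Definition Z3_opp (x : Z3) : Z3 := Z3_of (Z3_opp_subproof x).

Fact Z3_mul_subproof (x y : Z3) n :
  (x n * y n = x n.+1 * y n.+1 %[mod 3 ^+ n])%Z.
Proof. by rewrite -modzMm !(Z3_mod _ n) modzMm. Qed.
Definition Z3_mul (x y : Z3) : Z3 := Z3_of (Z3_mul_subproof x y).

Lemma Z3_addA : associative Z3_add.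
Proof. by move=> x y z; apply/Z3P => n /=; rewrite modzDml modzDmr addrA. Qed.

Lemma Z3_addC : commutative Z3_add.
Proof. by move=> x y; apply/Z3P => n /=; rewrite addrC. Qed.

Lemma Z3_add0 : left_id (Z3_int 0) Z3_add.
Proof. by move=> x; apply/Z3P => n /=; rewrite modzDml add0r Z3_small. Qed.

Lemma Z3_addN : left_inverse (Z3_int 0) Z3_opp Z3_add.
Proof. by move=> x; apply/Z3P => n /=; rewrite modzDml addNr. Qed.

HB.instance Definition _ := GRing.isZmodule.Build Z3
  Z3_addA Z3_addC Z3_add0 Z3_addN.

Lemma Z3_mulA : associative Z3_mul.
Proof. by move=> x y z; apply/Z3P => n /=; rewrite modzMml modzMmr mulrA. Qed.

Lemma Z3_mulC : commutative Z3_mul.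
Proof. by move=> x y; apply/Z3P => n /=; rewrite mulrC. Qed.

Lemma Z3_mul1 : left_id (Z3_int 1) Z3_mul.
Proof. by move=> x; apply/Z3P => n /=; rewrite modzMml mul1r Z3_small. Qed.

Lemma Z3_mulDl : left_distributive Z3_mul +%R.
Proof.
by move=> x y z; apply/Z3P => n /=; rewrite modzMml modzDm mulrDl.
Qed.

Lemma Z3_1neq0 : Z3_int 1 != 0.
Proof. by apply/eqP => /Z3P/(_ 1%N). Qed.

HB.instance Definition _ := GRing.Zmodule_isComNzRing.Build Z3
  Z3_mulA Z3_mulC Z3_mul1 Z3_mulDl Z3_1neq0.

HB.instance Definition _ := GRing.ComNzRing_hasMulInverse.Build Z3
  (@cinvVx Z3) (@cunitPl Z3) (@cinv_out Z3).

Lemma Z3_modn (x : Z3) m n : (x m = x (m + n)%N %[mod 3 ^+ m])%Z.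
Proof.
elim: n => [|n IH]; first by rewrite addn0.
rewrite IH addnS.
have /eqP := Z3_mod x (m + n); rewrite eqz_mod_dvd => h.
apply/eqP; rewrite eqz_mod_dvd; apply: dvdz_trans h.
by rewrite exprD dvdz_mulr.
Qed.

Lemma Z3_integral : GRing.integral_domain_axiom Z3.
Proof.
have nz (x : Z3) : x != 0 -> exists m, forall n, ~~ (3 ^+ m %| x (m + n)%N)%Z.
  move=> x0; have [m xm] : exists m, x m <> 0.
    apply/not_existsP => h; move/eqP: x0; apply; apply/Z3P => m /=.
    by rewrite mod0z; apply: contrapT => /(h m).
  exists m => n; apply/negP => /dvdz_mod0P; rewrite -Z3_modn => h.
  by apply: xm; rewrite -Z3_small.
have ndvd m (a : int) : ~~ (3 ^+ m %| a)%Z ->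
    a != 0 /\ (logn 3 `|a| < m)%N.
  have [->|a0] := eqVneq a 0; rewrite dvdzE abszX ?dvdn0 // => h.
  by split=> //; rewrite ltnNge; move: h; rewrite pfactor_dvdn // lt0n absz_eq0.
move=> x y xy0; apply/norP => -[/nz[m xm] /nz[l yl]].
have [x0 lx] := ndvd m _ (xm l).
have [] := ndvd l _ (yl m); rewrite addnC => y0 ly.
have /Z3P/(_ (m + l)%N) /= := xy0; rewrite mod0z => /dvdz_mod0P.
rewrite dvdzE abszX abszM.
rewrite pfactor_dvdn ?muln_gt0 ?lt0n ?absz_eq0 ?x0 //=.
rewrite lognM ?lt0n ?absz_eq0 // leqNgt => /negP; apply.
by rewrite -addnS leq_add // ltnW.
Qed.

HB.instance Definition _ := GRing.ComUnitRing_isIntegral.Build Z3 Z3_integral.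

Definition Q3 : fieldType := {fraction Z3}.

Definition Z3_lim (s : nat -> Z3) (z : Z3) : Prop :=
  forall m, exists N, forall n, (N <= n)%N -> residue (s n) m = residue z m.

Definition fps_value (f : {fps Z3}) (x z : Z3) : Prop :=
  Z3_lim (fun n => \sum_(i < n) f i * x ^+ i) z.

(* T / (e ^ T - 1) = \sum_n B_n T ^ n / n! *)
Definition bernoulli (n : nat) : rat :=
  (n`!)%:R * (Fps (fun i => (i.+1`!)%:R^-1) : {fps rat})^-1 n.

(* For k >= 2, the value zeta(1 - k) of the Riemann zeta function is the
   rational number - B_k / k. *)
Definition zeta_1sub (k : nat) : rat := - bernoulli k / k%:R.

Definition eisenstein (k : nat) : {fps rat} := Fps (fun n =>
  if n == 0%N then 1 else
  2%:R / ((1 - 3%:R ^+ k.-1) * zeta_1sub k)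
  * \sum_(d <- divisors n | ~~ (3 %| d)%N) d%:R ^+ k.-1).

Definition is_eisenstein_family (E : {fps {fps Z3}}) : Prop :=
  E 0%N = 1 /\
  forall n k : nat, (2 <= k)%N -> ~~ odd k ->
    exists2 z : Z3, fps_value (E n) (4%:R ^+ k - 1) z
                  & tofrac z = ratr (eisenstein k n) :> Q3.

Definition theta_reps (n : nat) : set (int * int) :=
  [set ab | ab.1 ^+ 2 + ab.1 * ab.2 + ab.2 ^+ 2 = n%:Z].

Lemma finite_theta_reps (n : nat) : finite_set (theta_reps n).
Proof.
pose f (ij : 'I_(n.*2.+1) * 'I_(n.*2.+1)) : int * int :=
  ((ij.1 : nat)%:Z - n%:Z, (ij.2 : nat)%:Z - n%:Z).
apply: (@sub_finite_set _ _ (f @` setT)); last exact/finite_image/finite_finset.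
move=> [a b] /= abn.
have bound (c d : int) : c ^+ 2 + c * d + d ^+ 2 = n%:Z ->
    (`|(c + n%:Z)%R| < n.*2.+1)%N /\ 0 <= c + n%:Z.
  move=> cdn; have c2 : 3 * (c * c) <= 4 * n%:Z.
    by have := sqr_ge0 (c + 2 * d); rewrite !expr2 in cdn *; lia.
  have c_le : - n%:Z <= c <= n%:Z by rewrite !leNgt; apply/andP; split; nia.
  lia.
have [la pa] := bound a b abn.
have [lb pb] : (`|(b + n%:Z)%R| < n.*2.+1)%N /\ 0 <= b + n%:Z.
  by apply: (bound b a); rewrite -abn /= [b * a]mulrC addrC addrA [RHS]addrAC addrC.
exists (Ordinal la, Ordinal lb) => //.
by rewrite /f /= !gez0_abs // !addrK.
Qed.

Definition theta : {fps rat} := Fps (fun n => #|` fset_set (theta_reps n)|%:R).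

Definition y_fps : {fps rat} := (theta / V theta - 1) / 6%:R.

(* The ambient ring is Q_3[[w, q]] = {fps {fps Q3}}, with inner variable w and
   outer variable q. *)
Definition w_var : {fps {fps Q3}} := fpsC (fpsX Q3).

Definition y_var : {fps {fps Q3}} :=
  fps_map (fun r : rat => fpsC (ratr r : Q3)) y_fps.

Definition cst (z : Z3) : {fps {fps Q3}} := fpsC (fpsC (tofrac z)).

Definition incl : {fps {fps Z3}} -> {fps {fps Q3}} :=
  fps_map (fps_map (@tofrac Z3)).

(* s is the sum of the double series u for coefficientwise (formal)
   convergence, the coefficients being discrete. *)
Definition fps_double_sum (u : nat -> nat -> {fps {fps Q3}})
    (s : {fps {fps Q3}}) : Prop :=
  forall n m : nat, exists N, forall M, (N <= M)%N ->
    (\sum_(i < M) \sum_(j < M) u i j) n m = s n m.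

(* Main.v *)
From HB Require Import structures.
From mathcomp Require Import all_boot all_order all_algebra.
From mathcomp Require Import finmap ring lra zify.
From mathcomp Require Import boolp classical_sets functions cardinality.
Require Import Defs.

Set Implicit Arguments.
Unset Strict Implicit.
Unset Printing Implicit Defensive.

Import Order.TTheory GRing.Theory Num.Theory.
Local Open Scope ring_scope.

(** Why the theorem holds. Put [w = 3 W] and [A = Z_3[[W]]]. The family is mostly
    used at the weights [k = 2 * 3^(m+1)], where [W] takes values [3 c_m] that
    tend to 0; a power series in [W] that vanishes at infinitely many of these
    points is zero ([ev_identity]), so that identities between series over [A]
    can be checked weight by weight.

    Integral weights. The Taylor coefficients in [z] of the sum over [m] of
    [z x / (1 - x^3)] at [x = q^m e^z] are, up to constants, the Eisenstein
    series of level 3 ([geis], [geis_eisenstein]). Partial fractions express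
    the square of this sum linearly through the analogous sum of
    [z x^2 / (1 - x^3)], its image under [z -> -z] ([lamser_sqr]); this is a
    recursion on the weight, and it yields [E_k = theta^k p_k(t)] for a
    polynomial [p_k] and a Hauptmodul [t] ([eisenstein_poly]). The
    coefficients of these series at [q^(3n)] and [q^n] agree; in the weights 1
    to 6 this forces [(1 + 6 y)^3 t = y + 3 y^2 + 9 y^3] and [V t = y^3]
    ([haupt_y]), together with a cubic equation relating [y] and [V y]. The
    theta series satisfies the same equation, by a discrete Fourier transform
    on the cube of the hexagonal lattice ([thetaC_cube]); as the equation
    determines the series, theta is the Eisenstein series of weight 1
    ([theta_geis1]).

    Interpolation. Write [theta = 1 + 6 chi]. The weight is the value at the
    chosen points of some [kappa] in [A], and [theta^k] is interpolated by
    [Th = beta(chi)] with [beta = (1 + 6 X)^kappa] ([universal_power]). Hence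
    [E = Th P(t)] for some [P] in [A[[X]]], whose coefficients tend to 0
    because [P] becomes the polynomial [p_k] at weight [k] ([ev_decay]). In
    terms of [y] this reads [E = V(Th) F(y)] and [V E = V(Th) P(y^3)], where
    [F = beta P(t)] and [t] is regarded as a function of [y]; moreover [P(X^3)]
    is the part of [F] with exponents divisible by 3.

    Divisibility. The last fact expresses the coefficient [P_j] through all
    the [P_i]; since [t(y)] lies in [y Z_3[[3 y]]] and the denominators in
    [beta] cost half of the powers of 3 at most, a downward induction gives
    [3^j | P_j] ([P_graded]). So the logarithmic derivative of [F] has
    coefficients divisible by [3^n], and the differential equation of
    [H = F / P(X^3)], whose coefficients are to be divided only by integers
    prime to 3, shows that [3^n | H_n] ([fps_ratio_graded]). Finally
    [E / V E = H(y)]. *)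

(** * Formal power series *)

Section FpsRing.
Variable R : comNzRingType.
Implicit Types (f g s : {fps R}) (c : R) (n i j : nat).

Lemma coef_fpsB f g n : (f - g) n = f n - g n. Proof. by []. Qed.

Lemma coef_fps_sum (I : Type) (r : seq I) (P : pred I) (F : I -> {fps R}) n :
  (\sum_(i <- r | P i) F i) n = \sum_(i <- r | P i) F i n.
Proof.
by elim/big_rec2: _ => [|i x y _ <-]; rewrite ?coef_fps0 ?coef_fpsD.
Qed.

Lemma coef0_fpsM f g : (f * g) 0%N = f 0%N * g 0%N.
Proof. by rewrite coef_fpsM big_ord_recl big_ord0 addr0. Qed.

Lemma coef0_fpsX f n : (f ^+ n) 0%N = f 0%N ^+ n.
Proof.
by elim: n => [|n IH]; rewrite ?expr0 ?coef_fps1 // !exprS coef0_fpsM IH.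
Qed.

Lemma coef_fpsCM c f n : (fpsC c * f) n = c * f n.
Proof.
rewrite coef_fpsM big_ord_recl /= subn0 big1 ?addr0 // => i _.
by rewrite mul0r.
Qed.

Lemma coef_fpsMC c f n : (f * fpsC c) n = f n * c.
Proof. by rewrite mulrC coef_fpsCM mulrC. Qed.

Lemma coef_fpsXM f n : (fpsX R * f) n = if n is m.+1 then f m else 0.
Proof.
case: n => [|n]; first by rewrite coef0_fpsM mul0r.
rewrite coef_fpsM 2!big_ord_recl /= mul0r add0r mul1r subSS subn0.
by rewrite big1 ?addr0 // => i _; rewrite mul0r.
Qed.

Lemma coef_fpsXnM i f n :
  (fpsX R ^+ i * f) n = if (i <= n)%N then f (n - i)%N else 0.
Proof.
elim: i n => [|i IH] n; first by rewrite expr0 mul1r subn0.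
by rewrite exprS -mulrA coef_fpsXM; case: n => [|n] //; rewrite IH subSS.
Qed.

Lemma coef_fpsXn i n : (fpsX R ^+ i) n = (n == i)%:R.
Proof.
rewrite -[fpsX R ^+ i]mulr1 coef_fpsXnM coef_fps1.
have [le_in|] := leqP i n; last by rewrite ltn_neqAle => /andP[/negPf->].
by rewrite subn_eq0 eqn_leq le_in andbT.
Qed.

Fact fpsC_is_zmod_morphism : zmod_morphism (@fpsC R).
Proof. by move=> x y; apply/fpsP => n /=; case: eqP; rewrite ?subrr. Qed.
HB.instance Definition _ :=
  GRing.isZmodMorphism.Build R {fps R} (@fpsC R) fpsC_is_zmod_morphism.

Fact fpsC_is_monoid_morphism : monoid_morphism (@fpsC R).
Proof.
split=> // x y; apply/fpsP => n; rewrite coef_fpsCM /=.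
by case: eqP; rewrite ?mulr0.
Qed.
HB.instance Definition _ :=
  GRing.isMonoidMorphism.Build R {fps R} (@fpsC R) fpsC_is_monoid_morphism.

Lemma fpsC_nat n : fpsC (n%:R : R) = n%:R.
Proof. exact: rmorph_nat. Qed.

Lemma coef_fps_natM m f n : (m%:R * f) n = m%:R * f n.
Proof. by rewrite -fpsC_nat coef_fpsCM. Qed.

Definition fps_shift f : {fps R} := Fps (fun n => f n.+1).

Lemma coef_iter_shift k f n : iter k fps_shift f n = f (n + k)%N.
Proof. by elim: k n => [|k IH] n; rewrite ?addn0 //= IH addnS. Qed.

Lemma fps_shiftE f : f = fpsC (f 0%N) + fpsX R * fps_shift f.
Proof.
by apply/fpsP => -[|n]; rewrite coef_fpsD coef_fpsXM /= ?addr0 ?add0r.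
Qed.

Lemma fps_shiftE0 f : f 0%N = 0 -> f = fpsX R * fps_shift f.
Proof. by move=> f0; rewrite {1}[f]fps_shiftE f0 rmorph0 add0r. Qed.

Lemma coef_fpsM_low f g k l n : (forall i, (i < k)%N -> f i = 0) ->
  (forall i, (i < l)%N -> g i = 0) -> (n < k + l)%N -> (f * g) n = 0.
Proof.
move=> f0 g0 lt_n; rewrite coef_fpsM big1 // => -[i /= le_in] _.
have [/f0->|le_ki] := ltnP i k; rewrite ?mul0r // g0 ?mulr0 //.
by rewrite ltn_subLR // (leq_trans lt_n) // leq_add2r.
Qed.

Lemma coef_fpsM_lead f g k l : (forall i, (i < k)%N -> f i = 0) ->
  (forall i, (i < l)%N -> g i = 0) -> (f * g) (k + l)%N = f k * g l.
Proof.
move=> f0 g0; rewrite coef_fpsM.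
have lt_k : (k < (k + l).+1)%N by rewrite ltnS leq_addr.
rewrite (bigD1 (Ordinal lt_k)) //= addKn big1 ?addr0 // => -[i /= lt_i].
rewrite -val_eqE /= neq_ltn => /orP[/f0->|lt_ki]; first by rewrite mul0r.
by rewrite g0 ?mulr0 // ltn_subLR // ltn_add2r.
Qed.

Lemma coef_expr_low s j n : s 0%N = 0 -> (n < j)%N -> (s ^+ j) n = 0.
Proof.
move=> s0; elim: j n => // j IH n lt_nj; rewrite exprS.
apply: (@coef_fpsM_low _ _ 1 j) => // -[|i] //.
Qed.

Lemma coef_expr_lead s n : s 0%N = 0 -> (s ^+ n) n = s 1%N ^+ n.
Proof.
move=> s0; elim: n => [|n IH]; first by rewrite !expr0 coef_fps1.
rewrite !exprS -[n.+1]add1n coef_fpsM_lead ?IH // => [[|i]|i] //.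
exact: coef_expr_low.
Qed.

Lemma fps_neq0_lead f : f != 0 ->
  exists k, f k != 0 /\ forall i, (i < k)%N -> f i = 0.
Proof.
move=> f0; have exf : exists k, f k != 0.
  apply/not_existsP => h; case/eqP: f0; apply/fpsP => n.
  by rewrite coef_fps0; apply/eqP/negPn/negP/h.
exists (ex_minn exf); case: ex_minnP => k fk min_k; split=> // i lt_ik.
by apply/eqP; apply: contraTT lt_ik => /min_k; rewrite -leqNgt.
Qed.

End FpsRing.

Lemma coef_1natD (R : comNzRingType) k (f : {fps R}) n :
  (1 + k%:R * f) n = (n == 0%N)%:R + k%:R * f n.
Proof. by rewrite -coef_fps_natM -coef_fps1. Qed.

Lemma coef1_fpsM (R : comNzRingType) (f g : {fps R}) :
  (f * g) 1%N = f 0%N * g 1%N + f 1%N * g 0%N.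
Proof. by rewrite coef_fpsM 2!big_ord_recl big_ord0 addr0. Qed.

Lemma fps_integral (R : idomainType) :
  GRing.integral_domain_axiom {fps R}.
Proof.
move=> f g fg0; apply/norP => -[/fps_neq0_lead[k [fk f0]]].
move=> /fps_neq0_lead[l [gl g0]].
have /fpsP/(_ (k + l)%N) := fg0.
by rewrite coef_fpsM_lead // coef_fps0; apply/eqP; rewrite mulf_neq0.
Qed.

HB.instance Definition _ (R : idomainType) :=
  GRing.ComUnitRing_isIntegral.Build {fps R} (@fps_integral R).

(** * Substitution in power series *)

Section Composition.
Variable R : comNzRingType.
Implicit Types (f g s : {fps R}) (c : R) (n i j : nat).

(** The series [f(s)]. Stopping the sum at [n] loses nothing when [s] has no
    constant term. *)
Definition fps_comp s f : {fps R} :=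
  Fps (fun n => \sum_(j < n.+1) f j * (s ^+ j) n).

Lemma coef_fps_comp s f n N : s 0%N = 0 -> (n < N)%N ->
  fps_comp s f n = \sum_(j < N) f j * (s ^+ j) n.
Proof.
move=> s0 lt_nN /=; rewrite (big_ord_widen N (fun j => f j * (s ^+ j) n)) //.
rewrite big_mkcond /=; apply: eq_bigr => j _.
by case: ltnP => // lt_nj; rewrite coef_expr_low ?mulr0.
Qed.

Lemma fps_comp_horner s f n (p : {poly R}) : s 0%N = 0 ->
  (forall j, (j <= n)%N -> p`_j = f j) ->
  (map_poly (@fpsC R) p).[s] n = fps_comp s f n.
Proof.
move=> s0 pf; rewrite (coef_fps_comp f s0 (ltnSn n)).
rewrite (@horner_coef_wide _ (maxn n.+1 (size p))); last first.
  by rewrite (leq_trans (size_poly _ _)) // leq_maxr.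
rewrite coef_fps_sum (big_ord_widen (maxn n.+1 (size p))
  (fun j => f j * (s ^+ j) n)) ?leq_maxl //.
rewrite [RHS]big_mkcond /=; apply: eq_bigr => j _.
rewrite (coef_map (@fpsC R)) [LHS]coef_fpsCM; case: ltnP => [le_jn|lt_nj].
  by rewrite pf.
by rewrite coef_expr_low ?mulr0.
Qed.

Fact fps_comp_is_zmod_morphism s : zmod_morphism (fps_comp s).
Proof.
move=> f g; apply/fpsP => n; rewrite coef_fpsB /= -sumrB.
by apply: eq_bigr => j _; rewrite mulrBl.
Qed.
HB.instance Definition _ s :=
  GRing.isZmodMorphism.Build {fps R} {fps R} (fps_comp s)
    (fps_comp_is_zmod_morphism s).

Lemma fps_compC s c : fps_comp s (fpsC c) = fpsC c.
Proof.
apply/fpsP => n /=; rewrite big_ord_recl big1 => [|i _]; last first.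
  by rewrite mul0r.
rewrite expr0 coef_fps1 addr0 /=; by case: n => [|n]; rewrite ?mulr0 ?mulr1.
Qed.

Lemma fps_comp1 s : fps_comp s 1 = 1.
Proof. exact: (fps_compC s 1). Qed.

(** Modulo a power of the variable, substitution is the evaluation of a
    polynomial, which is multiplicative. *)
Lemma fps_compM s f g : s 0%N = 0 ->
  fps_comp s (f * g) = fps_comp s f * fps_comp s g.
Proof.
move=> s0; apply/fpsP => n.
pose tr (h : {fps R}) := \poly_(i < n.+1) h i.
have trE h i : (i <= n)%N -> (tr h)`_i = h i.
  by move=> le_in; rewrite coef_poly ltnS le_in.
rewrite -(@fps_comp_horner s (f * g) n (tr f * tr g)) //; last first.
  move=> j le_jn; rewrite coefM coef_fpsM; apply: eq_bigr => -[i /= lt_ij] _.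
  by rewrite !trE ?(leq_trans _ le_jn) ?leq_subr.
rewrite rmorphM hornerM !coef_fpsM; apply: eq_bigr => -[i /= le_in] _.
rewrite (@fps_comp_horner s f) ?(@fps_comp_horner s g) // => j le_j; apply: trE.
  by rewrite (leq_trans le_j) ?leq_subr.
by rewrite (leq_trans le_j).
Qed.

Lemma fps_compXn s f n : s 0%N = 0 -> fps_comp s (f ^+ n) = fps_comp s f ^+ n.
Proof.
move=> s0; elim: n => [|n IH]; first exact: fps_comp1.
by rewrite !exprS fps_compM // IH.
Qed.

Lemma fps_compX s : s 0%N = 0 -> fps_comp s (fpsX R) = s.
Proof.
move=> s0; apply/fpsP => n.
rewrite (@coef_fps_comp _ _ _ n.+2) // 2!big_ord_recl /= mul0r add0r mul1r.
by rewrite expr1 big1 ?addr0 // => i _; rewrite mul0r.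
Qed.

Lemma fps_comp_nat s n : fps_comp s n%:R = n%:R.
Proof. by rewrite -fpsC_nat fps_compC. Qed.

Lemma coef0_fps_comp s f : fps_comp s f 0%N = f 0%N.
Proof. by rewrite /= big_ord1 expr0 coef_fps1 mulr1. Qed.

Lemma fps_compV s f : s 0%N = 0 -> f \is a GRing.unit ->
  fps_comp s f^-1 = (fps_comp s f)^-1.
Proof.
move=> s0 uf; have fK : fps_comp s f^-1 * fps_comp s f = 1.
  by rewrite -fps_compM // mulVr // fps_comp1.
have uc : fps_comp s f \is a GRing.unit.
  by apply/unitrPr; exists (fps_comp s f^-1); rewrite mulrC.
by apply: (mulIr uc); rewrite fK mulVr.
Qed.

Lemma fps_compA s f g : s 0%N = 0 -> g 0%N = 0 ->
  fps_comp s (fps_comp g f) = fps_comp (fps_comp s g) f.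
Proof.
move=> s0 g0; apply/fpsP => n.
have sg0 : fps_comp s g 0%N = 0 by rewrite coef0_fps_comp.
rewrite [RHS](coef_fps_comp _ sg0 (ltnSn n)) [LHS](coef_fps_comp _ s0 (ltnSn n)).
transitivity (\sum_(j < n.+1) \sum_(k < n.+1)
    f k * (g ^+ k) j * (s ^+ j) n).
  apply: eq_bigr => j _; rewrite -mulr_suml; congr (_ * _).
  exact: (coef_fps_comp f g0 (ltn_ord j)).
rewrite exchange_big /=; apply: eq_bigr => k _.
rewrite -fps_compXn // (coef_fps_comp _ s0 (ltnSn n)) mulr_sumr.
by apply: eq_bigr => j _; rewrite mulrA.
Qed.

(** When [s] vanishes to order exactly one, every series is a unique series
    in [s]: divide repeatedly by [s]. *)
Lemma fps_comp_surj s f : s 0%N = 0 -> s 1%N = 1 ->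
  exists g, fps_comp s g = f.
Proof.
move=> s0 s1; pose u := fps_shift s.
have sE : s = fpsX R * u by exact: fps_shiftE0.
have uu : u \is a GRing.unit by apply: fps_unit1.
pose T (h : {fps R}) := fps_shift h / u.
pose g : {fps R} := Fps (fun n => iter n T f 0%N).
have TE (h : {fps R}) : h = fpsC (h 0%N) + s * T h.
  by rewrite sE -mulrA [u * _]mulrC divrK // -fps_shiftE.
have fE n : f = \sum_(j < n) fpsC (g j) * s ^+ j + s ^+ n * iter n T f.
  elim: n => [|n IH]; first by rewrite big_ord0 add0r expr0 mul1r.
  rewrite big_ord_recr /= {1}IH -addrA; congr (_ + _).
  rewrite {1}[iter n T f]TE mulrDr; congr (_ + _); first by rewrite mulrC.
  by rewrite mulrA -exprSr.
exists g; apply/fpsP => n.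
rewrite [in RHS](fE n.+1) coef_fpsD coef_fps_sum.
rewrite (@coef_fpsM_low _ _ _ n.+1 0) ?addn0 // => [|i lt_i]; last first.
  exact: coef_expr_low.
by rewrite addr0; apply: eq_bigr => j _; rewrite coef_fpsCM.
Qed.

Lemma fps_comp_inj s : s 0%N = 0 -> s 1%N = 1 -> injective (fps_comp s).
Proof.
move=> s0 s1 f g fg; apply/eqP; rewrite -subr_eq0; apply/negPn/negP.
move=> /fps_neq0_lead[k [hk h0]]; case/eqP: hk.
have /fpsP/(_ k) : fps_comp s (f - g) = 0 by rewrite raddfB /= fg subrr.
rewrite coef_fps0 /= big_ord_recr /= coef_expr_lead // s1 expr1n mulr1.
by rewrite big1 ?add0r // => i _; rewrite [X in X * _](h0 i) ?mul0r.
Qed.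

End Composition.

Lemma horner_fps_comp (R : comNzRingType) (s : {fps R}) (p : {poly R}) :
  s 0%N = 0 ->
  (map_poly (@fpsC R) p).[s] = fps_comp s (Fps (fun n => p`_n)).
Proof. by move=> s0; apply/fpsP => n; apply: fps_comp_horner. Qed.

Lemma coef_mul_comp (R : comNzRingType) (b s f : {fps R}) n : s 0%N = 0 ->
  (b * fps_comp s f) n = \sum_(i < n.+1) f i * (b * s ^+ i) n.
Proof.
move=> s0; rewrite coef_fpsM.
under eq_bigr => k _ do
  rewrite (@coef_fps_comp _ _ _ _ n.+1) ?ltnS ?leq_subr // mulr_sumr.
rewrite exchange_big; apply: eq_bigr => i _.
rewrite coef_fpsM mulr_sumr; apply: eq_bigr => k _; exact: mulrCA.
Qed.

(** * Coefficientwise images *)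

Section Map.
Variables (R S : comNzRingType) (phi : {rmorphism R -> S}).

Fact fps_map_is_zmod_morphism : zmod_morphism (fps_map phi).
Proof. by move=> f g; apply/fpsP => n /=; rewrite rmorphB. Qed.
HB.instance Definition _ := GRing.isZmodMorphism.Build {fps R} {fps S}
  (fps_map phi) fps_map_is_zmod_morphism.

Fact fps_map_is_monoid_morphism : monoid_morphism (fps_map phi).
Proof.
split=> [|f g]; apply/fpsP => n /=.
  by case: eqP => _; rewrite ?rmorph1 ?rmorph0.
by rewrite rmorph_sum; apply: eq_bigr => i _; rewrite rmorphM.
Qed.
HB.instance Definition _ := GRing.isMonoidMorphism.Build {fps R} {fps S}
  (fps_map phi) fps_map_is_monoid_morphism.

Lemma fps_mapX : fps_map phi (fpsX R) = fpsX S.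
Proof. by apply/fpsP => n /=; case: eqP => _; rewrite ?rmorph0 ?rmorph1. Qed.

Lemma fps_map_comp s f :
  fps_map phi (fps_comp s f) = fps_comp (fps_map phi s) (fps_map phi f).
Proof.
apply/fpsP => n /=; rewrite rmorph_sum; apply: eq_bigr => j _.
by rewrite rmorphM -rmorphXn.
Qed.

Lemma fps_map_V f : fps_map phi (V f) = V (fps_map phi f).
Proof. by apply/fpsP => n /=; case: ifP; rewrite ?rmorph0. Qed.

End Map.

Lemma fps_map_inj (R S : Type) (phi : R -> S) :
  injective phi -> injective (fps_map phi).
Proof. by move=> phiI f g /fpsP fg; apply/fpsP => n; apply/phiI/(fg n). Qed.

Lemma fps_map_M_comp (R S : comNzRingType) (phi : {rmorphism R -> S})
    (u s f : {fps R}) :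
  fps_map phi (u * fps_comp s f)
  = fps_map phi u * fps_comp (fps_map phi s) (fps_map phi f).
Proof. by rewrite rmorphM /= fps_map_comp. Qed.

(** * Exponents modulo 3 *)

Section ThreeSections.
Variable R : comNzRingType.
Implicit Types (f g h s : {fps R}).

Lemma coef_V f n : V f n = if (3 %| n)%N then f (n %/ 3)%N else 0.
Proof. by []. Qed.

Lemma coef_V3 f n : V f (3 * n)%N = f n.
Proof. by rewrite coef_V dvdn_mulr // mulKn. Qed.

Lemma V_comp f : V f = fps_comp (fpsX R ^+ 3) f.
Proof.
apply/fpsP => n; rewrite coef_V /=.
under eq_bigr do rewrite -exprM coef_fpsXn.
case: ifP => [/dvdnP[k ->]|ndv].
  have lt_k : (k < (k * 3).+1)%N by lia.
  rewrite mulnK // (bigD1 (Ordinal lt_k)) //=.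
  rewrite (_ : (k * 3 == 3 * k)%N = true) ?mulr1; last by rewrite mulnC eqxx.
  rewrite big1 ?addr0 // => j; rewrite -val_eqE /= => /negPf njk.
  by rewrite (_ : (k * 3 == 3 * j)%N = false) ?mulr0 //; lia.
rewrite big1 // => j _; case: eqP => [nE|]; rewrite ?mulr0 //.
by rewrite nE dvdn_mulr in ndv.
Qed.

Fact V_is_zmod_morphism : zmod_morphism (@V R).
Proof. by move=> f g; rewrite !V_comp raddfB. Qed.
HB.instance Definition _ :=
  GRing.isZmodMorphism.Build {fps R} {fps R} (@V R) V_is_zmod_morphism.

Fact V_is_monoid_morphism : monoid_morphism (@V R).
Proof.
split=> [|f g]; rewrite !V_comp ?fps_comp1 ?fps_compM //.
by rewrite exprS coef0_fpsM mul0r.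
Qed.
HB.instance Definition _ :=
  GRing.isMonoidMorphism.Build {fps R} {fps R} (@V R) V_is_monoid_morphism.

Lemma VC c : V (fpsC c) = fpsC c :> {fps R}.
Proof. by rewrite V_comp fps_compC. Qed.

Lemma coef0_V f : V f 0%N = f 0%N. Proof. by []. Qed.

Lemma V_fps_comp s f : s 0%N = 0 -> V (fps_comp s f) = fps_comp (V s) f.
Proof.
move=> s0; have X30 : (fpsX R ^+ 3) 0%N = 0 by rewrite coef_fpsXn.
by rewrite !V_comp fps_compA.
Qed.

(** The index is read modulo 3, so that the sections of a product are indexed
    by sums. *)
Definition sec3 (r : nat) f : {fps R} :=
  Fps (fun n => if (n %% 3 == r %% 3)%N then f n else 0).

Fact sec3_is_zmod_morphism r : zmod_morphism (sec3 r).
Proof. by move=> f g; apply/fpsP => n /=; case: ifP; rewrite ?subrr. Qed.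
HB.instance Definition _ r := GRing.isZmodMorphism.Build {fps R} {fps R}
  (sec3 r) (sec3_is_zmod_morphism r).

Lemma coef_sec3 r f n : sec3 r f n = if (n %% 3 == r %% 3)%N then f n else 0.
Proof. by []. Qed.

Lemma sec3_mod r f : sec3 (r %% 3) f = sec3 r f.
Proof. by apply/fpsP => n /=; rewrite modn_mod. Qed.

Lemma sec3_split f : f = sec3 0 f + sec3 1 f + sec3 2 f.
Proof.
apply/fpsP => n; rewrite !coef_fpsD !coef_sec3.
by move: (ltn_pmod n (isT : 0 < 3)%N); case: (n %% 3)%N => [|[|[|]]] //=;
  rewrite ?addr0 ?add0r.
Qed.

Lemma sec3_sec3 r f : sec3 r (sec3 r f) = sec3 r f.
Proof. by apply/fpsP => n /=; case: eqP. Qed.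

Lemma sec3_mul i r h f : sec3 i h = h -> sec3 (i + r) (h * f) = h * sec3 r f.
Proof.
move=> hE; apply/fpsP => n; rewrite coef_sec3 !coef_fpsM.
have h0 k : (k %% 3 != i %% 3)%N -> h k = 0.
  by move=> /negPf hk; rewrite -hE coef_sec3 hk.
case: ifPn => [/eqP nE|nN]; last symmetry; last first.
  rewrite big1 // => -[k /= le_kn] _.
  have [ki|/h0->] := eqVneq (k %% 3)%N (i %% 3)%N; last by rewrite mul0r.
  by case: eqP => [kr|]; rewrite ?mulr0 //; lia.
apply: eq_bigr => -[k /= le_kn] _.
have [ki|/h0->] := eqVneq (k %% 3)%N (i %% 3)%N; last by rewrite !mul0r.
by case: eqP => [//|kr]; lia.
Qed.

Lemma sec3_prod i j h g : sec3 i h = h -> sec3 j g = g ->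
  sec3 (i + j) (h * g) = h * g.
Proof. by move=> hE gE; rewrite sec3_mul // gE. Qed.

Lemma sec3_neq i j h : (i %% 3 != j %% 3)%N -> sec3 i h = h -> sec3 j h = 0.
Proof.
move=> ij hE; apply/fpsP => n; rewrite coef_fps0 coef_sec3.
by rewrite -hE coef_sec3; case: eqP => // ->; rewrite eq_sym (negPf ij).
Qed.

Lemma sec3_V f : sec3 0 (V f) = V f.
Proof. by apply/fpsP => n /=; rewrite /dvdn; case: eqP => //; case: eqP. Qed.

Lemma sec3C c : sec3 0 (fpsC c) = fpsC c :> {fps R}.
Proof. by rewrite -VC sec3_V. Qed.

End ThreeSections.

Lemma fps_map_sec3 (R S : comNzRingType) (phi : {rmorphism R -> S}) r f :
  fps_map phi (sec3 r f) = sec3 r (fps_map phi f).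
Proof. by apply/fpsP => n /=; case: ifP; rewrite ?rmorph0. Qed.

(** The derivation [X d/dX]. *)
Definition euler (R : comNzRingType) (f : {fps R}) : {fps R} :=
  Fps (fun n => n%:R * f n).

Lemma eulerM (R : comNzRingType) (f g : {fps R}) :
  euler (f * g) = euler f * g + f * euler g.
Proof.
apply/fpsP => n; rewrite coef_fpsD !coef_fpsM /= mulr_sumr -big_split /=.
apply: eq_bigr => -[i /= le_in] _.
rewrite -{1}(subnKC (ltnSE le_in)) natrD; ring.
Qed.

(** * Lambert series *)

Section EqMod.
Variable R : comNzRingType.
Implicit Types (f g h : {fps R}).

Definition eqmX k f g := forall n, (n < k)%N -> f n = g n.

Lemma eqmX_all f g : (forall k, eqmX k f g) -> f = g.
Proof. by move=> fg; apply/fpsP => n; apply: (fg n.+1). Qed.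

Lemma eqmXD k f f' g g' :
  eqmX k f f' -> eqmX k g g' -> eqmX k (f + g) (f' + g').
Proof. by move=> ff gg n nk; rewrite !coef_fpsD ff ?gg. Qed.

Lemma eqmXM k f f' g g' :
  eqmX k f f' -> eqmX k g g' -> eqmX k (f * g) (f' * g').
Proof.
move=> ff gg n nk; rewrite !coef_fpsM; apply: eq_bigr => -[i /= le_in] _.
by rewrite ff ?gg //; lia.
Qed.

Lemma eqmX_sum k (I : Type) (r : seq I) (P : pred I) (F G : I -> {fps R}) :
  (forall i, P i -> eqmX k (F i) (G i)) ->
  eqmX k (\sum_(i <- r | P i) F i) (\sum_(i <- r | P i) G i).
Proof.
by move=> FG n nk; rewrite !coef_fps_sum; apply: eq_bigr => i /FG ->.
Qed.

Lemma eqmX_trans k f g h : eqmX k f g -> eqmX k g h -> eqmX k f h.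
Proof. by move=> fg geis n nk; rewrite fg ?geis. Qed.

Lemma eqmX_sym k f g : eqmX k f g -> eqmX k g f.
Proof. by move=> fg n nk; rewrite fg. Qed.

End EqMod.

Section Lambert.
Variable R : comNzRingType.
Implicit Types (x : R) (m r n : nat).

(** The expansion of [(x q^m)^r / (1 - (x q^m)^3)]. *)
Definition lambert x m r : {fps R} :=
  Fps (fun n => if (m %| n)%N && ((n %/ m) %% 3 == r)%N then x ^+ (n %/ m)
                else 0).

Lemma lambertE x m r : (0 < m)%N -> (r < 3)%N -> (0 < r)%N ->
  (1 - fpsX R ^+ (3 * m) * fpsC x ^+ 3) * lambert x m r
  = (fpsX R ^+ m * fpsC x) ^+ r.
Proof.
move=> m0 r3 r0; apply/fpsP => n.
have CX k : fpsC x ^+ k = fpsC (x ^+ k) by rewrite rmorphXn.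
rewrite mulrBl mul1r coef_fpsB -mulrA coef_fpsXnM exprMn -exprM !CX.
rewrite coef_fpsMC coef_fpsXn coef_fpsCM.
have [/dvdnP[d ->]|nd] := boolP (m %| n)%N; last first.
  rewrite (_ : (n == m * r)%N = false) ?mul0r; last first.
    by apply: contraNF nd => /eqP->; rewrite dvdn_mulr.
  have -> : lambert x m r n = 0 by rewrite /= (negPf nd).
  case: leqP => [le_n|]; rewrite ?subr0 //.
  rewrite /= (_ : (m %| n - 3 * m)%N = false) ?mulr0 ?subr0 //.
  by apply: contraNF nd; rewrite dvdn_subl ?dvdn_mull.
have lamE k : lambert x m r (k * m)%N = if (k %% 3 == r)%N then x ^+ k else 0.
  by rewrite /= dvdn_mull // mulnK.
rewrite leq_pmul2r // -mulnBl !lamE [(m * r)%N]mulnC eqn_pmul2r //.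
have [lt_d3|le_3d] := ltnP d 3.
  by rewrite subr0 modn_small //; case: eqP => [->|]; rewrite ?mul1r ?mul0r.
rewrite (_ : ((d - 3) %% 3 = d %% 3)%N); last by lia.
rewrite (_ : (d == r) = false) ?mul0r; last by lia.
by case: eqP => _; rewrite ?mulr0 ?subrr // -exprD subnKC // subrr.
Qed.

Lemma lambert_low x m r n : (0 < r)%N -> (n < m)%N -> lambert x m r n = 0.
Proof.
move=> r0 nm /=; case: ifP => // /andP[/dvdnP[d nE] /eqP dr]; move: nm dr.
by rewrite nE; case: d {nE} => [|d] //; [rewrite mul0n div0n; lia|nia].
Qed.

(** The divisor [d] of [n] comes from the series with [m = n / d]. *)
Lemma sum_lambert x M r n : (0 < n <= M)%N ->
  \sum_(1 <= m < M.+1) lambert x m r n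
  = \sum_(d <- divisors n | (d %% 3 == r)%N) x ^+ d.
Proof.
move=> /andP[n0 nM].
pose s := [seq (n %/ m)%N | m <- index_iota 1 M.+1 & (m %| n)%N].
have p : perm_eq s (divisors n).
  apply: uniq_perm; last 1 first.
  - move=> d; rewrite -dvdn_divisors //; apply/mapP/idP => [[m]|dvd].
      rewrite mem_filter => /andP[mn _] ->.
      by apply/dvdnP; exists m; rewrite mulnC divnK.
    exists (n %/ d)%N; last by rewrite divnA // mulKn.
    rewrite mem_filter mem_index_iota; apply/andP; split.
      by apply/dvdnP; exists d; rewrite mulnC divnK.
    have d0 : (0 < d)%N by apply: dvdn_gt0 dvd.
    rewrite divn_gt0 // dvdn_leq //= ltnS.
    by apply: leq_trans nM; apply: leq_div.
  - rewrite map_inj_in_uniq ?filter_uniq ?iota_uniq // => m m'.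
    rewrite !mem_filter => /andP[mn _] /andP[mn' _] e.
    have q0 : (0 < n %/ m')%N.
      by rewrite divn_gt0; [exact: dvdn_leq|exact: dvdn_gt0 mn'].
    apply/eqP; rewrite -(eqn_pmul2r q0) -{1}e.
    by rewrite [X in X == _]mulnC [X in _ == X]mulnC !divnK.
  - exact: divisors_uniq.
rewrite -(perm_big _ p) /= big_map big_filter_cond /= [RHS]big_mkcond /=.
by rewrite [LHS]big_seq [RHS]big_seq; apply: eq_bigr => m _.
Qed.

End Lambert.

(** * The square of a Lambert series in two variables *)

(** The exponential series [e^(c z)]. *)
Definition expz (c : rat) : {fps rat} := Fps (fun n => c ^+ n / (n`!)%:R).

Lemma expz0 : expz 0 = 1.
Proof.
by apply/fpsP => -[|n]; rewrite coef_fps1 /= ?expr0 ?fact0 ?divr1 // exprS !mul0r.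
Qed.

Lemma expzD c d : expz c * expz d = expz (c + d).
Proof.
apply/fpsP => n; rewrite coef_fpsM /= addrC exprDn mulr_suml.
apply: eq_bigr => -[i /= le_in] _.
have fact_n0 m : (m`!)%:R != 0 :> rat by rewrite pnatr_eq0 -lt0n fact_gt0.
have := bin_fact (ltnSE le_in) => /(congr1 (fun k => k%:R : rat)).
rewrite !natrM -mulr_natr => <-.
have b0 : ('C(n, i))%:R != 0 :> rat by rewrite pnatr_eq0 -lt0n bin_gt0 -ltnS.
by field; rewrite ?fact_n0 ?b0.
Qed.

Lemma expzXn c n : expz c ^+ n = expz (c *+ n).
Proof. by elim: n => [|n IH]; rewrite ?expz0 // exprS IH expzD -mulrS. Qed.

Lemma euler_expz c : euler (expz c) = fpsX rat * (fpsC c * expz c).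
Proof.
apply/fpsP => -[|n]; rewrite coef_fpsXM ?coef_fpsCM /= ?mul0r //.
rewrite factS natrM exprS; field.
by rewrite nat1r !pnatr_eq0 -lt0n fact_gt0.
Qed.

Lemma sqr_sum (R : comNzRingType) (x : nat -> R) n :
  (\sum_(0 <= i < n) x i) ^+ 2 = \sum_(0 <= i < n) x i ^+ 2
    + 2%:R * \sum_(0 <= j < n) \sum_(0 <= i < j) x i * x j.
Proof.
elim: n => [|n IH]; first by rewrite !big_geq // expr2 mul0r mulr0 addr0.
rewrite !big_nat_recr //= sqrrD IH -mulr_suml mulrDr -mulr_natl; ring.
Qed.

(** The pairs [i < j] are grouped by the index that [x] carries; the other
    index only enters through the difference. *)
Lemma sum_pairs (R : comNzRingType) (x A B : nat -> R) n :
  \sum_(0 <= j < n) \sum_(0 <= i < j) (A (j - i)%N * x i - B (j - i)%N * x j)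
  = \sum_(0 <= i < n)
      x i * (\sum_(1 <= r < (n - i)%N) A r - \sum_(1 <= r < i.+1) B r).
Proof.
elim: n => [|n IH]; first by rewrite !big_geq.
rewrite [LHS]big_nat_recr //= [RHS]big_nat_recr //= {}IH subSnn.
rewrite [\sum_(1 <= r < 1) _]big_geq // sub0r.
have -> : \sum_(0 <= i < n) x i * (\sum_(1 <= r < (n.+1 - i)%N) A r
      - \sum_(1 <= r < i.+1) B r)
  = \sum_(0 <= i < n) x i * (\sum_(1 <= r < (n - i)%N) A r
      - \sum_(1 <= r < i.+1) B r) + \sum_(0 <= i < n) A (n - i)%N * x i.
  rewrite -big_split /=; apply: eq_big_nat => i /andP[_ lt_in].
  rewrite subSn; last exact: ltnW.
  rewrite big_nat_recr /=; [ring | by rewrite subn_gt0].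
rewrite sumrB -addrA; congr (_ + (_ + _)).
rewrite mulrN; congr (- _).
rewrite -mulr_suml mulrC; congr (_ * _).
rewrite [RHS](big_addn 0 n.+1 1) subn1 /= [RHS]big_nat_rev /=.
by apply: eq_big_nat => i lt_in; congr B; lia.
Qed.

(** Partial fractions for [x y / ((1 - x^3)(1 - y^3))] with [y = Q x], written
    with [x = N1 / D1] and [y = N2 / D2]. *)
Lemma partial_fractions (R : comNzRingType) (N1 D1 k1 N2 D2 k2 z Q : R) :
  N2 * D1 = Q * N1 * D2 ->
  k1 * (D1 ^+ 3 - N1 ^+ 3) = z -> k2 * (D2 ^+ 3 - N2 ^+ 3) = z ->
  (1 - Q ^+ 3) * ((N1 * D1 ^+ 2 * k1) * (N2 * D2 ^+ 2 * k2))
  = z * (Q * (N1 ^+ 2 * D1 * k1) - Q ^+ 2 * (N2 ^+ 2 * D2 * k2)).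
Proof.
move=> e z1 z2; apply/eqP; rewrite -subr_eq0 mulrBr {1}(esym z2) -{1}z1.
rewrite [X in X == _](_ : _ = k1 * k2 * (N1 * D1 * D2 ^+ 2
  + Q * N1 ^+ 2 * N2 ^+ 2 + Q ^+ 2 * D1 ^+ 2 * D2 * N2)
  * (N2 * D1 - Q * N1 * D2)); last by ring.
by rewrite e subrr mulr0.
Qed.

(** The series [sum_n (sum_(d | n) chi(d)) q^n], [chi] being the quadratic
    character modulo 3. *)
Definition chiser (R : comNzRingType) : {fps R} := Fps (fun n =>
  if n == 0%N then 0 else
  \sum_(d <- divisors n | (d %% 3 == 1)%N) 1
  - \sum_(d <- divisors n | (d %% 3 == 2)%N) 1).

Section Hexagonal.
Variable R : comNzRingType.

(** Over the rationals, the theta series of the hexagonal lattice: see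
    [theta_hexser]. *)
Definition hexser : {fps R} := 1 + 6%:R * chiser R.

Lemma coef0_hexser : hexser 0%N = 1.
Proof. by rewrite coef_1natD mulr0 addr0. Qed.

Lemma hexser_unit : hexser \is a GRing.unit.
Proof. exact/fps_unit1/coef0_hexser. Qed.

Lemma Vhexser_unit : V hexser \is a GRing.unit.
Proof. by apply: fps_unit1; rewrite coef0_V coef0_hexser. Qed.

End Hexagonal.

Section LambertIdentity.

Local Notation z := (fpsX rat).
Local Notation u := (expz 1).
Local Notation v := (expz (-1)).

Let uv : u * v = 1. Proof. by rewrite expzD subrr expz0. Qed.

(* discharges the unit conditions of [unitrX] below, by assumption *)
Let u_unit : u \is a GRing.unit. Proof. by apply/unitrPr; exists v. Qed.

(** [z / (1 - e^(3z))], a power series although the quotient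
    [1 / (1 - e^(3z))] has a pole. *)
Definition polar : {fps rat} := - (fps_shift (u ^+ 3 - 1))^-1.

Arguments polar : simpl never.

Lemma polarE : polar * (1 - u ^+ 3) = z.
Proof.
have u30 : (u ^+ 3 - 1) 0%N = 0.
  by rewrite coef_fpsB expzXn coef_fps1 /= expr0 fact0 divr1 subrr.
rewrite /polar mulNr -mulrN opprB {2}[u ^+ 3 - 1](fps_shiftE0 u30) mulrCA.
rewrite mulVr ?mulr1 // fps_unitE (_ : fps_shift _ 0%N = 3%:R) //.
by rewrite expzXn /= expr1 subr0 divr1.
Qed.

(** The coefficients of [z sum_(m in Z) c_r(q^m e^z)], where
    [c_r(x) = x^r / (1 - x^3)] and [c_r] is expanded at infinity for
    [m < 0]. *)
Definition lamser (r : nat) : {fps {fps rat}} := Fps (fun n =>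
  if n == 0%N then u ^+ r * polar else
  z * (\sum_(d <- divisors n | (d %% 3 == r)%N) u ^+ d
       - \sum_(d <- divisors n | (d %% 3 == 3 - r)%N) v ^+ d)).

(** The derivation [z d/dz] on series in [q] over series in [z]. *)
Definition eulz (f : {fps {fps rat}}) : {fps {fps rat}} := Fps (fun n => euler (f n)).

Let eulzM f g : eulz (f * g) = eulz f * g + f * eulz g.
Proof.
apply/fpsP => n; rewrite coef_fpsD !coef_fpsM /=.
have eul_sum (I : Type) (r : seq I) (F : I -> {fps rat}) :
    euler (\sum_(i <- r) F i) = \sum_(i <- r) euler (F i).
  apply/fpsP => j; rewrite coef_fps_sum /= coef_fps_sum mulr_sumr.
  by [].
rewrite eul_sum -big_split /=.
by apply: eq_bigr => i _; rewrite eulerM.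
Qed.

Let eulzC c : eulz (fpsC c) = fpsC (euler c).
Proof.
by apply/fpsP => -[|n] //=; apply/fpsP => j; rewrite /= !if_same mulr0.
Qed.

Let eulzXn k : eulz (fpsX _ ^+ k) = 0.
Proof.
apply/fpsP => n; rewrite coef_fps0 /= coef_fpsXn; apply/fpsP => j.
rewrite coef_fps0 /=; case: (n == k); rewrite ?coef_fps0 ?mulr0 //.
by rewrite coef_fps1; case: j => [|j]; rewrite ?mul0r ?mulr0.
Qed.

Local Notation q := (fpsX {fps rat}).
Local Notation Z := (fpsC z).
Local Notation U := (fpsC u).
Local Notation W := (fpsC v).

(* Truncated subtraction makes [num M i / den M i] equal to [q ^ (i - M) e^z]
   for every [i], on both sides of [M]; then [kap M i] and [cc M r i] are
   [z / (1 - x^3)] over [den M i ^+ 3] and [z x^r / (1 - x^3)] at that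
   [x]. *)
Definition num M i := q ^+ (i - M) * U.
Definition den M i := q ^+ (M - i).
Definition kap M i :=
  if i == M then fpsC polar else Z / (den M i ^+ 3 - num M i ^+ 3).
Definition cc M r i := num M i ^+ r * den M i ^+ (3 - r) * kap M i.

Let A r := lambert (1 : {fps rat}) r 1.
Let B r := lambert (1 : {fps rat}) r 2.

Section Truncation.
Variable M : nat.

Local Notation num := (num M).
Local Notation den := (den M).
Local Notation kap := (kap M).
Local Notation cc := (cc M).

Let UW : U * W = 1. Proof. by rewrite -rmorphM uv rmorph1. Qed.

Let q0 k : (0 < k)%N -> (q ^+ k) 0%N = 0.
Proof. by case: k => // k _; rewrite coef0_fpsX expr0n. Qed.

Let Delta_unit i : i != M -> den i ^+ 3 - num i ^+ 3 \is a GRing.unit.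
Proof.
move=> iM; rewrite fps_unitE coef_fpsB !coef0_fpsX coef0_fpsM.
rewrite !coef0_fpsX (_ : q 0%N = 0) // (_ : U 0%N = u) // !expr0n.
have [lt_iM|le_Mi] := ltnP i M.
  rewrite !subn_eq0 leqNgt lt_iM ltnW // mul1r expr0n sub0r unitrN.
  by rewrite unitrX.
have lt_Mi : (M < i)%N by rewrite ltn_neqAle eq_sym iM.
rewrite !subn_eq0 le_Mi leqNgt lt_Mi /= mul0r expr0n expr1n subr0.
exact: unitr1.
Qed.

Let kapE i : kap i * (den i ^+ 3 - num i ^+ 3) = Z.
Proof.
rewrite /kap; have [->|iM] := eqVneq i M; last by rewrite divrK ?Delta_unit.
rewrite /den /num subnn expr0 mul1r expr1n -[1](rmorph1 (@fpsC _)).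
by rewrite -rmorphXn -rmorphB -rmorphM polarE.
Qed.

Let ccM i j : (i < j)%N -> (1 - q ^+ (3 * (j - i))) * (cc 1 i * cc 1 j)
  = Z * (q ^+ (j - i) * cc 2 i - q ^+ (2 * (j - i)) * cc 2 j).
Proof.
move=> lt_ij; rewrite ![(_ * (j - i))%N]mulnC !exprM /cc !expr1.
apply: partial_fractions; [|exact: kapE|exact: kapE].
rewrite /num /den [_ * U * _]mulrAC -exprD -!mulrA [U * _]mulrC !mulrA -!exprD.
by congr (q ^+ _ * _); lia.
Qed.

Let ccD r i : (den i ^+ 3 - num i ^+ 3) * cc r i
  = num i ^+ r * den i ^+ (3 - r) * Z.
Proof. by rewrite [LHS]mulrC -[LHS]mulrA kapE. Qed.

Let lam1E i r : (M < i)%N -> (0 < r < 3)%N ->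
  cc r i = Z * lambert u (i - M) r.
Proof.
move=> lt_Mi /andP[r0 r3].
have De : den i = 1 by rewrite /den (_ : (M - i = 0)%N) //; lia.
have iM : i != M by rewrite neq_ltn lt_Mi orbT.
have lE : (1 - num i ^+ 3) * lambert u (i - M) r = num i ^+ r.
  have := @lambertE _ u (i - M) r; rewrite subn_gt0 lt_Mi r0 r3.
  by rewrite [(3 * _)%N]mulnC exprM -exprMn => /(_ isT isT isT).
apply: (mulrI (Delta_unit iM)); rewrite ccD De !expr1n.
by rewrite mulr1 mulrCA lE mulrC.
Qed.

Let lam2E i r : (i < M)%N -> (0 < r < 3)%N ->
  cc r i = - Z * lambert v (M - i) (3 - r).
Proof.
move=> lt_iM /andP[r0 r3].
have Ne : num i = U by rewrite /num (_ : (i - M = 0)%N) ?mul1r //; lia.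
have iM : i != M by rewrite neq_ltn lt_iM.
have lE : (1 - (den i * W) ^+ 3) * lambert v (M - i) (3 - r)
    = (den i * W) ^+ (3 - r).
  have := @lambertE _ v (M - i) (3 - r); rewrite !subn_gt0 lt_iM r3.
  rewrite [(3 * _)%N]mulnC exprM -exprMn => /(_ isT _ isT) -> //.
  by rewrite ltn_subrL r0.
have De : den i ^+ 3 - num i ^+ 3 = - U ^+ 3 * (1 - (den i * W) ^+ 3).
  rewrite Ne [(_ * W) ^+ 3]exprMn mulrBr mulr1 mulNr opprK addrC.
  by rewrite mulrCA -exprMn UW expr1n mulr1.
apply: (mulrI (Delta_unit iM)); rewrite ccD mulrCA {}De -[- U ^+ 3 * _ * _]mulrA lE Ne.
have -> : U ^+ 3 = U ^+ r * U ^+ (3 - r) by rewrite -exprD subnKC // ltnW.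
have e : U ^+ (3 - r) * W ^+ (3 - r) = 1 by rewrite -exprMn UW expr1n.
rewrite exprMn -[LHS]mulr1 -e.
move: (U ^+ r) (U ^+ _) (W ^+ _) (den i ^+ _) => a b c d; ring.
Qed.

Let eulz_num i : eulz (num i) = Z * num i.
Proof.
by rewrite eulzM eulzXn mul0r add0r eulzC euler_expz rmorph1 mul1r rmorphM mulrCA.
Qed.

(* The double pole: [x d/dx] of [x^2 / (1 - x^3)] involves the square of
   [x / (1 - x^3)]. *)
Let ccS i : 3%:R * cc 1 i ^+ 2 = eulz (cc 2 i) - cc 2 i + Z * cc 2 i.
Proof.
have Z0 : Z != 0.
  by apply/eqP => /fpsP/(_ 0%N)/fpsP/(_ 1%N); rewrite coef_fps0 coef_fps0.
have dk : eulz (kap i) = kap i * (1 + 3%:R * num i ^+ 3 * kap i).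
  have : eulz (kap i * (den i ^+ 3 - num i ^+ 3)) = Z.
    rewrite kapE eulzC; congr fpsC; apply/fpsP => -[|[|j]] /=;
    by rewrite ?mulr0 ?mul0r ?mulr1.
  rewrite eulzM.
  have -> : eulz (den i ^+ 3 - num i ^+ 3) = - (3%:R * Z * num i ^+ 3).
    have eulzB f g : eulz (f - g) = eulz f - eulz g.
      by apply/fpsP => n; apply/fpsP => j; rewrite /= mulrBr.
    rewrite eulzB -exprM eulzXn sub0r; congr (- _).
    have eulzX3 f : eulz (f ^+ 3) = 3%:R * f ^+ 2 * eulz f.
      by rewrite !exprS expr0 mulr1 !eulzM; ring.
    by rewrite eulzX3 eulz_num; ring.
  have alg (k x D N y : {fps {fps rat}}) :
      k * (x * D + k * - (3%:R * y * N)) = k * y -> k * D = y ->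
      x * y = k * (1 + 3%:R * N * k) * y.
    move=> e kD; rewrite -{1}kD.
    transitivity (k * (x * D + k * - (3%:R * y * N)) + 3%:R * k ^+ 2 * y * N).
      by ring.
    by rewrite e; ring.
  move=> /(congr1 ( *%R (kap i))) e; apply: (mulIf Z0).
  apply: alg e (kapE i).
have eulz3 f g h : eulz (f ^+ 2 * g * h)
    = 2%:R * f * eulz f * g * h + f ^+ 2 * eulz g * h + f ^+ 2 * g * eulz h.
  by rewrite !eulzM; ring.
rewrite /cc eulz3 eulz_num [eulz (_ ^+ 1)]eulzXn dk -(kapE i) !subSS !subn0 !expr1.
move: (num i) (den i) (kap i) => N D k; ring.
Qed.

Let ccAB i j : (i < j)%N ->
  cc 1 i * cc 1 j = Z * (A (j - i)%N * cc 2 i - B (j - i)%N * cc 2 j).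
Proof.
move=> lt_ij; have ji0 : (0 < j - i)%N by rewrite subn_gt0.
have d0 : 1 - q ^+ (3 * (j - i)) != 0.
  apply/eqP => /fpsP/(_ 0%N); rewrite coef_fpsB q0 ?muln_gt0 // subr0.
  by rewrite coef_fps0 coef_fps1 => /eqP; rewrite oner_eq0.
have := @lambertE {fps rat} 1 (j - i) 1; have := @lambertE {fps rat} 1 (j - i) 2.
rewrite rmorph1 expr1n !mulr1 ji0 => /(_ isT isT isT) BE /(_ isT isT isT) AE.
have alg (X a b qa qb x y t : {fps {fps rat}}) : X * a = qa -> X * b = qb ->
    t * (qa * x - qb * y) = X * (t * (a * x - b * y)) by move=> <- <-; ring.
apply: (mulfI d0); rewrite ccM // [(2 * _)%N]mulnC exprM.
exact: alg AE BE.
Qed.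

Let sumAB R1 R2 n : (n < R1)%N -> (n < R2)%N ->
  (\sum_(1 <= r < R1) A r - \sum_(1 <= r < R2) B r) n = chiser {fps rat} n.
Proof.
move=> n1 n2; rewrite coef_fpsB !coef_fps_sum.
have [->|n0] := posnP n.
  have lam0 r s : (0 < s)%N -> lambert (1 : {fps rat}) r s 0%N = 0.
    by rewrite /= div0n mod0n; case: s => // s _; rewrite andbF.
  by rewrite [RHS]/= !big1 ?subrr // => r _; apply: lam0.
case: R1 R2 n1 n2 => [|R1] // [|R2] // n1 n2.
rewrite /A /B !sum_lambert ?n0 // [RHS]/= gtn_eqF //.
by congr (_ - _); apply: eq_bigr => d _; rewrite expr1n.
Qed.

Let cc2_low i n : (n < (i - M) + (M - i))%N -> cc 2 i n = 0.
Proof.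
have [lt_iM|lt_Mi|->] := ltngtP i M; last by rewrite subnn.
  rewrite (_ : (i - M = 0)%N) ?add0n; last by lia.
  move=> lt_n; rewrite lam2E // mulNr coef_fpsN coef_fpsCM.
  by rewrite (@lambert_low _ v) ?mulr0 ?oppr0.
rewrite (_ : (M - i = 0)%N) ?addn0; last by lia.
by move=> lt_n; rewrite lam1E // coef_fpsCM (@lambert_low _ u) ?mulr0.
Qed.

Let S r := \sum_(0 <= i < (2 * M).+1) cc r i.

Let S_sqr : eqmX M.+1 (S 1 ^+ 2) (\sum_(0 <= i < (2 * M).+1) cc 1 i ^+ 2
  + 2%:R * Z * chiser _ * S 2).
Proof.
rewrite /S sqr_sum.
have -> : \sum_(0 <= j < (2 * M).+1) \sum_(0 <= i < j) cc 1 i * cc 1 j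
  = Z * \sum_(0 <= j < (2 * M).+1) \sum_(0 <= i < j)
      (A (j - i)%N * cc 2 i - B (j - i)%N * cc 2 j).
  rewrite mulr_sumr; apply: eq_big_nat => j _; rewrite mulr_sumr.
  by apply: eq_big_nat => i /andP[_ ij]; rewrite ccAB.
have -> : 2%:R * Z * chiser _ * S 2 = 2%:R * Z *
    \sum_(0 <= i < (2 * M).+1) cc 2 i * chiser _.
  by rewrite -mulr_suml /S; ring.
rewrite sum_pairs mulrA; apply: eqmXD => //; apply: eqmXM => //.
apply: eqmX_sum => i _ n n_lt; apply/eqP; rewrite -subr_eq0 -coef_fpsB -mulrBr.
rewrite (@coef_fpsM_low _ _ _ (i - M + (M - i))
  (minn ((2 * M).+1 - i) i.+1)) //; last by lia.
  exact: cc2_low.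
by move=> k k_lt; rewrite coef_fpsB sumAB ?subrr //; lia.
Qed.

Let S_lamser r : (0 < r < 3)%N -> eqmX M.+1 (S r) (lamser r).
Proof.
move=> r03 n n_lt; rewrite /S coef_fps_sum.
have split3 (F : nat -> {fps rat}) : \sum_(0 <= i < (2 * M).+1) F i
    = \sum_(0 <= i < M) F i + (F M + \sum_(M.+1 <= i < (2 * M).+1) F i).
  by rewrite -big_ltn -?big_cat_nat //; lia.
rewrite split3.
have -> : \sum_(0 <= i < M) cc r i n
  = - z * \sum_(1 <= m < M.+1) lambert v m (3 - r) n.
  rewrite mulr_sumr big_nat_rev big_add1; apply: eq_big_nat => i /andP[_ iM].
  rewrite lam2E // ?mulNr ?coef_fpsN ?coef_fpsCM; last by lia.
  by congr (- (_ * lambert _ _ _ _)); lia.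
have -> : \sum_(M.+1 <= i < (2 * M).+1) cc r i n
  = z * \sum_(1 <= m < M.+1) lambert u m r n.
  rewrite mulr_sumr -[X in index_iota X (2 * M).+1]add1n big_addn.
  rewrite (_ : ((2 * M).+1 - M = M.+1)%N); last by lia.
  apply: eq_big_nat => i /andP[i0 iM].
  by rewrite lam1E; [rewrite coef_fpsCM; congr (_ * lambert _ _ _ _)| |]; lia.
have -> : cc r M n = if n == 0%N then u ^+ r * polar else 0.
  rewrite /cc /kap eqxx /num /den subnn !expr0 mul1r expr1n mulr1.
  by rewrite -rmorphXn -rmorphM.
rewrite /=; case: eqP => [->|/eqP n0].
  rewrite !big1_seq ?mulr0 ?add0r ?addr0 // => m; rewrite mem_index_iota.
    by move=> /andP[_ /andP[m0 _]]; apply: lambert_low => //; lia.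
  by move=> /andP[_ /andP[m0 _]]; apply: lambert_low => //; lia.
by rewrite !sum_lambert ?lt0n ?n0 //; ring.
Qed.

Lemma lamser_sqr_trunc : eqmX M.+1 (3%:R * lamser 1 ^+ 2)
  (eulz (lamser 2) + (6%:R * Z * chiser _ - 1 + Z) * lamser 2).
Proof.
have S1 := @S_lamser 1 isT; have S2 := @S_lamser 2 isT.
apply: (@eqmX_trans _ _ _ (3%:R * S 1 ^+ 2)).
  by apply: eqmXM => //; rewrite !expr2; apply: eqmXM; apply: eqmX_sym.
apply: (@eqmX_trans _ _ _
  (eulz (S 2) + (6%:R * Z * chiser _ - 1 + Z) * S 2)); last first.
  apply: eqmXD; last exact: eqmXM.
  by move=> n n_lt /=; rewrite S2.
apply: (@eqmX_trans _ _ _ (3%:R * (\sum_(0 <= i < (2 * M).+1) cc 1 i ^+ 2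
  + 2%:R * Z * chiser _ * S 2))); first by apply: eqmXM => //; apply: S_sqr.
have -> : 3%:R * (\sum_(0 <= i < (2 * M).+1) cc 1 i ^+ 2
  + 2%:R * Z * chiser _ * S 2)
  = eulz (S 2) + (6%:R * Z * chiser _ - 1 + Z) * S 2 => //.
have -> : eulz (S 2) = \sum_(0 <= i < (2 * M).+1) eulz (cc 2 i).
  apply: (big_morph eulz) => [f g|]; apply/fpsP => n; apply/fpsP => j /=.
    by rewrite mulrDr.
  by rewrite !if_same coef_fps0 mulr0.
rewrite mulrDr mulr_sumr (eq_bigr _ (fun i _ => ccS i)) big_split sumrB /=.
by rewrite -mulr_sumr -/(S 2); ring.
Qed.

End Truncation.

(** The diagonal terms of the square are given by [ccS]. By [ccAB] an
    off-diagonal term splits into single terms, whose factors depend on the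
    distance of the two indices; these factors add up to [chiser]. *)
Lemma lamser_sqr : 3%:R * lamser 1 ^+ 2
  = eulz (lamser 2) + (6%:R * fpsC z * chiser _ - 1 + fpsC z) * lamser 2.
Proof.
by apply: eqmX_all => k n n_lt; apply: (@lamser_sqr_trunc k); apply: ltnW.
Qed.

End LambertIdentity.

(** * Eisenstein series as Taylor coefficients *)

Lemma coef_fps_comp_scale (R : comNzRingType) (c : R) (f : {fps R}) n :
  fps_comp (fpsC c * fpsX R) f n = c ^+ n * f n.
Proof.
rewrite /= (eq_bigr (fun j : 'I_n.+1 => f j * (c ^+ j * (n == j)%:R))) => [|j _].
  rewrite big_ord_recr /= eqxx mulr1 big1 ?add0r 1?mulrC // => -[i lt_in] _ /=.
  by rewrite gtn_eqF // !mulr0.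
by rewrite exprMn -rmorphXn coef_fpsCM coef_fpsXn.
Qed.

Lemma comp_scale_expz (c d : rat) :
  fps_comp (fpsC c * fpsX rat) (expz d) = expz (c * d).
Proof. by apply/fpsP => n; rewrite coef_fps_comp_scale /= exprMn mulrA. Qed.

Lemma coef0_scale (R : comNzRingType) (c : R) : (fpsC c * fpsX R) 0%N = 0.
Proof. by rewrite coef_fpsCM mulr0. Qed.

Lemma comp_scaleM (R : comNzRingType) (c : R) (f g : {fps R}) :
  fps_comp (fpsC c * fpsX R) (f * g)
  = fps_comp (fpsC c * fpsX R) f * fps_comp (fpsC c * fpsX R) g.
Proof. exact/fps_compM/coef0_scale. Qed.

Lemma comp_scaleXn (R : comNzRingType) (c : R) (f : {fps R}) n :
  fps_comp (fpsC c * fpsX R) (f ^+ n) = fps_comp (fpsC c * fpsX R) f ^+ n.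
Proof. exact/fps_compXn/coef0_scale. Qed.

Lemma comp_scaleX (R : comNzRingType) (c : R) :
  fps_comp (fpsC c * fpsX R) (fpsX R) = fpsC c * fpsX R.
Proof. exact/fps_compX/coef0_scale. Qed.

Section TaylorCoefficients.

Local Notation z := (fpsX rat).
Local Notation u := (expz 1).
Local Notation v := (expz (-1)).

(** Changing [z] into [-z] exchanges the terms with indices [m] and [-m]. *)
Lemma lamser_reflect n :
  lamser 2 n = fps_comp (fpsC (-1) * z) (lamser 1 n).
Proof.
pose s := fpsC (-1) * z; rewrite -/s.
have sz : fps_comp s z = - z by rewrite comp_scaleX rmorphN rmorph1 mulN1r.
have su : fps_comp s u = v by rewrite comp_scale_expz mulr1.
have sv : fps_comp s v = u by rewrite comp_scale_expz mulrN1 opprK.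
have uv : u * v = 1 by rewrite expzD subrr expz0.
have v3 : 1 - v ^+ 3 != 0.
  apply/eqP => /fpsP/(_ 1%N); rewrite coef_fpsB coef_fps1 expzXn coef_fps0 /=.
  by rewrite expr1.
rewrite /=; case: ifP => _.
  rewrite expr1 comp_scaleM -/s su; apply: (mulfI v3).
  have := congr1 (fps_comp s) polarE.
  rewrite comp_scaleM -/s raddfB /= comp_scaleXn -/s su sz fps_comp1 => pE.
  rewrite [RHS]mulrCA [_ * fps_comp s polar]mulrC pE -polarE.
  transitivity (- (v * (polar * (1 - u ^+ 3))) + u ^+ 2 * polar * (1 - u * v)
    + v * polar * (1 - (u * v) ^+ 2)); first by ring.
  by rewrite uv expr1n subrr !mulr0 !addr0 mulrN.
rewrite comp_scaleM -/s sz raddfB /= !(raddf_sum (fps_comp s)) /=.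
have su_sum (P : pred nat) :
    \sum_(d <- divisors n | P d) fps_comp s (u ^+ d)
    = \sum_(d <- divisors n | P d) v ^+ d.
  by apply: eq_bigr => d _; rewrite [LHS](@comp_scaleXn rat (-1)) -/s su.
have sv_sum (P : pred nat) :
    \sum_(d <- divisors n | P d) fps_comp s (v ^+ d)
    = \sum_(d <- divisors n | P d) u ^+ d.
  by apply: eq_bigr => d _; rewrite [LHS](@comp_scaleXn rat (-1)) -/s sv.
rewrite su_sum sv_sum.
by rewrite mulNr -mulrN opprB.
Qed.

(** The Taylor coefficients in [z] of [lamser 1]: up to a constant, [geis j] is
    the Eisenstein series of weight [j] and character [chi^j] modulo 3. *)
Definition geis (j : nat) : {fps rat} := Fps (fun n => lamser 1 n j).

Lemma coef_lamser2 n j : lamser 2 n j = (-1) ^+ j * geis j n.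
Proof. by rewrite lamser_reflect coef_fps_comp_scale. Qed.

Lemma polar0 : polar 0%N = - 3%:R^-1.
Proof.
have u3 : (1 - u ^+ 3) 0%N = 0 /\ (1 - u ^+ 3) 1%N = - 3%:R.
  rewrite !coef_fpsB expzXn !coef_fps1 /= !expr0 fact0 expr1 divr1.
  by rewrite subrr divr1 sub0r.
have := congr1 (fun f : {fps rat} => f 1%N) polarE.
rewrite coef1_fpsM; case: u3 => -> ->; rewrite mulr0 addr0 => e.
apply: (@mulIf _ (- 3%:R)); first by [].
by rewrite e.
Qed.

Lemma geis0 : geis 0 = fpsC (- 3%:R^-1).
Proof.
apply/fpsP => n; rewrite /=; case: ifP => _; last by rewrite coef0_fpsM mul0r.
by rewrite expr1 coef0_fpsM polar0 /= expr0 fact0 divr1 mul1r.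
Qed.

(** The coefficient of [z^(j+1)] in [lamser_sqr]. *)
Lemma geis_rec j :
  3%:R * \sum_(l < j.+2) geis l * geis (j.+1 - l)
  = (-1) ^+ j * ((hexser rat) * geis j - j%:R * geis j.+1).
Proof.
apply/fpsP => n.
rewrite coef_fps_natM coef_fps_sum.
have <- : (lamser 1 ^+ 2) n j.+1 = \sum_(l < j.+2) (geis l * geis (j.+1 - l)) n.
  rewrite expr2 coef_fpsM coef_fps_sum.
  under eq_bigr do rewrite coef_fpsM.
  by rewrite exchange_big /=; apply: eq_bigr => l _.
have -> : 3%:R * (lamser 1 ^+ 2) n j.+1 = (3%:R * lamser 1 ^+ 2) n j.+1.
  by rewrite !coef_fps_natM.
rewrite lamser_sqr.
have chiE i : chiser {fps rat} i = fpsC (chiser rat i).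
  rewrite /=; case: ifP => _; first by rewrite rmorph0.
  by rewrite raddfB /= !rmorph_sum.
have XE (f : {fps {fps rat}}) : (fpsC z * f) n j.+1 = f n j.
  by rewrite coef_fpsCM coef_fpsXM.
have cE : (chiser {fps rat} * lamser 2) n j = (-1) ^+ j * (chiser rat * geis j) n.
  rewrite !coef_fpsM coef_fps_sum mulr_sumr; apply: eq_bigr => i _.
  by rewrite chiE coef_fpsCM coef_lamser2 mulrCA.
have -> : (6%:R * fpsC z * chiser _ - 1 + fpsC z) * lamser 2
  = fpsC z * (6%:R * (chiser _ * lamser 2) + lamser 2) - lamser 2 by ring.
have DE (f g h : {fps {fps rat}}) k :
  (f + (g - h)) n k = f n k + (g n k - h n k) by [].
rewrite DE XE [(_ + lamser 2) n]coef_fpsD coef_fpsD.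
rewrite coef_fps_natM coef_fps_natM cE.
rewrite [eulz _ n j.+1](_ : _ = j.+1%:R * lamser 2 n j.+1) // !coef_lamser2.
rewrite /hexser exprS.
have -> : ((-1) ^+ j * ((1 + 6%:R * chiser rat) * geis j - j%:R * geis j.+1)) n
  = (-1) ^+ j * (geis j n + 6%:R * (chiser rat * geis j) n - j%:R * geis j.+1 n).
  have -> : (-1) ^+ j * ((1 + 6%:R * chiser rat) * geis j - j%:R * geis j.+1)
    = fpsC ((-1) ^+ j) * (geis j + 6%:R * (chiser rat * geis j) - j%:R * geis j.+1).
    by rewrite rmorphXn rmorphN rmorph1; ring.
  by rewrite coef_fpsCM coef_fpsB coef_fpsD !coef_fps_natM.
rewrite -natr1; move: ((-1) ^+ j) => s; ring.
Qed.

Lemma sum_divisors3 (R : comNzRingType) (F : nat -> R) r n : (0 < r < 3)%N ->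
  (0 < n)%N -> \sum_(d <- divisors (3 * n) | (d %% 3 == r)%N) F d
               = \sum_(d <- divisors n | (d %% 3 == r)%N) F d.
Proof.
move=> r03 n0; rewrite -[LHS]big_filter -[RHS]big_filter; apply: perm_big.
apply: uniq_perm; rewrite ?filter_uniq ?divisors_uniq // => d.
rewrite !mem_filter -!dvdn_divisors ?muln_gt0 //.
case: eqP => //= dr; rewrite Gauss_dvdr //.
by rewrite coprime_sym prime_coprime // /dvdn dr; lia.
Qed.

Lemma coef_geisS j n : (0 < n)%N -> geis j.+1 n =
  (\sum_(d <- divisors n | (d %% 3 == 1)%N) d%:R ^+ j
   - \sum_(d <- divisors n | (d %% 3 == 2)%N) (- d%:R) ^+ j) / (j`!)%:R.
Proof.
move=> n0; rewrite [LHS]/= gtn_eqF // coef_fpsXM coef_fpsB !coef_fps_sum.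
rewrite mulrBl !mulr_suml; congr (_ - _); apply: eq_bigr => d _.
  by rewrite expzXn.
by rewrite expzXn /= mulNrn.
Qed.

(** Only the divisors prime to 3 enter. *)
Lemma geis_tripling j n : geis j (3 * n)%N = geis j n.
Proof.
have [->|n0] := posnP n; first by rewrite muln0.
case: j => [|j]; first by rewrite geis0 /= !gtn_eqF ?muln_gt0.
by rewrite !coef_geisS ?muln_gt0 // !sum_divisors3.
Qed.

(** The generating series of the constant terms of even weight is a combination
    of the values at [3 z] and at [z] of [z / (e^z - 1)]: it generates the
    Bernoulli numbers with their Euler factor at 3 removed. *)
Lemma coef0_geis_zeta j : odd j ->
  (1 - 3%:R ^+ j) * zeta_1sub j.+1 = 2%:R * (j`!)%:R * geis j.+1 0%N.
Proof.
move=> jodd.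
pose beta : {fps rat} := (Fps (fun i => (i.+1`!)%:R^-1))^-1.
have betaE : beta * (u - 1) = z.
  have -> : u - 1 = z * Fps (fun i => (i.+1`!)%:R^-1).
    apply/fpsP => -[|n]; rewrite coef_fpsB coef_fpsXM coef_fps1 /= expr1n.
      by rewrite fact0 divr1 subrr.
    by rewrite subr0 div1r.
  rewrite mulrCA mulVr ?mulr1 // fps_unitE /=.
  by rewrite unitrV unitr1.
have beta3E : fps_comp (fpsC 3%:R * z) beta * (u ^+ 3 - 1) = 3%:R * z.
  have := congr1 (fps_comp (fpsC 3%:R * z)) betaE.
  rewrite comp_scaleM comp_scaleX raddfB /= comp_scale_expz fps_comp1 mulr1.
  by rewrite expzXn => ->; rewrite fpsC_nat.
have u3 : u ^+ 3 - 1 != 0.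
  by apply: contraNneq (_ : (3%:R : {fps rat}) * z != 0) => [e|];
    [rewrite -beta3E e mulr0|apply/eqP => /fpsP/(_ 1%N); rewrite coef_fps_natM coef_fps0].
have e3 : 3%:R * ((u + u ^+ 2) * polar)
    = fps_comp (fpsC 3%:R * z) beta - 3%:R * beta.
  apply: (mulIf u3); rewrite mulrBl beta3E.
  transitivity (- (3%:R * (u + u ^+ 2)) * (polar * (1 - u ^+ 3))); first by ring.
  transitivity (3%:R * z - 3%:R * (u ^+ 2 + u + 1) * (beta * (u - 1))).
    by rewrite polarE betaE; ring.
  by ring.
have e1 : 2%:R * geis j.+1 0%N = ((u + u ^+ 2) * polar) j.+1.
  have l2 := coef_lamser2 0 j.+1.
  have -> : (u + u ^+ 2) * polar = u ^+ 1 * polar + u ^+ 2 * polar.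
    by rewrite expr1 mulrDl.
  rewrite [RHS]coef_fpsD -[X in _ = X + _]/(geis j.+1 0%N).
  rewrite -[X in _ = _ + X]/(lamser 2 0%N j.+1) l2 -signr_odd /= jodd.
  by rewrite expr0 mul1r mulr_natl.
have /fpsP/(_ j.+1) := e3.
rewrite coef_fps_natM -e1 coef_fpsB coef_fps_comp_scale coef_fps_natM exprS.
rewrite -mulrBl => e.
rewrite /zeta_1sub /bernoulli -/beta factS natrM.
have j0 : j.+1%:R != 0 :> rat by rewrite pnatr_eq0.
have : 2%:R * geis j.+1 0%N = (3%:R ^+ j - 1) * beta j.+1 by lra.
move=> e2; rewrite [RHS]mulrAC e2; field.
by rewrite nat1r.
Qed.

Lemma geis_eisenstein k : (0 < k)%N -> ~~ odd k -> geis k 0%N != 0 ->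
  geis k = fpsC (geis k 0%N) * eisenstein k.
Proof.
case: k => // j _; rewrite oddS negbK => jodd c0; apply/fpsP => n.
rewrite coef_fpsCM; have [->|n0] := posnP n; first by rewrite mulr1.
have -> : eisenstein j.+1 n = 2%:R / ((1 - 3%:R ^+ j) * zeta_1sub j.+1)
    * \sum_(d <- divisors n | ~~ (3 %| d)%N) d%:R ^+ j.
  by rewrite [LHS]/= gtn_eqF.
rewrite coef_geisS // coef0_geis_zeta //.
have f0 : (j`!)%:R != 0 :> rat by rewrite pnatr_eq0 -lt0n fact_gt0.
have -> : \sum_(d <- divisors n | ~~ (3 %| d)%N) (d%:R : rat) ^+ j
  = \sum_(d <- divisors n | (d %% 3 == 1)%N) d%:R ^+ j
   - \sum_(d <- divisors n | (d %% 3 == 2)%N) (- d%:R) ^+ j.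
  rewrite -sumrN !(big_mkcond (fun d => _ == _)) [LHS]big_mkcond -big_split /=.
  apply: eq_bigr => d _; rewrite exprNn -signr_odd jodd expr1 mulN1r opprK.
  rewrite /dvdn; case: (d %% 3)%N (ltn_pmod d (isT : 0 < 3)%N) => [|[|[|]]] //= _;
    by rewrite ?addr0 ?add0r.
by field; rewrite f0 c0.
Qed.

End TaylorCoefficients.

(** * The cubic modular equation for Eisenstein series *)

Section Pure.
Variable R : comNzRingType.
Implicit Types f g h : {fps R}.

Definition pure3 r f := sec3 r f = f.

Lemma pure3D r f g : pure3 r f -> pure3 r g -> pure3 r (f + g).
Proof. by rewrite /pure3 raddfD /= => -> ->. Qed.

Lemma pure3B r f g : pure3 r f -> pure3 r g -> pure3 r (f - g).
Proof. by rewrite /pure3 raddfB /= => -> ->. Qed.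

Lemma pure3M i j k f g : (i + j = k %[mod 3])%N ->
  pure3 i f -> pure3 j g -> pure3 k (f * g).
Proof.
by move=> e pf pg; rewrite /pure3 -sec3_mod -e sec3_mod sec3_prod.
Qed.

Lemma pure3_nat n : pure3 0 (n%:R : {fps R}).
Proof. by rewrite /pure3 -fpsC_nat sec3C. Qed.

Lemma pure3_natM r n f : pure3 r f -> pure3 r (n%:R * f).
Proof. by apply: pure3M (pure3_nat n). Qed.

Lemma pure3X i j k f : (i * j = k %[mod 3])%N -> pure3 i f -> pure3 k (f ^+ j).
Proof.
move=> e pf; rewrite /pure3 -sec3_mod -{}e sec3_mod.
elim: j => [|j IH]; first by rewrite muln0 expr0; apply: (pure3_nat 1).
by rewrite exprS mulnS; apply: pure3M pf IH.
Qed.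

Lemma pure3_sec3 r f : pure3 r (sec3 r f). Proof. exact: sec3_sec3. Qed.

Lemma pure3_V f : pure3 0 (V f). Proof. exact: sec3_V. Qed.

Lemma sec3_0D f g h : pure3 0 f -> pure3 1 g -> pure3 2 h ->
  sec3 0 (f + g + h) = f.
Proof.
move=> pf pg ph; rewrite !raddfD /= pf.
by rewrite (@sec3_neq _ 1 0 g) // (@sec3_neq _ 2 0 h) // !addr0.
Qed.

Lemma sec3_0_eq F f g h t : sec3 0 F = t -> F = f + g + h ->
  pure3 0 f -> pure3 1 g -> pure3 2 h -> f = t.
Proof. by move=> <- -> pf pg ph; rewrite sec3_0D. Qed.

End Pure.

Ltac pure3_tac := repeat first
  [ apply: pure3_nat | apply: pure3_natM | apply: pure3B
  | apply: pure3D | assumption ].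

Lemma fps_nat_unit n : n.+1%:R \is a @GRing.unit {fps rat}.
Proof. by rewrite fps_unitE -fpsC_nat /= unitfE pnatr_eq0. Qed.

Lemma fps_nat_inj n (f g : {fps rat}) : n.+1%:R * f = n.+1%:R * g -> f = g.
Proof. by apply: mulrI; apply: fps_nat_unit. Qed.

Section LowWeights.

Local Notation a := (hexser rat).

Lemma geis0M f : 3%:R * (geis 0 * f) = - f.
Proof.
by apply/fpsP => n; rewrite geis0 coef_fps_natM coef_fpsCM coef_fpsN; field.
Qed.

Lemma geis_recS j : 3%:R * \sum_(l < j) geis l.+1 * geis (j - l)
  = (-1) ^+ j * (a * geis j - j%:R * geis j.+1) + 2%:R * geis j.+1.
Proof.
rewrite -geis_rec big_ord_recr big_ord_recl /= subnn subn0.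
rewrite [geis j.+1 * geis 0]mulrC 2!mulrDr !geis0M.
rewrite (eq_bigr (fun l : 'I_j => geis l.+1 * geis (j - l))) // ; ring.
Qed.

Lemma geis1 : 6%:R * geis 1 = a.
Proof.
have := geis_rec 0; rewrite !big_ord_recl big_ord0 !subn0 addr0 mul0r subr0.
rewrite expr0 mul1r subnn [geis _ * geis 0]mulrC mulrDr geis0M => e.
have -> : a = - (3%:R * (geis 0 * a)) by rewrite geis0M opprK.
rewrite [geis 0 * a]mulrC -e; ring.
Qed.

Lemma geis1_unit : geis 1 \is a GRing.unit.
Proof. by have := hexser_unit rat; rewrite -geis1 unitrM => /andP[]. Qed.

(** The recursion gives [geis j.+1] in terms of lower weights, except for
    [geis 3], whose coefficient in [geis_recS] is zero: it brings in the
    parameter [cubic_ratio]. *)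
Lemma geis2 : geis 2 = 3%:R * geis 1 ^+ 2.
Proof.
have alg (R : comNzRingType) (g1 g2 b : R) : 6%:R * g1 = b ->
    3%:R * (g1 * g1) = - 1 * (b * g1 - 1 * g2) + 2%:R * g2 ->
    3%:R * g2 = 3%:R * (3%:R * g1 ^+ 2).
  move=> <- e; transitivity (3%:R * (g1 * g1) + 6%:R * g1 * g1); last by ring.
  by rewrite e; ring.
have := geis_recS 1; rewrite big_ord1 expr1 subn0 => e.
exact: (@fps_nat_inj 2) (alg _ _ _ _ geis1 e).
Qed.

(** The cube of the ratio of the theta series [b] and [a] of the cubic theory of
    elliptic functions. *)
Definition cubic_ratio : {fps rat} := - (geis 3 / geis 1 ^+ 3) / 12%:R.

Local Notation x := cubic_ratio.

Lemma geis3 : geis 3 = - 12%:R * geis 1 ^+ 3 * x.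
Proof.
have alg (R : comUnitRingType) (g3 c k : R) : c \is a GRing.unit ->
    k \is a GRing.unit -> g3 = - k * c * (- (g3 / c) / k).
  move=> uc uk; transitivity (g3 * (c / c) * (k / k)); last by ring.
  by rewrite !divrr ?mulr1.
by apply: alg; [rewrite unitrX ?geis1_unit|exact: (fps_nat_unit 11)].
Qed.

Lemma geis4 : 5%:R * geis 4 = 9%:R * geis 1 ^+ 4 * (3%:R - 16%:R * x).
Proof.
have alg (R : comNzRingType) (g1 g2 g3 g4 b t : R) : 6%:R * g1 = b ->
    g2 = 3%:R * g1 ^+ 2 -> g3 = - 12%:R * g1 ^+ 3 * t ->
    3%:R * (g1 * g3 + (g2 * g2 + (g3 * g1 + 0)))
      = - 1 * (b * g3 - 3%:R * g4) + 2%:R * g4 ->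
    5%:R * g4 = 9%:R * g1 ^+ 4 * (3%:R - 16%:R * t).
  move=> <- e2 e3 e.
  transitivity (3%:R * (g1 * g3 + (g2 * g2 + (g3 * g1 + 0)))
    + 6%:R * g1 * g3); first by rewrite e; ring.
  by rewrite e2 e3; ring.
have := geis_recS 3; rewrite !big_ord_recl big_ord0 -signr_odd /= expr1 => e.
exact: alg geis1 geis2 geis3 e.
Qed.

Lemma geis5 : geis 5 = 108%:R * geis 1 ^+ 5 * x.
Proof.
have alg (R : comNzRingType) (g1 g2 g3 g4 g5 b t : R) : 6%:R * g1 = b ->
    g2 = 3%:R * g1 ^+ 2 -> g3 = - 12%:R * g1 ^+ 3 * t ->
    3%:R * (g1 * g4 + (g2 * g3 + (g3 * g2 + (g4 * g1 + 0))))
      = 1 * (b * g4 - 4%:R * g5) + 2%:R * g5 ->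
    2%:R * g5 = 2%:R * (108%:R * g1 ^+ 5 * t).
  move=> <- e2 e3 e.
  transitivity (6%:R * g1 * g4
    - 3%:R * (g1 * g4 + (g2 * g3 + (g3 * g2 + (g4 * g1 + 0))))).
    by rewrite e; ring.
  by rewrite e2 e3; ring.
have := geis_recS 4; rewrite !big_ord_recl big_ord0 -signr_odd /= expr0 => e.
exact: (@fps_nat_inj 1) (alg _ _ _ _ _ _ _ _ geis1 geis2 geis3 e).
Qed.

Lemma geis6 : 35%:R * geis 6
  = 54%:R * geis 1 ^+ 6 * (9%:R + 72%:R * x + 40%:R * x ^+ 2).
Proof.
have alg (R : comNzRingType) (g1 g2 g3 g4 g5 g6 b t : R) : 6%:R * g1 = b ->
    g2 = 3%:R * g1 ^+ 2 -> g3 = - 12%:R * g1 ^+ 3 * t ->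
    5%:R * g4 = 9%:R * g1 ^+ 4 * (3%:R - 16%:R * t) ->
    g5 = 108%:R * g1 ^+ 5 * t ->
    3%:R * (g1 * g5 + (g2 * g4 + (g3 * g3 + (g4 * g2 + (g5 * g1 + 0)))))
      = - 1 * (b * g5 - 5%:R * g6) + 2%:R * g6 ->
    35%:R * g6 = 54%:R * g1 ^+ 6 * (9%:R + 72%:R * t + 40%:R * t ^+ 2).
  move=> <- e2 e3 e4 e5 e.
  transitivity (5%:R * (3%:R * (g1 * g5 + (g2 * g4 + (g3 * g3
    + (g4 * g2 + (g5 * g1 + 0)))))) + 30%:R * g1 * g5).
    by rewrite e; ring.
  transitivity (60%:R * g1 * g5 + 6%:R * g2 * (5%:R * g4) + 15%:R * g3 ^+ 2).
    by ring.
  by rewrite e4 e2 e3 e5; ring.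
have := geis_recS 5; rewrite !big_ord_recl big_ord0 -signr_odd /= expr1 => e.
exact: alg geis1 geis2 geis3 geis4 geis5 e.
Qed.

Lemma sec3_geis j : sec3 0 (geis j) = V (geis j).
Proof.
apply/fpsP => n; rewrite coef_sec3 coef_V /dvdn mod0n.
by case: ifP => // /dvdnP[k ->]; rewrite mulnK // mulnC geis_tripling.
Qed.

End LowWeights.

Section CubicModularEquation.

Local Notation x := cubic_ratio.
Local Notation G := (geis 1).

(** Three times the series [y] of the theorem, with [geis 1] in place of
    theta. *)
Definition y_triple : {fps rat} := (G / V G - 1) / 2%:R.
Local Notation Y := y_triple.

Lemma V_geis1_unit : V G \is a GRing.unit.
Proof. by rewrite fps_unitE coef0_V -fps_unitE geis1_unit. Qed.

Lemma geis1_y_triple : G = V G * (1 + 2%:R * Y).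
Proof.
have alg (R : comUnitRingType) (g c k : R) : c \is a GRing.unit ->
    k \is a GRing.unit -> g = c * (1 + k * ((g / c - 1) / k)).
  move=> uc uk; rewrite [k * _]mulrC divrK // addrCA subrr addr0.
  by rewrite mulrC divrK.
by apply: alg; [exact: V_geis1_unit|exact: (fps_nat_unit 1)].
Qed.

Definition trifixed (f : {fps rat}) := sec3 0 f = V f.

Lemma trifixed_natP n f : trifixed (n.+1%:R * f) -> trifixed f.
Proof.
rewrite /trifixed rmorphM rmorph_nat -[in sec3 0 _](addn0 0%N).
by rewrite (sec3_mul _ _ (pure3_nat _ _)) => /fps_nat_inj.
Qed.

Lemma trifixed_natM n f : trifixed f -> trifixed (n%:R * f).
Proof.
rewrite /trifixed rmorphM rmorph_nat -[in sec3 0 _](addn0 0%N).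
by rewrite (sec3_mul _ _ (pure3_nat _ _)) => ->.
Qed.

(** [G] is [V G] times [1 + 2 Y], and powers of [V G] commute with taking the
    section 0. *)
Lemma trifixed_geis1X k f : trifixed (G ^+ k * f) ->
  sec3 0 ((1 + 2%:R * Y) ^+ k * f) = V f.
Proof.
have pA : pure3 0 (V G ^+ k) by apply: (@pure3X _ 0 k); [|exact: pure3_V].
rewrite /trifixed {1}geis1_y_triple exprMn -mulrA -[in LHS](addn0 0%N).
rewrite (sec3_mul _ _ pA) rmorphM rmorphXn.
by apply: mulrI; rewrite unitrX ?V_geis1_unit.
Qed.

Lemma coef0_y_triple : Y 0%N = 0.
Proof.
have /fpsP/(_ 0%N) := geis1_y_triple; rewrite coef0_fpsM coef0_V => e.
have G0 : G 0%N != 0 by have := geis1_unit; rewrite fps_unitE unitfE.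
move: e; rewrite -[LHS]mulr1 => /(mulfI G0).
by rewrite coef_1natD /=; lra.
Qed.

Lemma coef1_y_triple : Y 1%N = 3%:R.
Proof.
have /fpsP/(_ 1%N) := geis1_y_triple.
rewrite coef1_fpsM coef0_V (_ : V G 1%N = 0) // mul0r addr0 => e.
have G6 n : 6%:R * G n = (hexser rat) n by rewrite -geis1 coef_fps_natM.
have := G6 0%N; have := G6 1%N.
have -> : (hexser rat) 1%N = 6%:R.
  rewrite coef_fpsD coef_fps_natM coef_fps1 /= /divisors /= !big_cons !big_nil /=.
  by [].
rewrite coef0_hexser; move: e; rewrite coef_1natD add0r.
move: (G 0%N) (G 1%N) (Y 1%N) => g0 g1 y1 e e1 e0.
have {}e0 : g0 = 6%:R^-1 by lra.
by move: e; rewrite e0; lra.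
Qed.

(** Weight 1 kills the section 0 of [Y], and weight 2 then kills the product
    of its two other sections. The coefficient of [X] decides which of them is
    zero. *)
Lemma pure3_y_triple : pure3 1 Y.
Proof.
have Y0 : sec3 0 Y = 0.
  have := @trifixed_geis1X 1 1; rewrite expr1 !mulr1 rmorph1 => /(_ (sec3_geis 1)).
  rewrite raddfD /= (pure3_nat _ 1) -[in X in _ + X](addn0 0%N).
  rewrite (sec3_mul _ _ (pure3_nat _ 2)) -[RHS]addr0 => /addrI e.
  by apply: (@fps_nat_inj 1); rewrite e mulr0.
have YE : Y = sec3 1 Y + sec3 2 Y by rewrite {1}[Y]sec3_split Y0 add0r.
have : sec3 0 ((1 + 2%:R * Y) ^+ 2 * 1) = V 1.
  apply: trifixed_geis1X; apply: (@trifixed_natP 2); rewrite mulr1 -geis2.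
  exact: sec3_geis.
rewrite mulr1 rmorph1 YE.
have -> : (1 + 2%:R * (sec3 1 Y + sec3 2 Y)) ^+ 2
  = (1 + 8%:R * (sec3 1 Y * sec3 2 Y))
    + (4%:R * sec3 1 Y + 4%:R * sec3 2 Y ^+ 2)
    + (4%:R * sec3 2 Y + 4%:R * sec3 1 Y ^+ 2) by ring.
rewrite sec3_0D; first last.
- apply: pure3D; apply: pure3_natM; first exact: pure3_sec3.
  by apply: (@pure3X _ 1 2); [|exact: pure3_sec3].
- apply: pure3D; apply: pure3_natM; first exact: pure3_sec3.
  by apply: (@pure3X _ 2 2); [|exact: pure3_sec3].
- apply: pure3D; first exact: (pure3_nat _ 1).
  by apply: pure3_natM; apply: (@pure3M _ 1 2) => //; exact: pure3_sec3.
rewrite -[RHS]addr0 => /addrI e.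
have /eqP : sec3 1 Y * sec3 2 Y = 0 by apply: (@fps_nat_inj 7); rewrite e mulr0.
rewrite mulf_eq0 => /orP[] /eqP Yr; last first.
  by rewrite /pure3 Yr addr0 sec3_sec3.
have : sec3 1 Y 1%N = 0 by rewrite Yr coef_fps0.
by rewrite (_ : sec3 1 Y 1%N = Y 1%N) // coef1_y_triple => /eqP; rewrite pnatr_eq0.
Qed.

(** In the weights 4, 5 and 6 the condition [trifixed] determines one after the
    other the sections 2, 1 and 0 of [(1 + 2 Y)^3 x]. *)
Lemma cubic_ratio_y_triple :
  (1 + 2%:R * Y) ^+ 3 * x = (1 - Y) ^+ 3 /\ V x = 1 - Y ^+ 3.
Proof.
pose X := (1 + 2%:R * Y) ^+ 3 * x; pose w := V x; rewrite -/X -/w.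
have w3 : sec3 0 X = w.
  apply: trifixed_geis1X; apply: (@trifixed_natP 11).
  have := sec3_geis 3; rewrite geis3 -mulrA mulNr /trifixed !raddfN /=.
  exact: oppr_inj.
have pY := pure3_y_triple; have pw : pure3 0 w by exact: pure3_V.
have pY2 : pure3 2 (Y ^+ 2) by exact: (@pure3X _ 1 2).
have pY3 : pure3 0 (Y ^+ 3) by exact: (@pure3X _ 1 3).
have pY4 : pure3 1 (Y ^+ 4) by exact: (@pure3X _ 1 4).
have pY5 : pure3 2 (Y ^+ 5) by exact: (@pure3X _ 1 5).
have pY6 : pure3 0 (Y ^+ 6) by exact: (@pure3X _ 1 6).
have [X1 [X2 [pX1 pX2 XE]]] : exists X1 X2,
    [/\ pure3 1 X1, pure3 2 X2 & X = w + X1 + X2].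
  exists (sec3 1 X), (sec3 2 X); split; try exact: pure3_sec3.
  by rewrite -w3 -sec3_split.
have Y0 : Y != 0.
  by apply/eqP => /fpsP/(_ 1%N)/eqP; rewrite coef1_y_triple coef_fps0 pnatr_eq0.
have pYX2 : pure3 0 (Y * X2) by exact: (@pure3M _ 1 2).
have pYX1 : pure3 2 (Y * X1) by exact: (@pure3M _ 1 1).
have pYw : pure3 1 (Y * w) by exact: (@pure3M _ 1 0).
have X2E : X2 = 3%:R * Y ^+ 2.
  have : sec3 0 ((1 + 2%:R * Y) ^+ 4 * (3%:R - 16%:R * x)) = V (3%:R - 16%:R * x).
    apply: trifixed_geis1X; apply: (@trifixed_natP 8); rewrite mulrA -geis4.
    exact/trifixed_natM/sec3_geis.
  have -> : V (3%:R - 16%:R * x) = 3%:R - 16%:R * w.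
    by rewrite rmorphB rmorphM 2!rmorph_nat.
  move/(@sec3_0_eq _ _ (3%:R + 96%:R * Y ^+ 3 - 16%:R * w - 32%:R * (Y * X2))
    (24%:R * Y + 48%:R * Y ^+ 4 - 16%:R * X1 - 32%:R * (Y * w))
    (72%:R * Y ^+ 2 - 16%:R * X2 - 32%:R * (Y * X1))).
  move=> /(_ _ ltac:(by pure3_tac) ltac:(by pure3_tac) ltac:(by pure3_tac)) e.
  have alg (R : comNzRingType) (b c d : R) :
      3%:R + 96%:R * b ^+ 3 - 16%:R * c - 32%:R * (b * d) = 3%:R - 16%:R * c ->
      32%:R * (b * d) = 32%:R * (b * (3%:R * b ^+ 2)).
    move=> {}e; transitivity (3%:R + 96%:R * b ^+ 3 - 16%:R * c
      - (3%:R + 96%:R * b ^+ 3 - 16%:R * c - 32%:R * (b * d))); first by ring.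
    by rewrite e; ring.
  apply/(mulfI Y0)/(@fps_nat_inj 31)/alg/e.
  transitivity (3%:R * (1 + 2%:R * Y) ^+ 4 - 16%:R * (1 + 2%:R * Y) * X).
    by rewrite /X; ring.
  by rewrite XE; ring.
have X1E : X1 = - 3%:R * Y.
  have : sec3 0 ((1 + 2%:R * Y) ^+ 5 * x) = w.
    apply: trifixed_geis1X; apply: (@trifixed_natP 107); rewrite mulrA -geis5.
    exact: sec3_geis.
  have pYYX1 : pure3 0 (Y * (Y * X1)) by exact: (@pure3M _ 1 2).
  have pY2w : pure3 2 (Y ^+ 2 * w) by exact: (@pure3M _ 2 0).
  move/(@sec3_0_eq _ _ (w + 12%:R * Y ^+ 3 + 4%:R * (Y * (Y * X1)))
    (X1 + 4%:R * (Y * w) + 12%:R * Y ^+ 4)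
    (3%:R * Y ^+ 2 + 4%:R * (Y * X1) + 4%:R * (Y ^+ 2 * w))).
  move=> /(_ _ ltac:(by pure3_tac) ltac:(by pure3_tac) ltac:(by pure3_tac)) e.
  have alg (R : comNzRingType) (b c d : R) :
      c + 12%:R * b ^+ 3 + 4%:R * (b * (b * d)) = c ->
      4%:R * (b * (b * d)) = 4%:R * (b * (b * (- 3%:R * b))).
    move=> {}e; transitivity (c + 12%:R * b ^+ 3 + 4%:R * (b * (b * d))
      - c - 12%:R * b ^+ 3); first by ring.
    by rewrite e; ring.
  apply/(mulfI Y0)/(mulfI Y0)/(@fps_nat_inj 3)/alg/e.
  transitivity ((1 + 2%:R * Y) ^+ 2 * X); first by rewrite /X; ring.
  by rewrite XE X2E; ring.
have wE : w = 1 - Y ^+ 3.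
  have : sec3 0 ((1 + 2%:R * Y) ^+ 6 * (9%:R + 72%:R * x + 40%:R * x ^+ 2))
    = V (9%:R + 72%:R * x + 40%:R * x ^+ 2).
    apply: trifixed_geis1X; apply: (@trifixed_natP 53); rewrite mulrA -geis6.
    exact/trifixed_natM/sec3_geis.
  have algV (R S : comNzRingType) (phi : {rmorphism R -> S}) b :
      phi (9%:R + 72%:R * b + 40%:R * b ^+ 2)
      = 9%:R + 72%:R * phi b + 40%:R * phi b ^+ 2.
    by rewrite 2!rmorphD 2!rmorphM rmorphXn 3!rmorph_nat.
  have -> : V (9%:R + 72%:R * x + 40%:R * x ^+ 2)
    = 9%:R + 72%:R * w + 40%:R * w ^+ 2 by exact: algV.
  have pY2w : pure3 2 (Y ^+ 2 * w) by exact: (@pure3M _ 2 0).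
  have pY3w : pure3 0 (Y ^+ 3 * w) by exact: (@pure3M _ 0 0).
  have pw2 : pure3 0 (w ^+ 2) by exact: (@pure3X _ 0 2).
  move/(@sec3_0_eq _ _ (9%:R + 72%:R * w + 40%:R * w ^+ 2 - 576%:R * Y ^+ 3
       + 576%:R * Y ^+ 6 + 576%:R * (Y ^+ 3 * w))
    (192%:R * (Y * w) + 3384%:R * Y ^+ 4 - 108%:R * Y)
    (1104%:R * (Y ^+ 2 * w) + 3456%:R * Y ^+ 5 - 180%:R * Y ^+ 2)).
  move=> /(_ _ ltac:(by pure3_tac) ltac:(by pure3_tac) ltac:(by pure3_tac)) e.
  have alg (R : comNzRingType) (b c : R) :
      9%:R + 72%:R * c + 40%:R * c ^+ 2 - 576%:R * b ^+ 3
       + 576%:R * b ^+ 6 + 576%:R * (b ^+ 3 * c)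
      = 9%:R + 72%:R * c + 40%:R * c ^+ 2 ->
      576%:R * (b ^+ 3 * c) = 576%:R * (b ^+ 3 * (1 - b ^+ 3)).
    move=> {}e; transitivity (9%:R + 72%:R * c + 40%:R * c ^+ 2
      - 576%:R * b ^+ 3 + 576%:R * b ^+ 6 + 576%:R * (b ^+ 3 * c)
      - (9%:R + 72%:R * c + 40%:R * c ^+ 2) + 576%:R * b ^+ 3
      - 576%:R * b ^+ 6); first by ring.
    by rewrite e; ring.
  apply/(mulfI (expf_neq0 3 Y0))/(@fps_nat_inj 575)/alg/e.
  transitivity (9%:R * (1 + 2%:R * Y) ^+ 6
      + 72%:R * (1 + 2%:R * Y) ^+ 3 * X + 40%:R * X ^+ 2).
    by rewrite /X; ring.
  by rewrite XE X2E X1E; ring.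
by split=> //; rewrite XE X1E X2E wE; ring.
Qed.

(** The Eisenstein series are modular forms of level 3, hence isobaric
    polynomials in generators of weights 1 and 3. Here this comes from the
    recursion, in which [geis n] has a nonzero coefficient for [n > 3]. *)
Lemma geis_poly n :
  exists p : {poly rat}, geis n = G ^+ n * (map_poly (@fpsC rat) p).[x].
Proof.
elim/ltn_ind: n => -[|[|[|j]]] IH.
- by exists (- 3%:R^-1)%:P; rewrite geis0 expr0 mul1r map_polyC hornerC.
- by exists 1; rewrite expr1 rmorph1 hornerC mulr1.
- by exists 3%:R; rewrite geis2 rmorph_nat -polyC_natr hornerC mulrC.
case: j IH => [|j] IH.
  exists (- 12%:R *: 'X); rewrite geis3 linearZ /= map_polyX hornerZ hornerX.
  by rewrite rmorphN rmorph_nat; ring.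
pose i := j.+3; pose s : rat := (-1) ^+ i; pose c : rat := 2%:R - s * i%:R.
have c0 : c != 0.
  rewrite /c /s /i -signr_odd; case: (odd _); rewrite ?expr0 ?expr1.
    by rewrite mulN1r opprK -natrD pnatr_eq0.
  by rewrite mul1r -addn3 natrD; apply/eqP => e; have := ler0n rat j; lra.
have rec : geis i.+1 = fpsC c^-1 *
    (3%:R * \sum_(l < i) geis l.+1 * geis (i - l) - 6%:R * fpsC s * G * geis i).
  have sE : fpsC s = (-1) ^+ i by rewrite rmorphXn rmorphN rmorph1.
  have cE : fpsC c = 2%:R - fpsC s * i%:R.
    by rewrite rmorphB rmorphM !rmorph_nat.
  rewrite geis_recS -geis1 -sE.
  have -> : fpsC s * (6%:R * G * geis i - i%:R * geis i.+1) + 2%:R * geis i.+1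
    - 6%:R * fpsC s * G * geis i = fpsC c * geis i.+1 by rewrite cE; ring.
  by rewrite mulrA -rmorphM mulVf // rmorph1 mul1r.
have [f fE] : exists f : nat -> {poly rat}, forall n, (n <= i)%N ->
    geis n = G ^+ n * (map_poly (@fpsC rat) (f n)).[x].
  have ex n : exists p : {poly rat}, (n <= i)%N ->
      geis n = G ^+ n * (map_poly (@fpsC rat) p).[x].
    have [le_n|_] := leqP n i; last by exists 0.
    by have [p pE] := IH n le_n; exists p.
  by exists (fun n => projT1 (cid (ex n))) => n; apply: projT2 (cid (ex n)).
exists (c^-1 *: (3%:R *: \sum_(l < i) f l.+1 * f (i - l)%N
  - (6%:R * s) *: f i)).
rewrite rec map_polyZ rmorphB /= !map_polyZ hornerZ hornerD hornerN !hornerZ.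
rewrite [RHS]mulrCA; congr (_ * _); rewrite mulrBr; congr (_ - _).
  rewrite [X in _ * (X * _)](_ : _ = 3%:R); last exact: fpsC_nat.
  rewrite [RHS]mulrCA; congr (_ * _).
  rewrite rmorph_sum horner_sum mulr_sumr; apply: eq_bigr => -[l /= lt_l] _.
  rewrite rmorphM hornerM (fE l.+1) // (fE (i - l)%N) ?leq_subr //.
  have -> : i.+1 = (l.+1 + (i - l))%N by lia.
  by rewrite exprD; ring.
rewrite [X in _ * (X * _)](_ : _ = 6%:R * fpsC s).
  by rewrite (fE i) // exprS; ring.
by rewrite -fpsC_nat -rmorphM.
Qed.

End CubicModularEquation.

Section LatticePoints.

Local Open Scope classical_set_scope.
Local Open Scope ring_scope.

(** * Lattice points and the theta series *)

Definition ccard (T : choiceType) (X : set T) : nat := #|` fset_set X|.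

Lemma ccard_seq (T : choiceType) (X : set T) (s : seq T) :
  uniq s -> (forall t, t \in s <-> X t) -> ccard X = size s.
Proof.
move=> us sX; have XE : X = [set` s].
  by apply/seteqP; split => t /=; rewrite -?sX //; move/sX.
have fX : finite_set X by rewrite XE; exact: finite_seq.
rewrite /ccard cardfE cardE.
rewrite -(size_map val); apply: perm_size; apply: uniq_perm.
- by rewrite map_inj_uniq ?enum_uniq //; apply: val_inj.
- exact: us.
move=> t; apply/mapP/idP => [[u _ ->]|ts].
  by have := valP u; rewrite in_fset_set // inE => /sX.
have tX : t \in fset_set X by rewrite in_fset_set // inE; apply/sX.
by exists [` tX]%fset; rewrite ?mem_enum.
Qed.

Lemma finite_setE (T : choiceType) (X : set T) : finite_set X ->
  exists s : seq T, uniq s /\ forall t, t \in s <-> X t.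
Proof.
move=> fX; exists (enum_fset (fset_set X)); split; first exact: fset_uniq.
by move=> t; rewrite in_fset_set // inE.
Qed.

(** An infinite fiber would be counted as empty: hence the hypotheses
    [finite_fibers] below. *)
Definition cser (T : choiceType) (A : set T) (N : T -> nat) : {fps rat} :=
  Fps (fun n => (ccard [set t | A t /\ N t = n])%:R).

Definition finite_fibers (T : choiceType) (A : set T) (N : T -> nat) :=
  forall n, finite_set [set t | A t /\ N t = n].

Lemma finite_fibers_sub (T : choiceType) (A B : set T) (N : T -> nat) :
  (forall t, A t -> B t) -> finite_fibers B N -> finite_fibers A N.
Proof.
by move=> AB fB n; apply: sub_finite_set (fB n) => t /= [/AB].
Qed.

Lemma cser_bij (T U : choiceType) (A : set T) (B : set U) (N : T -> nat)
    (M : U -> nat) (f : T -> U) (g : U -> T) : finite_fibers A N ->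
    (forall t, A t -> [/\ B (f t), M (f t) = N t & g (f t) = t]) ->
    (forall t, B t -> A (g t) /\ f (g t) = t) ->
  cser A N = cser B M.
Proof.
move=> fA AB BA; apply/fpsP => n /=; congr (_%:R).
have [s [us sA]] := finite_setE (fA n).
rewrite (ccard_seq us sA) (@ccard_seq _ _ (map f s)) ?size_map //.
  rewrite map_inj_in_uniq // => t t' /sA[/AB[_ _ gt] _] /sA[/AB[_ _ gt'] _] e.
  by rewrite -gt e gt'.
move=> t; split => [/mapP[t' /sA[/AB[Bf Mf _] Nt'] ->]|[Bt Mt]].
  by split=> //; rewrite Mf.
have [Ag fg] := BA t Bt; apply/mapP; exists (g t) => //; apply/sA.
by split=> //; have [_ Mf _] := AB _ Ag; rewrite -Mf fg.
Qed.

Lemma cser_split (T : choiceType) (I : finType) (A : set T) (N : T -> nat)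
    (c : T -> I) : finite_fibers A N ->
  cser A N = \sum_(i : I) cser [set t | A t /\ c t = i] N.
Proof.
move=> fA; apply/fpsP => n; rewrite coef_fps_sum /= -natr_sum; congr (_%:R).
have [s [us sA]] := finite_setE (fA n).
rewrite (ccard_seq us sA) -sum1_size.
rewrite (partition_big c predT) //=; apply: eq_bigr => i _.
rewrite (@ccard_seq _ _ [seq t <- s | c t == i]) ?filter_uniq //.
  by rewrite -sum1_size big_filter.
move=> t; rewrite mem_filter; split => [/andP[/eqP ci /sA[At Nt]] //|].
by move=> [[At /eqP ->] Nt] /=; apply/sA.
Qed.

Lemma finite_fibersM (T U : choiceType) (A : set T) (B : set U) (N : T -> nat)
    (M : U -> nat) : finite_fibers A N -> finite_fibers B M ->
  finite_fibers [set p : T * U | A p.1 /\ B p.2] (fun p => N p.1 + M p.2)%N.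
Proof.
move=> fA fB n.
apply: (@sub_finite_set _ _ (\bigcup_(i in `I_n.+1)
  ([set t | A t /\ N t = i] `*` [set u | B u /\ M u = (n - i)%N]))).
  move=> [t u] /= [[At Bu] <-]; exists (N t); first by rewrite /= ltnS leq_addr.
  by split; split=> //=; rewrite addKn.
by apply: bigcup_finite => // i _; apply: finite_setX.
Qed.

Lemma cserM (T U : choiceType) (A : set T) (B : set U) (N : T -> nat)
    (M : U -> nat) : finite_fibers A N -> finite_fibers B M ->
  cser A N * cser B M
  = cser [set p : T * U | A p.1 /\ B p.2] (fun p => N p.1 + M p.2)%N.
Proof.
move=> fA fB; apply/fpsP => n; rewrite coef_fpsM /=.
have [s [us sE]] := finite_setE (finite_fibersM fA fB n).
rewrite (ccard_seq us sE) -sum1_size.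
rewrite (partition_big (fun p : T * U => inord (N p.1) : 'I_n.+1) predT) //=.
rewrite natr_sum; apply: eq_bigr => i _; rewrite -natrM; congr (_%:R).
have [sa [ua saE]] := finite_setE (fA i).
have [sb [ub sbE]] := finite_setE (fB (n - i)%N).
rewrite (ccard_seq ua saE) (ccard_seq ub sbE) -(size_allpairs pair).
rewrite -big_filter sum1_size; apply: perm_size; apply: uniq_perm.
- by apply: allpairs_uniq => // -[a b] [a' b'] _ _.
- exact: filter_uniq.
move=> [a b]; rewrite mem_filter; apply/allpairsP/andP => [[[a' b']]|[]] /=.
  move=> [/saE[Aa Na] /sbE[Bb Mb] [-> ->]]; split.
    by rewrite Na inord_val.
  by apply/sE; split=> //=; rewrite Na Mb subnKC // -ltnS.
move=> /eqP Ni /sE[[Aa Bb] /= NM].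
have iE : (i : nat) = N a by rewrite -Ni inordK // ltnS -NM leq_addr.
exists (a, b); split=> //=; [apply/saE|apply/sbE]; split=> //.
by rewrite iE -NM addKn.
Qed.

Lemma cser_scale3 (T : choiceType) (A : set T) (N : T -> nat) :
  cser A (fun t => 3 * N t)%N = V (cser A N).
Proof.
apply/fpsP => n; rewrite coef_V /=; case: ifP => [/dvdnP[k ->]|n3].
  rewrite mulnK //; congr (ccard _)%:R; apply/seteqP; split => t /= [At];
    by rewrite 1?mulnC => e; split=> //; lia.
rewrite (@ccard_seq _ _ [::]) // => t; split=> // -[_ nE].
by rewrite -nE dvdn_mulr in n3.
Qed.

Local Notation Eis := (int * int)%type.

(** The pair [(a, b)] stands for the Eisenstein integer [a - b w], [w] being a
    primitive cube root of unity; its norm is [a^2 + a b + b^2], and [a - b] is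
    its class modulo the prime [1 - w] above 3. *)
Definition enorm (z : Eis) : nat :=
  absz (z.1 ^+ 2 + z.1 * z.2 + z.2 ^+ 2).

Definition eclass (r : nat) : set Eis := [set z | ((z.1 - z.2) %% 3)%Z = r%:Z].

(** Multiplication by [w]. *)
Definition omega (z : Eis) : Eis := (z.2, - (z.1 + z.2)).

Lemma enormE z : (enorm z)%:Z = z.1 ^+ 2 + z.1 * z.2 + z.2 ^+ 2.
Proof.
rewrite /enorm gez0_abs //.
have : 0 <= (z.1 + z.2) ^+ 2 + z.1 ^+ 2 + z.2 ^+ 2.
  by rewrite !addr_ge0 // sqr_ge0.
by rewrite !expr2; nia.
Qed.

Lemma finite_enorm (A : set Eis) : finite_fibers A enorm.
Proof.
apply: (@finite_fibers_sub _ _ setT) => // n.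
apply: sub_finite_set (finite_theta_reps n) => z /= [_ <-].
by rewrite /theta_reps /= enormE.
Qed.

Lemma theta_cser : theta = cser setT enorm.
Proof.
apply/fpsP => n /=; congr (#|` fset_set _|)%:R; apply/seteqP.
split => z /=; rewrite /theta_reps /= -enormE; first by move=> [->].
by move=> [_ ->].
Qed.

Definition thetaC : {fps rat} := cser (eclass 1) enorm.

Lemma cser_class0 : cser (eclass 0) enorm = V theta.
Proof.
rewrite theta_cser -cser_scale3; symmetry.
(* multiplication by the prime [1 - w] *)
apply: (@cser_bij _ _ _ _ _ _ (fun z : Eis => (z.1 - z.2, z.1 + z.2 * 2))
  (fun z : Eis => (((2 * z.1 + z.2) %/ 3)%Z, ((z.2 - z.1) %/ 3)%Z))).
- move=> n; apply: sub_finite_set (finite_enorm setT (n %/ 3)%N) => z /= [_ <-].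
  by rewrite mulKn.
- move=> [a b] _; rewrite /eclass /=; split; first by lia.
    by apply/eqP; rewrite -eqz_nat PoszM !enormE /=; apply/eqP; ring.
  by congr (_, _); lia.
by move=> [a b]; rewrite /eclass /= => ab; split=> //; congr (_, _); lia.
Qed.

Lemma cser_class2 : cser (eclass 2) enorm = thetaC.
Proof.
apply: (@cser_bij _ _ _ _ _ _ (fun z : Eis => (- z.1, - z.2))
  (fun z : Eis => (- z.1, - z.2))); first exact: finite_enorm.
  move=> [a b]; rewrite /eclass /= => ab; split; first by lia.
    by apply/eqP; rewrite -eqz_nat !enormE /=; apply/eqP; ring.
  by rewrite !opprK.
by move=> [a b]; rewrite /eclass /= => ab; split; [lia|rewrite !opprK].
Qed.

Definition ecl (z : Eis) : 'I_3 := inord (absz ((z.1 - z.2) %% 3)%Z).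

Lemma eclE z : eclass (ecl z) z.
Proof. by rewrite /eclass /ecl /= inordK; lia. Qed.

Lemma eclP (r : 'I_3) : [set z | setT z /\ ecl z = r] = eclass r.
Proof.
apply/seteqP; split => z /=; first by move=> [_ <-]; apply: eclE.
rewrite /eclass /= => zr; split=> //; apply/val_inj => /=.
by rewrite inordK; case: r zr => r /= r3; lia.
Qed.

(** The sum over the cosets of the ideal [(1 - w)]; the two nontrivial ones are
    exchanged by the sign. *)
Lemma theta_split : theta = V theta + 2%:R * thetaC.
Proof.
rewrite {1}theta_cser (@cser_split _ _ _ _ ecl (finite_enorm _)).
rewrite (eq_bigr (fun r : 'I_3 => cser (eclass r) enorm)) => [|r _]; last first.
  by rewrite eclP.
rewrite !big_ord_recl big_ord0 /= /bump /= cser_class0 cser_class2 addr0.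
by rewrite -/thetaC mulr_natl.
Qed.

Local Notation Eis3 := (Eis * (Eis * Eis))%type.

Definition enorm3 (p : Eis3) : nat := enorm p.1 + (enorm p.2.1 + enorm p.2.2).

Definition etri (r0 r1 r2 : nat) : set Eis3 :=
  [set p | eclass r0 p.1 /\ (eclass r1 p.2.1 /\ eclass r2 p.2.2)].

Lemma finite_enorm3 (A : set Eis3) : finite_fibers A enorm3.
Proof.
have f2 := finite_fibersM (finite_enorm setT) (finite_enorm setT).
by apply: finite_fibers_sub (finite_fibersM (finite_enorm setT) f2).
Qed.

Lemma cser_etri r0 r1 r2 : cser (etri r0 r1 r2) enorm3
  = cser (eclass r0) enorm * (cser (eclass r1) enorm * cser (eclass r2) enorm).
Proof.
rewrite (cserM (finite_enorm _) (finite_enorm _)).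
rewrite (cserM (finite_enorm _)) //.
exact: (finite_fibersM (finite_enorm _) (finite_enorm _)).
Qed.

(** The vectors of [Z[w]^3] whose coordinates add up to 1 modulo the prime
    above 3. *)
Definition esum1 : set Eis3 := [set p |
  ((p.1.1 + p.2.1.1 + p.2.2.1 - (p.1.2 + p.2.1.2 + p.2.2.2)) %% 3)%Z = 1].

(** The classes of two coordinates determine that of the third. *)
Lemma cser_esum1 : cser esum1 enorm3
  = 3%:R * (V theta ^+ 2 * thetaC + V theta * thetaC ^+ 2 + thetaC ^+ 3).
Proof.
rewrite (@cser_split _ _ _ _ (fun p : Eis3 => (ecl p.1, ecl p.2.1))
  (finite_enorm3 _)).
rewrite (eq_bigr (fun r : 'I_3 * 'I_3 =>
    cser (etri r.1 r.2 ((1 + 2 * r.1 + 2 * r.2) %% 3)) enorm3)); last first.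
  move=> [r0 r1] _; congr cser; apply/seteqP; split => -[x0 [x1 x2]] /=.
    rewrite /esum1 /etri /= => -[e [<- <-]].
    have := eclE x0; have := eclE x1; rewrite /eclass /= => e1 e0.
    by split=> //; split=> //; lia.
  rewrite /etri /esum1 /= => -[e0 [e1 e2]]; split.
    by move: e0 e1 e2; rewrite /eclass /=; lia.
  have clE (r : 'I_3) z : eclass r z -> ecl z = r.
    by rewrite -eclP => -[].
  by rewrite (clE _ _ e0) (clE _ _ e1).
rewrite -(pair_bigA _ (fun r0 r1 : 'I_3 =>
  cser (etri r0 r1 ((1 + 2 * r0 + 2 * r1) %% 3)) enorm3)) /=.
rewrite !big_ord_recl !big_ord0 /= /bump /= !cser_etri.
have class1 : cser (eclass 1) enorm = thetaC by [].
rewrite !cser_class0 !cser_class2 !class1.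
move: (V theta) thetaC => A C; ring.
Qed.

Local Notation esum p := (p.1.1 + p.2.1.1 + p.2.2.1).

Definition ecube (k : nat) : set Eis3 :=
  [set p | etri 1 1 1 p /\ (esum p %% 3)%Z = k%:Z].

(** Multiplying the first coordinate by [w] changes the sum by one modulo 3. *)
Lemma ecube_rot k l : ((l + 1) %% 3 = k)%N -> (l < 3)%N ->
  cser (ecube k) enorm3 = cser (ecube l) enorm3.
Proof.
move=> kl l3.
apply: (@cser_bij _ _ _ _ _ _ (fun p : Eis3 => (omega p.1, p.2))
  (fun p : Eis3 => (omega (omega p.1), p.2))); first exact: finite_enorm3.
  move=> [[a0 b0] [[a1 b1] [a2 b2]]]; rewrite /ecube /etri /eclass /omega /=.
  move=> -[[e0 [e1 e2]] es]; split; first by split; [split|]; lia.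
    rewrite /enorm3 /=; congr (_ + _)%N.
    by apply/eqP; rewrite -eqz_nat !enormE /=; apply/eqP; ring.
  by congr ((_, _), _); lia.
move=> [[a0 b0] [[a1 b1] [a2 b2]]]; rewrite /ecube /etri /eclass /omega /=.
move=> -[[e0 [e1 e2]] es]; split; first by split; [split|]; lia.
by congr ((_, _), _); lia.
Qed.

(** The discrete Fourier transform on [Z[w]^3] multiplies the norm by 3 and
    identifies [esum1] with one third of the cube of the coset of 1, cut out by
    a congruence on the sum of the coordinates. *)
Lemma ecube_fourier : cser (ecube 0) enorm3 = V (cser esum1 enorm3).
Proof.
rewrite -cser_scale3; symmetry.
pose ft s1 s2 (p : Eis3) : Eis3 :=
  let: (x0, (x1, x2)) := p in
  let add (x y : Eis) : Eis := (x.1 + y.1, x.2 + y.2) in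
  (add x0 (add x1 x2), (add x0 (add (s1 x1) (s2 x2)),
                        add x0 (add (s2 x1) (s1 x2)))).
pose third (x : Eis) : Eis := ((x.1 %/ 3)%Z, (x.2 %/ 3)%Z).
pose w2 z := omega (omega z).
apply: (@cser_bij _ _ _ _ _ _ (ft omega w2)
  (fun p => let: (x0, (x1, x2)) := ft w2 omega p in
            (third x0, (third x1, third x2)))).
- move=> n; apply: sub_finite_set (finite_enorm3 setT (n %/ 3)%N) => z /= [_ <-].
  by rewrite mulKn.
- move=> [[a0 b0] [[a1 b1] [a2 b2]]].
  rewrite /esum1 /ecube /etri /eclass /ft /third /w2 /omega /= => e.
  split.
  + by split; [split; [|split]|]; lia.
  + apply/eqP; rewrite -eqz_nat PoszM !PoszD !enormE /=; apply/eqP; ring.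
  + by congr ((_, _), ((_, _), (_, _))); lia.
move=> [[a0 b0] [[a1 b1] [a2 b2]]].
rewrite /esum1 /ecube /etri /eclass /ft /third /w2 /omega /=.
move=> -[[e0 [e1 e2]] es]; split; first by lia.
by congr ((_, _), ((_, _), (_, _))); lia.
Qed.

Lemma thetaC_cube : thetaC ^+ 3
  = V (9%:R * (V theta ^+ 2 * thetaC + V theta * thetaC ^+ 2 + thetaC ^+ 3)).
Proof.
transitivity (cser (etri 1 1 1) enorm3).
  by rewrite cser_etri -/thetaC !exprS expr0 mulr1.
rewrite (@cser_split _ _ _ _ (fun p : Eis3 => inord (absz (esum p %% 3)%Z) : 'I_3)
  (finite_enorm3 _)).
rewrite (eq_bigr (fun _ => cser (ecube 0) enorm3)); last first.
  move=> r _; transitivity (cser (ecube r) enorm3).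
    congr cser; apply/seteqP; split => p /= -[tp e]; split=> //.
      by rewrite -e inordK; lia.
    by apply/val_inj; rewrite /= e inordK; case: (r) => /=.
  case: r => [[|[|[|r]]] r3] //=.
    by rewrite (@ecube_rot 1 0).
  by rewrite (@ecube_rot 2 1) // (@ecube_rot 1 0).
rewrite sumr_const card_ord ecube_fourier cser_esum1 -[LHS]mulr_natl.
move: (V theta ^+ 2 * _ + _ + _) => S.
have -> : 9%:R * S = 3%:R * (3%:R * S) by ring.
rewrite [RHS](rmorphM (@V _)) /=; congr (_ * _).
by symmetry; exact: (rmorph_nat (@V _)).
Qed.

End LatticePoints.

(** * Theta as an Eisenstein series *)

(** A modular equation of degree 3, written for [Y = 3 y]. *)
Definition modular_eq (Y : {fps rat}) :=
  Y ^+ 3 * V (1 + 2%:R * Y) ^+ 3 = V (9%:R * (Y + Y ^+ 2 + Y ^+ 3)).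

(** If the difference of two solutions starts in degree [k], then [k > 1], and
    the difference of the two equations starts in degree [k + 2] on the left
    and [3 k] on the right. *)
Lemma modular_eq_unique (Y Z : {fps rat}) :
  Y 0%N = 0 -> Z 0%N = 0 -> Y 1%N = 3%:R -> Z 1%N = 3%:R ->
  modular_eq Y -> modular_eq Z -> Y = Z.
Proof.
move=> Y0 Z0 Y1 Z1 eY eZ; apply/eqP; rewrite -subr_eq0; apply/negPn/negP.
move=> /fps_neq0_lead[k [dk d_low]].
have k2 : (1 < k)%N.
  by case: k dk {d_low} => [|[|k]] //; rewrite coef_fpsB ?Y0 ?Z0 ?Y1 ?Z1 subrr eqxx.
pose Q := (Y ^+ 2 + Y * Z + Z ^+ 2) * V (1 + 2%:R * Y) ^+ 3.
pose S := V (9%:R * (1 + Y + Z + Y ^+ 2 + Y * Z + Z ^+ 2))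
  - 2%:R * Z ^+ 3 * (V (1 + 2%:R * Y) ^+ 2
     + V (1 + 2%:R * Y) * V (1 + 2%:R * Z) + V (1 + 2%:R * Z) ^+ 2).
have alg (R : comNzRingType) (phi : {rmorphism R -> R}) (b c : R) :
    b ^+ 3 * phi (1 + 2%:R * b) ^+ 3 = phi (9%:R * (b + b ^+ 2 + b ^+ 3)) ->
    c ^+ 3 * phi (1 + 2%:R * c) ^+ 3 = phi (9%:R * (c + c ^+ 2 + c ^+ 3)) ->
    (b - c) * ((b ^+ 2 + b * c + c ^+ 2) * phi (1 + 2%:R * b) ^+ 3)
    = phi (b - c) * (phi (9%:R * (1 + b + c + b ^+ 2 + b * c + c ^+ 2))
      - 2%:R * c ^+ 3 * (phi (1 + 2%:R * b) ^+ 2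
         + phi (1 + 2%:R * b) * phi (1 + 2%:R * c) + phi (1 + 2%:R * c) ^+ 2)).
  move=> eb ec.
  transitivity (b ^+ 3 * phi (1 + 2%:R * b) ^+ 3
    - c ^+ 3 * phi (1 + 2%:R * c) ^+ 3
    - c ^+ 3 * (phi (1 + 2%:R * b) ^+ 3 - phi (1 + 2%:R * c) ^+ 3)); first by ring.
  by rewrite eb ec; ring.
have /fpsP/(_ (k + 2)%N) : (Y - Z) * Q = V (Y - Z) * S.
  exact: (alg _ _ _ _ eY eZ).
have sq_low (f g : {fps rat}) i : f 0%N = 0 -> g 0%N = 0 -> (i < 2)%N ->
    (f * g) i = 0.
  by move=> f0 g0 i2; apply: (@coef_fpsM_low _ _ _ 1 1) => // -[|j].
have Q_low i : (i < 2)%N -> Q i = 0.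
  move=> i2; apply: (@coef_fpsM_low _ _ _ 2 0) => // j j2.
  by rewrite coef_fpsD coef_fpsD !expr2 !sq_low // !addr0.
rewrite coef_fpsM_lead // (@coef_fpsM_low _ _ _ (3 * k) 0) //; first last.
- by lia.
- move=> i i_lt; rewrite coef_V; case: ifP => // i3; apply: d_low.
  by rewrite ltn_divLR // mulnC.
have -> : Q 2 = 27%:R.
  have sq_lead (f g : {fps rat}) : f 0%N = 0 -> g 0%N = 0 ->
      (f * g) 2 = f 1%N * g 1%N.
    by move=> f0 g0; apply: (@coef_fpsM_lead _ _ _ 1 1) => -[|j].
  rewrite -[2]addn0 coef_fpsM_lead // => [|j j2]; last first.
    by rewrite coef_fpsD coef_fpsD !expr2 !sq_low // !addr0.
  rewrite coef0_fpsX coef0_V coef_1natD Y0 coef_fpsD coef_fpsD !expr2 !sq_lead //.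
  by rewrite Y1 Z1.
by move/eqP; rewrite mulf_eq0 (negPf dk) /= pnatr_eq0.
Qed.

Lemma y_triple_modular_eq : modular_eq y_triple.
Proof.
have [e1 e2] := cubic_ratio_y_triple; rewrite /modular_eq.
move: e1 => /(congr1 (@V _)); rewrite rmorphM /= e2 !rmorphXn /=.
move: y_triple => Y e.
have alg (R : comNzRingType) (phi : {rmorphism R -> R}) (b : R) :
    phi (1 + 2%:R * b) ^+ 3 * (1 - b ^+ 3) = phi (1 - b) ^+ 3 ->
    b ^+ 3 * phi (1 + 2%:R * b) ^+ 3 = phi (9%:R * (b + b ^+ 2 + b ^+ 3)).
  move=> eb; transitivity (phi (1 + 2%:R * b) ^+ 3
    - phi (1 + 2%:R * b) ^+ 3 * (1 - b ^+ 3)); first by ring.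
  by rewrite eb; ring.
exact: alg e.
Qed.

Lemma theta0 : theta 0%N = 1.
Proof.
rewrite theta_cser /= (@ccard_seq _ _ [:: (0, 0)]) // => -[a b].
rewrite inE /enorm /= !expr2; split => [/eqP[-> ->] //|[_ e]].
by apply/eqP; congr (_, _); nia.
Qed.

Lemma Vtheta_unit : V theta \is a GRing.unit.
Proof. by apply: fps_unit1; rewrite coef0_V theta0. Qed.

Definition thetaC_ratio : {fps rat} := thetaC / V theta.

Lemma thetaCE : thetaC = V theta * thetaC_ratio.
Proof. by rewrite mulrC divrK ?Vtheta_unit. Qed.

Lemma thetaE : theta = V theta * (1 + 2%:R * thetaC_ratio).
Proof. by rewrite mulrDr mulr1 mulrCA -thetaCE -theta_split. Qed.

Lemma theta_modular_eq : modular_eq thetaC_ratio.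
Proof.
have := thetaC_cube; rewrite thetaCE.
have alg (R : comNzRingType) (phi : {rmorphism R -> R}) (A b : R) :
    A = phi A * phi (1 + 2%:R * b) ->
    (A * b) ^+ 3 = phi (9%:R * (A ^+ 2 * (A * b) + A * (A * b) ^+ 2
      + (A * b) ^+ 3)) ->
    phi A ^+ 3 * (b ^+ 3 * phi (1 + 2%:R * b) ^+ 3)
    = phi A ^+ 3 * phi (9%:R * (b + b ^+ 2 + b ^+ 3)).
  move=> eA e; transitivity ((phi A * phi (1 + 2%:R * b) * b) ^+ 3).
    by ring.
  by rewrite -eA e; ring.
move=> e; have u3 : V (V theta) ^+ 3 \is a GRing.unit.
  by rewrite unitrX // fps_unit1 // !coef0_V theta0.
apply: (mulrI u3); apply: alg e.
by rewrite -rmorphM -thetaE.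
Qed.

Lemma thetaC_ratio_low : thetaC_ratio 0%N = 0 /\ thetaC_ratio 1%N = 3%:R.
Proof.
have C0 : thetaC 0%N = 0.
  rewrite /= (@ccard_seq _ _ [::]) // => -[a b]; split=> // -[].
  by rewrite /eclass /enorm /= !expr2; nia.
have C1 : thetaC 1%N = 3%:R.
  rewrite /= (@ccard_seq _ _ [:: (1, 0); (0, -1); (-1, 1)]) // => -[a b].
  rewrite /eclass /enorm /= !expr2 !inE; split.
    by case/or3P => /eqP[-> ->].
  move=> [ab e].
  have [a3 b3] : (a = -1 \/ a = 0 \/ a = 1) /\ (b = -1 \/ b = 0 \/ b = 1).
    by split; nia.
  by case: a3 ab e => [->|[->|->]]; case: b3 => [->|[->|->]].
move: C0 C1; rewrite thetaCE coef0_fpsM coef1_fpsM (_ : V theta 1%N = 0) //.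
by rewrite coef0_V theta0 !mul1r mul0r addr0.
Qed.

(** The number of representations by [a^2 + a b + b^2] is six times a divisor
    sum of the character modulo 3: both sides give rise to the same solution
    of [modular_eq]. *)
Lemma theta_geis1 : theta = 6%:R * geis 1.
Proof.
have YY : thetaC_ratio = y_triple.
  have [T0 T1] := thetaC_ratio_low.
  apply: modular_eq_unique => //; first exact: coef0_y_triple.
  - exact: coef1_y_triple.
  - exact: theta_modular_eq.
  - exact: y_triple_modular_eq.
have uG := geis1_unit.
have cross : theta * V (geis 1) = V theta * geis 1.
  by rewrite [geis 1 in RHS]geis1_y_triple {1}thetaE YY; ring.
pose f := theta / geis 1.
have fV : f = V f.
  have uV : V (geis 1) \is a GRing.unit := V_geis1_unit.
  rewrite /f rmorphM /= rmorphV // -[V theta](mulrK uG) -cross.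
  by rewrite mulrAC mulrK.
(* a series fixed by [V] is constant *)
have f_low n : (0 < n)%N -> f n = 0.
  elim/ltn_ind: n => n IH n0; rewrite fV coef_V; case: ifP => // n3.
  by apply: IH; [rewrite ltn_Pdiv|rewrite divn_gt0 // dvdn_leq].
have fE : f = 6%:R.
  rewrite -fpsC_nat; apply/fpsP => -[|n]; last by rewrite f_low.
  have := congr1 (fun g : {fps rat} => g 0%N) (divrK uG theta : f * geis 1 = theta).
  rewrite coef0_fpsM theta0 => e.
  have : 6%:R * geis 1 0%N = 1 by rewrite -coef_fps_natM geis1 coef0_hexser.
  move=> e6; have : (f 0%N - 6%:R) * geis 1 0%N = 0 by rewrite mulrBl e e6 subrr.
  move/eqP; rewrite mulf_eq0 => /orP[/eqP/subr0_eq //|/eqP g0].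
  by move: e6; rewrite g0 mulr0 => /eqP; rewrite eq_sym oner_eq0.
by rewrite -fE divrK.
Qed.

(** The Hauptmodul of level 3, normalized to start with [q]. *)
Definition haupt : {fps rat} := (1 - cubic_ratio) / 27%:R.

Lemma y_fpsE : 3%:R * y_fps = y_triple.
Proof.
have e : theta / V theta = geis 1 / V (geis 1).
  have uV : V (geis 1) \is a GRing.unit := V_geis1_unit.
  apply: (mulIr uV); rewrite divrK // mulrAC -[RHS](mulrK Vtheta_unit).
  by rewrite theta_geis1 rmorphM /= [V 6%:R](rmorph_nat (@V _)); congr (_ / _); ring.
rewrite /y_fps e /y_triple; apply: (@fps_nat_inj 1).
have alg (R : comUnitRingType) (b k l : R) : k \is a GRing.unit ->
  l \is a GRing.unit -> l * 3%:R = k -> l * (3%:R * (b / k)) = l * (b / l).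
  move=> uk ul e3; rewrite mulrA e3 mulrC divrK // mulrC divrK //.
by apply: alg; [exact: (fps_nat_unit 5)|exact: (fps_nat_unit 1)|ring].
Qed.

Lemma haupt_y :
  (1 + 6%:R * y_fps) ^+ 3 * haupt
    = y_fps + 3%:R * y_fps ^+ 2 + 9%:R * y_fps ^+ 3
  /\ V haupt = y_fps ^+ 3.
Proof.
have [e1 e2] := cubic_ratio_y_triple; rewrite -y_fpsE in e1 e2.
have uh : 27%:R * haupt = 1 - cubic_ratio.
  by rewrite mulrC divrK //; exact: (fps_nat_unit 26).
have alg1 (R : comNzRingType) (y h x : R) : 27%:R * h = 1 - x ->
    (1 + 2%:R * (3%:R * y)) ^+ 3 * x = (1 - 3%:R * y) ^+ 3 ->
    27%:R * ((1 + 6%:R * y) ^+ 3 * h)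
    = 27%:R * (y + 3%:R * y ^+ 2 + 9%:R * y ^+ 3).
  move=> eh ex; transitivity ((1 + 6%:R * y) ^+ 3 * (27%:R * h)); first by ring.
  rewrite eh; transitivity ((1 + 6%:R * y) ^+ 3
    - (1 + 2%:R * (3%:R * y)) ^+ 3 * x); first by ring.
  by rewrite ex; ring.
have alg2 (R : comNzRingType) (phi : {rmorphism R -> R}) (y h x : R) :
    27%:R * h = 1 - x -> phi x = 1 - (3%:R * y) ^+ 3 ->
    27%:R * phi h = 27%:R * y ^+ 3.
  move=> eh ex; transitivity (phi (27%:R * h)); first by ring.
  by rewrite eh rmorphB ex; ring.
split; apply: (@fps_nat_inj 26); first exact: alg1 uh e1.
exact: alg2 uh e2.
Qed.

Lemma sec3_y_fps : sec3 1 y_fps = y_fps.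
Proof.
apply: (@fps_nat_inj 2); rewrite y_fpsE -[RHS]pure3_y_triple -y_fpsE.
apply/fpsP => n; rewrite coef_fps_natM !coef_sec3 coef_fps_natM.
by case: ifP => _; rewrite ?mulr0.
Qed.

(** * Divisibility by powers of 3 *)

Section Div3.
Variable R : comNzRingType.
Implicit Types (x y : R) (m n : nat).

Definition div3 n x := exists y, x = 3%:R ^+ n * y.

Lemma div3_0 n : div3 n 0.
Proof. by exists 0; rewrite mulr0. Qed.

Lemma div30 x : div3 0 x.
Proof. by exists x; rewrite expr0 mul1r. Qed.

Lemma div3D n x y : div3 n x -> div3 n y -> div3 n (x + y).
Proof. by move=> [u ->] [v ->]; exists (u + v); rewrite mulrDr. Qed.

Lemma div3N n x : div3 n x -> div3 n (- x).
Proof. by move=> [u ->]; exists (- u); rewrite mulrN. Qed.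

Lemma div3B n x y : div3 n x -> div3 n y -> div3 n (x - y).
Proof. by move=> dx dy; apply: div3D dx (div3N dy). Qed.

Lemma div3M m n x y : div3 m x -> div3 n y -> div3 (m + n) (x * y).
Proof. by move=> [u ->] [v ->]; exists (u * v); rewrite exprD mulrACA. Qed.

Lemma div3Ml n x y : div3 n x -> div3 n (x * y).
Proof. by move=> [u ->]; exists (u * y); rewrite mulrA. Qed.

Lemma div3Mr n x y : div3 n y -> div3 n (x * y).
Proof. by rewrite mulrC; apply: div3Ml. Qed.

Lemma div3_le m n x : (m <= n)%N -> div3 n x -> div3 m x.
Proof.
move=> mn [u ->]; exists (3%:R ^+ (n - m) * u).
by rewrite mulrA -exprD subnKC.
Qed.

Lemma div3_sum n (I : Type) (r : seq I) (P : pred I) (F : I -> R) :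
  (forall i, P i -> div3 n (F i)) -> div3 n (\sum_(i <- r | P i) F i).
Proof. by move=> dF; elim/big_ind: _ => //; [exact: div3_0|exact: div3D]. Qed.

Lemma div3_exp n : div3 n (3%:R ^+ n : R).
Proof. by exists 1; rewrite mulr1. Qed.

End Div3.

Lemma div3_rmorph (R S : comNzRingType) (phi : {rmorphism R -> S}) n x :
  div3 n x -> div3 n (phi x).
Proof. by move=> [y ->]; exists (phi y); rewrite rmorphM rmorphXn rmorph_nat. Qed.

Lemma div3_fps (R : comNzRingType) n (f : {fps R}) :
  div3 n f <-> forall i, div3 n (f i).
Proof.
have natE : (3%:R : {fps R}) ^+ n = fpsC (3%:R ^+ n).
  by rewrite rmorphXn rmorph_nat.
split=> [[g ->] i|df]; first by exists (g i); rewrite natE coef_fpsCM.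
exists (Fps (fun i => projT1 (cid (df i)))); apply/fpsP => i.
by rewrite natE coef_fpsCM /=; apply: projT2 (cid (df i)).
Qed.

(** * The 3-adic integers *)

Lemma Z3_natE n : (n%:R : Z3) = Z3_int n.
Proof.
elim: n => [|n IH]; first by [].
rewrite mulrS {}IH; apply/Z3P => m /=.
by rewrite modzDm.
Qed.

Lemma Z3_intM (a b : int) : Z3_int a * Z3_int b = Z3_int (a * b).
Proof. by apply/Z3P => m /=; rewrite modzMm. Qed.

Lemma Z3_expE n : (3%:R : Z3) ^+ n = Z3_int (3 ^+ n).
Proof.
elim: n => [|n IH]; first by [].
by rewrite !exprS IH (Z3_natE 3) Z3_intM.
Qed.

Lemma div3_residue n (x : Z3) : div3 n x <-> x n = 0.
Proof.
split=> [[y ->]|x0]; first by rewrite Z3_expE /= modzz mul0r mod0z.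
pose u m := (x (m + n)%N %/ 3 ^+ n)%Z.
have n0 : (3 ^+ n : int) != 0 by rewrite expf_neq0.
have uE m : x (m + n)%N = 3 ^+ n * u m.
  rewrite mulrC divzK //; apply/dvdz_mod0P.
  by rewrite addnC -Z3_modn Z3_small.
have uP m : (u m = u m.+1 %[mod 3 ^+ m])%Z.
  apply/eqP; rewrite eqz_mod_dvd -(dvdz_mul2l n0) mulrBr -!uE -exprD.
  by rewrite -eqz_mod_dvd [(n + m)%N]addnC addSn; apply/eqP; exact: Z3_mod.
exists (Z3_of uP); apply/Z3P => m; rewrite Z3_expE /= modzMm -uE.
by rewrite -Z3_modn Z3_small.
Qed.

Lemma div3_eq_residue n (x y : Z3) : div3 n (x - y) <-> x n = y n.
Proof.
rewrite div3_residue; split=> [|xy] /=; rewrite modzDmr.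
  move=> h; rewrite -[x n]Z3_small -[y n]Z3_small; apply/eqP.
  by rewrite eqz_mod_dvd; apply/dvdz_mod0P.
by rewrite xy subrr mod0z.
Qed.

Lemma div3_all0 (x : Z3) : (forall n, div3 n x) -> x = 0.
Proof.
move=> dx; apply/Z3P => n; have /div3_residue -> := dx n.
by rewrite /= mod0z.
Qed.

Lemma Z3_complete (s : nat -> Z3) : (forall n, div3 n (s n.+1 - s n)) ->
  exists z, forall n, div3 n (z - s n).
Proof.
move=> ds; pose u n := s n n.
have uP n : (u n = u n.+1 %[mod 3 ^+ n])%Z.
  by rewrite /u -Z3_mod; have /div3_eq_residue -> := ds n.
exists (Z3_of uP) => n; apply/div3_eq_residue.
by rewrite /= Z3_small.
Qed.

Lemma Z3_nat_neq0 n : n.+1%:R != 0 :> Z3.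
Proof.
apply/eqP; rewrite Z3_natE => /Z3P/(_ n.+1); rewrite /= mod0z modz_small //.
by rewrite -natrX natz; apply/andP; split=> //; rewrite ltz_nat ltn_expl.
Qed.

Lemma Z3_3neq0 n : 3%:R ^+ n != 0 :> Z3.
Proof. by rewrite expf_neq0 // Z3_nat_neq0. Qed.

(** The inverse is the sum of a geometric series. *)
Lemma Z3_unit_1B (x : Z3) : 1 - 3%:R * x \is a GRing.unit.
Proof.
pose s n : Z3 := \sum_(i < n) (3%:R * x) ^+ i.
have [z zE] : exists z, forall n, div3 n (z - s n).
  apply: Z3_complete => n; rewrite /s big_ord_recr /= addrAC subrr add0r exprMn.
  exact/div3Ml/div3_exp.
apply/unitrPr; exists z; apply/eqP; rewrite -subr_eq0; apply/eqP.
apply: div3_all0 => n.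
have -> : (1 - 3%:R * x) * z - 1
    = (1 - 3%:R * x) * (z - s n) - (3%:R * x) ^+ n.
  have e : (3%:R * x) ^+ n - 1 = (3%:R * x - 1) * s n by rewrite subrX1.
  transitivity ((1 - 3%:R * x) * z - 1 + ((3%:R * x - 1) * s n
    - ((3%:R * x) ^+ n - 1))); first by rewrite e; ring.
  ring.
by apply: div3B; [exact: div3Mr|rewrite exprMn; exact/div3Ml/div3_exp].
Qed.

Lemma Z3_mod3 (x : Z3) : exists r y, (r < 3)%N /\ x = r%:R + 3%:R * y.
Proof.
exists (absz (x 1%N)).
have x1 : 0 <= x 1%N < 3 by rewrite -Z3_small modz_ge0 ?ltz_mod.
have [y yE] : div3 1 (x - (absz (x 1%N))%:R).
  apply/div3_eq_residue; rewrite Z3_natE /= modz_small; lia.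
by exists y; split; [lia|rewrite -[3%:R]expr1 -yE addrC subrK].
Qed.

Lemma Z3_unit (x : Z3) : ~ div3 1 x -> x \is a GRing.unit.
Proof.
have [[|[|[|r]]] [y [r3 ->]]] := Z3_mod3 x => // nx.
- by case: nx; exists y; rewrite add0r expr1.
- by have := Z3_unit_1B (- y); rewrite mulrN opprK.
rewrite -unitrN; have := Z3_unit_1B (y + 1).
by rewrite (_ : 1 - _ = - (2%:R + 3%:R * y)) //; ring.
Qed.

Lemma Z3_nat_unit n : ~~ (3 %| n)%N -> n%:R \is a @GRing.unit Z3.
Proof.
move=> n3; apply: Z3_unit => /div3_residue; rewrite Z3_natE /=.
by move/eqP; lia.
Qed.

(** * Evaluation of power series at multiples of 3 *)

Lemma ev_ex (c : Z3) (f : {fps Z3}) : exists z : Z3,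
  forall n, div3 n (z - \sum_(i < n) f i * (3%:R * c) ^+ i).
Proof.
apply: Z3_complete => n; rewrite big_ord_recr /= addrAC subrr add0r exprMn.
exact/div3Mr/div3Ml/div3_exp.
Qed.

Definition ev (c : Z3) (f : {fps Z3}) : Z3 := projT1 (cid (ev_ex c f)).

Lemma evP c f n : div3 n (ev c f - \sum_(i < n) f i * (3%:R * c) ^+ i).
Proof. exact: (projT2 (cid (ev_ex c f))). Qed.

Lemma ev_shift c f : ev c f = f 0%N + 3%:R * c * ev c (fps_shift f).
Proof.
apply/eqP; rewrite -subr_eq0; apply/eqP; apply: div3_all0 => n.
have := evP c f n.+1; have := evP c (fps_shift f) n.
rewrite big_ord_recl expr0 mulr1.
have -> : \sum_(i < n) f (lift ord0 i) * (3%:R * c) ^+ lift ord0 i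
    = 3%:R * c * \sum_(i < n) fps_shift f i * (3%:R * c) ^+ i.
  by rewrite mulr_sumr; apply: eq_bigr => i _; rewrite exprS mulrCA.
set s := \sum_(i < n) _ => d1 /(div3_le (leqnSn n)) d2.
rewrite (_ : _ - _ = (ev c f - (f 0%N + 3%:R * c * s))
  - 3%:R * c * (ev c (fps_shift f) - s)); last by ring.
exact/div3B/div3Mr.
Qed.

(** Division by [X - 3c], with [ev c f] as the remainder. *)
Lemma ev_dvd c f :
  exists h, f = fpsC (ev c f) + (fpsX Z3 - fpsC (3%:R * c)) * h.
Proof.
exists (Fps (fun i => ev c (iter i.+1 (@fps_shift Z3) f))).
apply/fpsP => n; rewrite coef_fpsD mulrBl coef_fpsB coef_fpsXM coef_fpsCM.
case: n => [|n] /=; first by rewrite sub0r {1}ev_shift addrK.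
by rewrite add0r {1}ev_shift addrK -[fps_shift _]/(iter n.+1 _ _) coef_iter_shift.
Qed.

Lemma ev_unique c z f h :
  f = fpsC z + (fpsX Z3 - fpsC (3%:R * c)) * h -> z = ev c f.
Proof.
move=> fE; have [k kE] := ev_dvd c f.
have e : fpsC (z - ev c f) = (fpsX Z3 - fpsC (3%:R * c)) * (k - h).
  have {fE} := etrans (esym fE) kE; rewrite rmorphB /=.
  move: (fpsC z) (fpsC (ev c f)) (_ - _) => u v L e0.
  transitivity (u + L * h - L * h - v); first by ring.
  by rewrite e0; ring.
move: e; set d := z - _; set l := k - h => e.
have d0 : d = - (3%:R * c) * l 0%N.
  by have /fpsP/(_ 0%N) := e; rewrite mulrBl coef_fpsB coef_fpsXM coef_fpsCM mulNr sub0r.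
have lS n : l n = 3%:R * c * l n.+1.
  have /fpsP/(_ n.+1) := e; rewrite mulrBl coef_fpsB coef_fpsXM coef_fpsCM /=.
  by move/esym/eqP; rewrite subr_eq0 => /eqP.
have ln n : l 0%N = (3%:R * c) ^+ n * l n.
  by elim: n => [|n ->]; rewrite ?mul1r // exprSr -mulrA -lS.
apply/eqP; rewrite -subr_eq0 -/d; apply/eqP; apply: div3_all0 => n.
by rewrite d0 (ln n) exprMn; apply/div3Mr/div3Ml/div3Ml/div3_exp.
Qed.

Fact ev_is_zmod_morphism c : zmod_morphism (ev c).
Proof.
move=> f g; have [h hE] := ev_dvd c f; have [k kE] := ev_dvd c g.
by symmetry; apply: (@ev_unique c _ _ (h - k)); rewrite {1}hE {1}kE rmorphB; ring.
Qed.
HB.instance Definition _ c :=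
  GRing.isZmodMorphism.Build {fps Z3} Z3 (ev c) (ev_is_zmod_morphism c).

Lemma evC c z : ev c (fpsC z) = z.
Proof. by symmetry; apply: (@ev_unique c _ _ 0); rewrite mulr0 addr0. Qed.

Lemma evX c : ev c (fpsX Z3) = 3%:R * c.
Proof. by symmetry; apply: (@ev_unique c _ _ 1); rewrite mulr1 addrCA subrr addr0. Qed.

Fact ev_is_monoid_morphism c : monoid_morphism (ev c).
Proof.
split=> [|f g]; first exact: evC.
have [h hE] := ev_dvd c f; have [k kE] := ev_dvd c g.
symmetry; apply: (@ev_unique c _ _ (fpsC (ev c f) * k + h * g)).
have alg (R : comNzRingType) (x y a b L s t : R) : x = a + L * s ->
    y = b + L * t -> x * y = a * b + L * (a * t + s * y).
  move=> ex ey; transitivity (a * y + L * s * y); first by rewrite {1}ex; ring.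
  by rewrite {1}ey; ring.
by rewrite rmorphM; apply: alg.
Qed.
HB.instance Definition _ c :=
  GRing.isMonoidMorphism.Build {fps Z3} Z3 (ev c) (ev_is_monoid_morphism c).

Section Rescale.
Variable R : comNzRingType.

(** The rescaling [w = 3 W] of the weight variable. *)
Definition rescale (f : {fps R}) : {fps R} := fps_comp (fpsC 3%:R * fpsX R) f.
Fact rescale_is_zmod_morphism : zmod_morphism rescale.
Proof. exact: raddfB. Qed.
HB.instance Definition _ := GRing.isZmodMorphism.Build {fps R} {fps R}
  rescale rescale_is_zmod_morphism.

Fact rescale_is_monoid_morphism : monoid_morphism rescale.
Proof. by split=> [|f g]; [exact: fps_comp1|exact: comp_scaleM]. Qed.
HB.instance Definition _ := GRing.isMonoidMorphism.Build {fps R} {fps R}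
  rescale rescale_is_monoid_morphism.

Lemma coef_rescale f n : rescale f n = 3%:R ^+ n * f n.
Proof. exact: coef_fps_comp_scale. Qed.

End Rescale.

Lemma rescale_inj : injective (@rescale Z3).
Proof.
move=> f g fg; apply/fpsP => n; apply: (mulfI (Z3_3neq0 n)).
by rewrite -!coef_rescale fg.
Qed.

(** The point [w = 9 c] is [W = 3 c]. *)
Lemma fps_value_ev c f z :
  fps_value f (9%:R * c) z -> z = ev c (rescale f).
Proof.
move=> fz; apply/eqP; rewrite -subr_eq0; apply/eqP; apply: div3_all0 => m.
have [N NP] := fz m; pose n := maxn N m.
have nN : (N <= n)%N by rewrite leq_maxl.
have e := evP c (rescale f) n.
have sE : \sum_(i < n) rescale f i * (3%:R * c) ^+ i
    = \sum_(i < n) f i * (9%:R * c) ^+ i.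
  apply: eq_bigr => i _; rewrite coef_rescale !exprMn.
  by rewrite (_ : 9%:R = 3%:R * 3%:R) ?exprMn; ring.
move: e; rewrite sE => /(div3_le (leq_maxr N m)) e.
have /div3_eq_residue d := esym (NP n nN).
rewrite (_ : z - _ = (z - \sum_(i < n) f i * (9%:R * c) ^+ i)
  - (ev c (rescale f) - \sum_(i < n) f i * (9%:R * c) ^+ i)); last by ring.
exact: div3B.
Qed.

(** * The weights [2 * 3^(m+1)] *)

Definition wt (m : nat) : nat := 2 * 3 ^ m.+1.

(** [pt m] is [(4 ^ wt m - 1) / 9]. *)
Fixpoint pt (m : nat) : Z3 := if m is m'.+1
  then 3%:R * pt m' * (1 + 9%:R * pt m' + 27%:R * pt m' ^+ 2) else 455%:R.

Lemma wt_even m : ~~ odd (wt m).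
Proof. by rewrite /wt oddM. Qed.

Lemma wt_ge2 m : (2 <= wt m)%N.
Proof. by rewrite /wt -{1}[2%N]muln1 leq_pmul2l // expn_gt0. Qed.

Lemma ptE m : 1 + 9%:R * pt m = 4%:R ^+ wt m.
Proof.
elim: m => [|m IH].
  by rewrite (_ : wt 0 = 6%N) //=; ring.
rewrite /wt expnS mulnCA mulnC exprM -/(wt m) -IH /=; ring.
Qed.

Lemma pt_div3 m : div3 m (pt m).
Proof.
elim: m => [|m IH]; first exact: div30.
by rewrite /= -add1n; apply/div3Ml/div3M => //; rewrite -[3%:R]expr1; exact: div3_exp.
Qed.

Lemma pt_neq0 m : pt m != 0.
Proof.
elim: m => [|m IH] /=; first exact: (Z3_nat_neq0 454).
rewrite !mulf_neq0 ?(Z3_nat_neq0 2) //.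
have u := Z3_unit_1B (- (3%:R * pt m + 9%:R * pt m ^+ 2)).
apply: contraTneq u => e; rewrite (_ : 1 - _ = 0) ?unitr0 // -e; ring.
Qed.

(** A power series that vanishes at infinitely many of the points [3 pt m],
    which accumulate at 0, is zero. *)
Lemma ev_identity (Q : nat -> Prop) (f : {fps Z3}) :
  (forall M, exists2 m, (M <= m)%N & Q m) ->
  (forall m, Q m -> ev (pt m) f = 0) -> f = 0.
Proof.
move=> Qinf fQ; apply/eqP/negPn/negP => /fps_neq0_lead[k [fk f_low]].
pose g : {fps Z3} := Fps (fun n => f (n + k)%N).
have fE : f = fpsX Z3 ^+ k * g.
  apply/fpsP => n; rewrite coef_fpsXnM; case: leqP => [kn|/f_low //].
  by rewrite /= subnK.
case/eqP: fk; apply: div3_all0 => n; have [m nm Qm] := Qinf n.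
have /eqP : (3%:R * pt m) ^+ k * ev (pt m) g = 0.
  rewrite -[RHS](fQ m Qm) -evX -rmorphXn -rmorphM; congr (ev _ _).
  exact: esym fE.
rewrite mulf_eq0 expf_eq0 mulf_eq0 (negPf (pt_neq0 m)) (negPf (Z3_nat_neq0 2)).
rewrite andbF /= ev_shift => /eqP g0.
have gE : g 0%N = - (3%:R * pt m * ev (pt m) (fps_shift g)).
  by apply/eqP; rewrite -addr_eq0 g0.
rewrite -[X in div3 n X]/(g 0%N) gE.
apply/div3N/div3Ml/div3Mr; exact: div3_le nm (pt_div3 m).
Qed.

(** * The universal weight *)

(** [logseq N] is [((1 + 3 W)^(3^N) - 1) / 3^(N+1)]; it tends to
    [log (1 + 3 W) / 3]. *)
Fixpoint logseq (N : nat) : {fps Z3} := if N is N'.+1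
  then logseq N' + 3%:R ^+ N'.+1 * logseq N' ^+ 2
    + 3%:R ^+ (N' + N').+1 * logseq N' ^+ 3
  else fpsX Z3.

Lemma logseqE N :
  1 + 3%:R ^+ N.+1 * logseq N = (1 + 3%:R * fpsX Z3) ^+ (3 ^ N).
Proof.
elim: N => [|N IH]; first by rewrite expn0 expr1.
rewrite expnS mulnC exprM -IH /=.
rewrite [3%:R ^+ N.+2]exprS !exprS exprD; move: (3%:R ^+ N) (logseq N) => a l.
ring.
Qed.

Lemma logseq_ex : exists g : {fps Z3}, forall N, div3 N.+1 (g - logseq N).
Proof.
have step N : div3 N.+1 (logseq N.+1 - logseq N).
  have alg (a b l : {fps Z3}) : l + a + b - l = a + b by ring.
  rewrite [logseq N.+1]/= alg; apply: div3D; apply: div3Ml.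
    exact: div3_exp.
  by apply: div3_le (div3_exp _ _); rewrite ltnS leq_addr.
have lim n : exists z, forall N, div3 N (z - logseq N n).
  apply: Z3_complete => N; apply: div3_le (leqnSn N) _.
  by have /div3_fps/(_ n) := step N.
exists (Fps (fun n => projT1 (cid (lim n)))) => N; apply/div3_fps => n /=.
have zN := projT2 (cid (lim n)) N.+1.
have /div3_fps/(_ n) sN := step N.
rewrite (_ : _ - logseq N n = (projT1 (cid (lim n)) - logseq N.+1 n)
  + (logseq N.+1 - logseq N) n); first exact: div3D.
by rewrite coef_fpsB addrA subrK.
Qed.

(** At [W = 3 pt m] one has [1 + 3 W = 4 ^ wt m], so [log (1 + 3 W)] takes the
    value [wt m * log 4]. The number [log 4] is 3 times a unit; dividing by it
    gives [kappa]. *)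
Lemma kappa_ex : exists kappa : {fps Z3}, forall m, ev (pt m) kappa = (wt m)%:R.
Proof.
have [g gE] := logseq_ex.
have evlog m N : 3%:R ^+ N.+1 * ev (pt m) (logseq N) = 9%:R * pt (m + N).
  have := congr1 (ev (pt m)) (logseqE N).
  have -> : ev (pt m) (1 + 3%:R ^+ N.+1 * logseq N)
      = 1 + 3%:R ^+ N.+1 * ev (pt m) (logseq N).
    by rewrite rmorphD rmorph1 rmorphM rmorphXn rmorph_nat.
  have -> : ev (pt m) ((1 + 3%:R * fpsX Z3) ^+ (3 ^ N))
      = (1 + 3%:R * (3%:R * pt m)) ^+ (3 ^ N).
    by rewrite rmorphXn rmorphD rmorph1 rmorphM rmorph_nat /= evX.
  move=> e.
  have e2 : 4%:R ^+ wt (m + N) = (1 + 3%:R * (3%:R * pt m)) ^+ (3 ^ N) :> Z3.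
    rewrite (_ : 1 + _ = 1 + 9%:R * pt m); last by ring.
    by rewrite ptE -exprM; congr (_ ^+ _); rewrite /wt -addSn expnD mulnA.
  by move: e; rewrite -e2 -ptE => /addrI.
have evS m : ev (pt m.+1) g = 3%:R * ev (pt m) g.
  apply/eqP; rewrite -subr_eq0; apply/eqP; apply: div3_all0 => N.
  have d1 : div3 N.+1 (ev (pt m.+1) g - ev (pt m.+1) (logseq N)).
    by rewrite -rmorphB; apply: div3_rmorph; exact: gE.
  have d2 : div3 N.+2 (ev (pt m) g - ev (pt m) (logseq N.+1)).
    by rewrite -rmorphB; apply: div3_rmorph; exact: gE.
  have e : ev (pt m.+1) (logseq N) = 3%:R * ev (pt m) (logseq N.+1).
    apply: (mulfI (Z3_3neq0 N.+1)).
    by rewrite [LHS]evlog [RHS]mulrA -exprSr [RHS]evlog addSnnS.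
  rewrite (_ : _ - _ = (ev (pt m.+1) g - ev (pt m.+1) (logseq N))
    - 3%:R * (ev (pt m) g - ev (pt m) (logseq N.+1))); last by rewrite e; ring.
  apply: div3B; first exact: (div3_le (leqnSn N)) d1.
  by apply/div3Mr; apply: div3_le d2; rewrite -addn2 leq_addr.
(* 455 is prime to 3 *)
have [e eE] : exists e, ev (pt 0) g = 3%:R * (455%:R + 3%:R * e).
  have [e eE] : div3 2 (ev (pt 0) g - ev (pt 0) (logseq 1)).
    by have := div3_rmorph (ev (pt 0)) (gE 1%N); rewrite rmorphB.
  have l1 : ev (pt 0) (logseq 1) = 3%:R * pt 0 + 3%:R * (3%:R * pt 0) ^+ 2
      + 3%:R * (3%:R * pt 0) ^+ 3.
    rewrite (_ : logseq 1 = fpsX Z3 + 3%:R * fpsX Z3 ^+ 2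
      + 3%:R * fpsX Z3 ^+ 3) //.
    rewrite !(rmorphD (ev (pt 0))) !(rmorphM (ev (pt 0))).
    by rewrite !(rmorph_nat (ev (pt 0))) /= evX.
  exists (e + 3%:R * pt 0 ^+ 2 + 9%:R * pt 0 ^+ 3).
  rewrite -[LHS](subrK (ev (pt 0) (logseq 1))) eE l1 -[455%:R]/(pt 0).
  by move: (pt 0) => p; ring.
have [v v1] : exists v, v * (455%:R + 3%:R * e) = 2%:R.
  have : 455%:R + 3%:R * e \is a GRing.unit.
    apply: Z3_unit => -[y]; rewrite expr1 => ey.
    have : div3 1 (2%:R : Z3).
      exists (y - e - 151%:R); rewrite expr1 !mulrBr -ey; ring.
    by move/div3_residue; rewrite Z3_natE.
  by move=> u; exists (2%:R / (455%:R + 3%:R * e)); rewrite divrK.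
exists (fpsC v * g) => m; rewrite rmorphM /= evC.
have -> : ev (pt m) g = 3%:R ^+ m.+1 * (455%:R + 3%:R * e).
  elim: m => [|m IH]; first by rewrite expr1.
  by rewrite evS IH mulrA -exprS.
by rewrite mulrCA v1 /wt natrM natrX mulrC.
Qed.

Lemma logn3_fact n : (logn 3 n`! <= n./2)%N.
Proof.
rewrite logn_fact // geq_half_double -muln2.
suff h K : ((\sum_(1 <= k < K.+1) n %/ 3 ^ k) * 2 + n %/ 3 ^ K <= n)%N.
  exact: leq_trans (leq_addr _ _) (h n).
elim: K => [|K IH]; first by rewrite big_geq // expn0 divn1.
rewrite big_nat_recr //=; apply: leq_trans IH.
rewrite expnSr divnMA; lia.
Qed.

(** The number [6^n / n!], together with its divisibility by 3. *)
Lemma expo_coef_ex n : exists2 e : Z3,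
  n`!%:R * e = 6%:R ^+ n & div3 (uphalf n) e.
Proof.
have [u u3 uE] := pfactor_coprime (isT : prime 3) (fact_gt0 n).
have uu : u%:R \is a @GRing.unit Z3.
  by apply: Z3_nat_unit; rewrite -prime_coprime.
have vn := logn3_fact n; set v := logn 3 n`! in uE vn.
have nv : (v <= n)%N by lia.
exists (3%:R ^+ (n - v) * (2%:R ^+ n / u%:R)).
  rewrite uE natrM natrX (_ : 6%:R = 3%:R * 2%:R :> Z3); last by ring.
  rewrite exprMn (_ : 3%:R ^+ n = 3%:R ^+ (n - v) * 3%:R ^+ v);
    last by rewrite -exprD subnK.
  move: (3%:R ^+ (n - v)) (3%:R ^+ v) (2%:R ^+ n) => a b c.
  transitivity (a * b * c * (u%:R / u%:R)); first by ring.
  by rewrite divrr // mulr1.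
apply: div3Ml; apply: div3_le (div3_exp _ _); lia.
Qed.

Lemma coef_1D6X_exp (R : comNzRingType) k n :
  ((1 + 6%:R * fpsX R) ^+ k) n = 'C(k, n)%:R * 6%:R ^+ n.
Proof.
elim: k n => [|k IH] n.
  by rewrite expr0 coef_fps1; case: n => [|n]; rewrite ?bin0 ?mul1r // mul0r.
rewrite exprS mulrDl mul1r -mulrA coef_fpsD coef_fps_natM coef_fpsXM IH.
case: n => [|n]; first by rewrite !bin0 mulr0 addr0.
rewrite /= IH binS natrD exprS; ring.
Qed.

(** The formal power [(1 + 6 X) ^ kappa], where [kappa] is the universal
    weight. *)
Lemma universal_power : exists (kappa : {fps Z3}) (beta : {fps {fps Z3}}),
  [/\ beta 0%N = 1, forall n, div3 (uphalf n) (beta n),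
    (1 + 6%:R * fpsX _) * euler beta = fpsC (6%:R * kappa) * (fpsX _ * beta)
  & forall m, fps_map (ev (pt m)) beta = (1 + 6%:R * fpsX Z3) ^+ wt m].
Proof.
have [kappa kE] := kappa_ex.
pose e n := projT1 (cid2 (expo_coef_ex n)).
have eE n : n`!%:R * e n = 6%:R ^+ n by rewrite /e; case: cid2.
have e3 n : div3 (uphalf n) (e n) by rewrite /e; case: cid2.
have f0 n : n`!%:R != 0 :> Z3 by rewrite -(prednK (fact_gt0 n)) Z3_nat_neq0.
have eS n : n.+1%:R * e n.+1 = 6%:R * e n.
  apply: (mulfI (f0 n)); rewrite [RHS]mulrCA eE -exprS -eE factS natrM; ring.
exists kappa, (Fps (fun n => fpsC (e n) * \prod_(i < n) (kappa - i%:R))).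
split=> [||| m].
- rewrite /= big_ord0 mulr1 (_ : e 0%N = 1) //.
  by have := eE 0%N; rewrite expr0 mul1r.
- move=> n /=; have [z ->] := e3 n; apply: div3Ml.
  by rewrite rmorphM rmorphXn rmorph_nat; apply/div3Ml/div3_exp.
- apply/fpsP => n; rewrite mulrDl mul1r coef_fpsD -mulrA coef_fps_natM.
  rewrite coef_fpsCM !coef_fpsXM; case: n => [|n].
    by rewrite !mulr0 addr0 /euler /= mul0r.
  rewrite [in X in X + _]/euler [in X in _ + X]/euler /= big_ord_recr /=.
  set P := \prod_(i < n) _.
  have eS' : n.+1%:R * fpsC (e n.+1) = 6%:R * fpsC (e n).
    by rewrite -!fpsC_nat -!rmorphM eS.
  rewrite [n.+1%:R * _]mulrA eS'; ring.
apply/fpsP => n; rewrite coef_1D6X_exp /= rmorphM /= evC rmorph_prod /=.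
under eq_bigr => i _ do rewrite rmorphB rmorph_nat /= kE.
have -> : \prod_(i < n) ((wt m)%:R - i%:R) = (wt m ^_ n)%:R :> Z3.
  elim: n => [|n IH]; first by rewrite big_ord0 ffactn0.
  rewrite big_ord_recr IH ffactnSr natrM /=.
  have [nm|nm] := leqP n (wt m); first by rewrite natrB.
  by rewrite ffact_small // !mul0r.
apply: (mulfI (f0 n)).
rewrite mulrA eE -bin_ffact natrM; ring.
Qed.

(** * The series [y] and the Hauptmodul over an arbitrary ring *)

Section Universal.
Variable R : comNzRingType.

(** The series [y] over any ring: the division by 6 in its definition has been
    carried out. *)
Definition yser : {fps R} := (chiser R - V (chiser R)) / V (hexser R).

(** The Hauptmodul as a rational function of [y]. *)
Definition tfrac : {fps R} :=
  fpsX R * (1 + 3%:R * fpsX R + 9%:R * fpsX R ^+ 2)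
    / (1 + 6%:R * fpsX R) ^+ 3.

Definition tser : {fps R} := fps_comp yser tfrac.

Lemma unit_1D6X : 1 + 6%:R * fpsX R \is a GRing.unit.
Proof. by apply: fps_unit1; rewrite coef_1natD mulr0 addr0. Qed.

Lemma VhexserM_yser : V (hexser R) * yser = chiser R - V (chiser R).
Proof. by rewrite mulrC divrK ?Vhexser_unit. Qed.

Lemma hexser_yser : hexser R = V (hexser R) * (1 + 6%:R * yser).
Proof.
rewrite mulrDr mulr1 mulrCA VhexserM_yser {1}/hexser rmorphD rmorphM rmorph1 /=.
by rewrite rmorph_nat; ring.
Qed.

Lemma coef0_yser : yser 0%N = 0.
Proof. by rewrite coef0_fpsM coef_fpsB coef0_V subrr mul0r. Qed.

Lemma coef1_yser : yser 1%N = 1.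
Proof.
have /fpsP/(_ 1%N) := VhexserM_yser.
rewrite coef1_fpsM coef0_V coef0_hexser mul1r coef0_yser mulr0 addr0 => ->.
rewrite coef_fpsB (_ : V _ 1%N = 0) // subr0 /chiser /=.
by rewrite !big_cons !big_nil /= addr0 subr0.
Qed.

Lemma tfracE : (1 + 6%:R * fpsX R) ^+ 3 * tfrac
  = fpsX R * (1 + 3%:R * fpsX R + 9%:R * fpsX R ^+ 2).
Proof. by rewrite mulrC divrK // unitrX // unit_1D6X. Qed.

Lemma coef0_tfrac : tfrac 0%N = 0.
Proof. by rewrite coef0_fpsM coef_fpsXM mul0r. Qed.

Lemma tserE : (1 + 6%:R * yser) ^+ 3 * tser
  = yser * (1 + 3%:R * yser + 9%:R * yser ^+ 2).
Proof.
have y0 := coef0_yser.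
have := congr1 (fps_comp yser) tfracE; rewrite fps_compM // -/tser.
rewrite !(fps_compM, fps_compXn, raddfD) //= !(fps_compM, fps_compXn) //.
by rewrite !fps_comp1 !fps_comp_nat fps_compX.
Qed.

Lemma unit_1D6y : 1 + 6%:R * yser \is a GRing.unit.
Proof. by apply: fps_unit1; rewrite coef_1natD coef0_yser mulr0 addr0. Qed.

Lemma coef0_tser : tser 0%N = 0.
Proof. by rewrite coef0_fps_comp coef0_tfrac. Qed.

Lemma coef1_tser : tser 1%N = 1.
Proof.
have d0 : (1 + 6%:R * yser) 0%N = 1 by rewrite coef_1natD coef0_yser mulr0 addr0.
have /fpsP/(_ 1%N) := tserE.
rewrite coef1_fpsM [in RHS]coef1_fpsM coef0_fpsX d0 expr1n mul1r.
rewrite coef0_tser mulr0 addr0 => ->.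
rewrite coef0_yser mul0r add0r coef1_yser mul1r coef_fpsD coef_1natD.
by rewrite coef_fps_natM coef0_fpsX coef0_yser expr0n /= !mulr0 !addr0.
Qed.

End Universal.

Section Naturality.
Variables (R S : comNzRingType) (phi : {rmorphism R -> S}).

Lemma fps_map_chiser : fps_map phi (chiser R) = chiser S.
Proof.
apply/fpsP => n /=; case: eqP => _; first by rewrite rmorph0.
by rewrite rmorphB !rmorph_sum /= !big_const_seq rmorph1.
Qed.

Lemma fps_map_hexser : fps_map phi (hexser R) = hexser S.
Proof. by rewrite rmorphD rmorphM rmorph1 rmorph_nat /= fps_map_chiser. Qed.

Lemma fps_map_yser : fps_map phi (yser R) = yser S.
Proof.
rewrite rmorphM rmorphV ?Vhexser_unit //= rmorphB /= !fps_map_V.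
by rewrite fps_map_chiser fps_map_hexser.
Qed.

Lemma fps_map_tfrac : fps_map phi (tfrac R) = tfrac S.
Proof.
rewrite rmorphM rmorphV ?unitrX ?unit_1D6X //= rmorphM rmorphXn.
by rewrite !rmorphD !rmorph1 !rmorphM !rmorph_nat /= !fps_mapX.
Qed.

Lemma fps_map_tser : fps_map phi (tser R) = tser S.
Proof. by rewrite fps_map_comp fps_map_yser fps_map_tfrac. Qed.

End Naturality.

Lemma theta_hexser : theta = hexser rat.
Proof. by rewrite theta_geis1 geis1. Qed.

Lemma y_fps_yser : y_fps = yser rat.
Proof.
apply: (@fps_nat_inj 5).
have -> : 6%:R * y_fps = theta / V theta - 1.
  by rewrite /y_fps mulrC divrK // (fps_nat_unit 5).
apply: (mulrI Vtheta_unit).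
rewrite mulrBr mulr1 [_ * (theta / _)]mulrC divrK ?Vtheta_unit //.
rewrite theta_hexser {1}hexser_yser; ring.
Qed.

Lemma haupt_tser : haupt = tser rat.
Proof.
have [e _] := haupt_y.
apply: (@mulrI _ ((1 + 6%:R * yser rat) ^+ 3)); first by rewrite unitrX // unit_1D6y.
rewrite tserE -{1}y_fps_yser e y_fps_yser; ring.
Qed.

(** The next two identities have integral coefficients: they are known over the
    rationals, hence hold over the integers, hence over every ring. *)
Lemma sec3_yser R : sec3 1 (yser R) = yser R.
Proof.
have inj : injective (fps_map (intr : int -> rat)) := fps_map_inj (@intr_inj _).
rewrite -(fps_map_yser (intr : {rmorphism int -> R})) -fps_map_sec3.
congr (fps_map _ _); apply: inj.
by rewrite fps_map_sec3 fps_map_yser -y_fps_yser sec3_y_fps.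
Qed.

Lemma V_tser R : V (tser R) = yser R ^+ 3.
Proof.
have inj : injective (fps_map (intr : int -> rat)) := fps_map_inj (@intr_inj _).
rewrite -(fps_map_yser (intr : {rmorphism int -> R})).
rewrite -(fps_map_tser (intr : {rmorphism int -> R})) -fps_map_V -rmorphXn.
congr (fps_map _ _); apply: inj.
rewrite fps_map_V rmorphXn /= fps_map_tser fps_map_yser -haupt_tser -y_fps_yser.
by case: haupt_y.
Qed.

(** * The Eisenstein family at integral weights *)

Lemma tofrac_inj : injective (@tofrac Z3).
Proof. by move=> x y /eqP; rewrite tofrac_eq => /eqP. Qed.

Lemma Q3_int_neq0 (a : int) : a != 0 -> a%:~R != 0 :> Q3.
Proof.
have natP n : n.+1%:R != 0 :> Q3.
  rewrite -[n.+1%:R](rmorph_nat (@tofrac Z3)) tofrac_eq0; exact: Z3_nat_neq0.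
by case: a => [[|n]|n] // _; rewrite ?NegzE ?rmorphN ?oppr_eq0; apply: natP.
Qed.

Lemma ratr_Q3_frac (a b : int) : b != 0 ->
  ratr (a%:~R / b%:~R) = a%:~R / b%:~R :> Q3.
Proof.
move=> b0; set x : rat := a%:~R / b%:~R.
have d0 : denq x != 0 by rewrite denq_neq0.
have e : a * denq x = numq x * b.
  apply: (@intr_inj rat); rewrite !intrM.
  have : x = (numq x)%:~R / (denq x)%:~R by rewrite divq_num_den.
  rewrite {1}/x => /eqP; rewrite eqr_div ?intr_eq0 // => /eqP ->.
  by [].
rewrite /ratr; apply/eqP; rewrite eqr_div ?Q3_int_neq0 // -!intrM.
by rewrite e.
Qed.

(** The embedding of the rationals, a ring morphism since [Q3] has
    characteristic 0. *)
Definition ratQ3 : rat -> Q3 := ratr.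

Fact ratQ3_is_zmod_morphism : zmod_morphism ratQ3.
Proof.
move=> x y; rewrite /ratQ3 -{1 2}(divq_num_den x) -{1 2}(divq_num_den y).
have dx : denq x != 0 := denq_neq0 x; have dy : denq y != 0 := denq_neq0 y.
have fracB (F : fieldType) (a b c d : int) : b%:~R != 0 :> F -> d%:~R != 0 :> F ->
    a%:~R / b%:~R - c%:~R / d%:~R
      = (a * d - c * b)%:~R / (b * d)%:~R :> F.
  by move=> b0 d0; rewrite rmorphB !intrM; field; rewrite b0 d0.
rewrite fracB ?intr_eq0 // !ratr_Q3_frac ?mulf_neq0 // fracB //; exact: Q3_int_neq0.
Qed.
HB.instance Definition _ :=
  GRing.isZmodMorphism.Build rat Q3 ratQ3 ratQ3_is_zmod_morphism.

Fact ratQ3_is_monoid_morphism : monoid_morphism ratQ3.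
Proof.
split=> [|x y]; first by have := @ratr_Q3_frac 1 1 isT; rewrite !divr1.
rewrite /ratQ3 -{1 2}(divq_num_den x) -{1 2}(divq_num_den y).
have dx : denq x != 0 := denq_neq0 x; have dy : denq y != 0 := denq_neq0 y.
rewrite mulf_div -!intrM !ratr_Q3_frac ?mulf_neq0 // mulf_div -!intrM //.
Qed.
HB.instance Definition _ :=
  GRing.isMonoidMorphism.Build rat Q3 ratQ3 ratQ3_is_monoid_morphism.

Lemma eisenstein_geis k : (0 < k)%N -> ~~ odd k -> geis k 0%N != 0 ->
  eisenstein k = fpsC (geis k 0%N)^-1 * geis k.
Proof.
move=> k0 kev c0; have := geis_eisenstein k0 kev c0.
move: (geis k 0%N) c0 => c c0 ->.
by rewrite mulrA -rmorphM mulVf // rmorph1 mul1r.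
Qed.

Lemma eisenstein_poly k : (0 < k)%N -> ~~ odd k -> geis k 0%N != 0 ->
  exists q : {poly rat}, eisenstein k
    = hexser rat ^+ k * fps_comp (tser rat) (Fps (fun n => q`_n)).
Proof.
move=> k0 kev c0; have [p pE] := geis_poly k.
have xE : cubic_ratio = (map_poly (@fpsC rat) (1 - 27%:R *: 'X)).[tser rat].
  rewrite rmorphB rmorph1 /= map_polyZ /= map_polyX hornerD hornerN hornerZ.
  rewrite hornerX -haupt_tser /haupt [fpsC _]fpsC_nat.
  rewrite [27%:R * _]mulrC divrK ?(fps_nat_unit 26) //.
  by rewrite -(rmorph1 (@polyC _)) hornerC; ring.
rewrite eisenstein_geis //; move: ((geis k 0%N)^-1) => c; rewrite {}pE.
exists (c * 6%:R ^- k *: (p \Po (1 - 27%:R *: 'X))).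
rewrite -horner_fps_comp ?coef0_tser // map_polyZ hornerZ /=.
rewrite map_comp_poly horner_comp -xE.
have -> : hexser rat = 6%:R * geis 1 by rewrite geis1.
rewrite [fpsC (c * _)]rmorphM /= exprMn.
have -> : (6%:R : {fps rat}) ^+ k = fpsC (6%:R ^+ k) by rewrite rmorphXn /= fpsC_nat.
have : fpsC (6%:R ^+ k : rat) * fpsC (6%:R ^- k) = 1.
  by rewrite -rmorphM divff ?rmorph1 // expf_neq0.
move: (fpsC c) (fpsC (6%:R ^+ k)) (fpsC (6%:R ^- k)) (_.[_]) => a d b P e1.
transitivity (d * b * (a * (geis 1 ^+ k * P))); first by rewrite e1; ring.
ring.
Qed.

Lemma eisenstein_tri k : (0 < k)%N -> ~~ odd k -> geis k 0%N != 0 ->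
  sec3 0 (eisenstein k) = V (eisenstein k).
Proof.
move=> k0 kev c0.
rewrite eisenstein_geis // rmorphM /= VC -[in LHS](addn0 0%N).
by rewrite sec3_mul ?sec3C // sec3_geis.
Qed.

Section Family.
Variable E : {fps {fps Z3}}.
Hypothesis hE : is_eisenstein_family E.

Let Er := fps_map (@rescale Z3) E.

Lemma family_at m :
  fps_map (@tofrac Z3) (fps_map (ev (pt m)) Er)
  = fps_map ratQ3 (eisenstein (wt m)).
Proof.
apply/fpsP => n /=.
have [z + zr] := hE.2 n _ (wt_ge2 m) (wt_even m).
by rewrite -(ptE m) [1 + _]addrC addrK => /fps_value_ev <-.
Qed.

Lemma coef1_eisenstein k :
  eisenstein k 1%N = 2%:R / ((1 - 3%:R ^+ k.-1) * zeta_1sub k).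
Proof.
rewrite /eisenstein /coef_fps; move: (zeta_1sub k) => z.
rewrite [LHS](_ : _ = 2%:R / ((1 - 3%:R ^+ k.-1) * z)
  * \sum_(d <- [:: 1%N] | ~~ (3 %| d)%N) d%:R ^+ k.-1) //.
by rewrite big_cons big_nil expr1n addr0 mulr1.
Qed.

Lemma eisenstein_2_neq0 : eisenstein 2 1%N != 0.
Proof.
have z0 : (1 - 3%:R ^+ 1) * zeta_1sub 2 != 0.
  rewrite coef0_geis_zeta // geis2 coef_fps_natM coef0_fpsX.
  have : geis 1 0%N != 0 by have := geis1_unit; rewrite fps_unitE unitfE.
  by move: (geis 1 0%N) => g g0; rewrite !mulf_neq0 // expf_neq0.
by rewrite coef1_eisenstein mulf_neq0 // invr_eq0.
Qed.

Lemma family_1_neq0 : Er 1%N != 0.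
Proof.
apply: contra eisenstein_2_neq0 => /eqP; rewrite -[0](rmorph0 (@rescale Z3)).
move/rescale_inj => E1; have [z zE zr] := hE.2 1%N 2 isT isT.
have z0 : z = 0.
  apply: div3_all0 => m; apply/div3_residue; have [N NP] := zE m.
  rewrite -(NP N (leqnn N)) big1 => [|i _]; first by rewrite /= mod0z.
  by rewrite E1 coef_fps0 mul0r.
move: zr; rewrite z0 rmorph0 -[ratr _]/(ratQ3 _) -(rmorph0 ratQ3).
by move/fmorph_inj => <-.
Qed.

(** The weights whose zeta value is nonzero, as [geis_eisenstein] requires. *)
Definition good m := (geis (wt m) 0%N != 0).

(** At a bad weight the coefficient of [q] in [eisenstein] is zero, because
    dividing by zero gives zero. If there were infinitely many bad weights, the
    coefficient [E 1] of the family would be zero, which it is not in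
    weight 2. *)
Lemma good_weights : exists M, forall m, (M <= m)%N -> good m.
Proof.
apply: contrapT => nM.
have /eqP := family_1_neq0; apply.
apply: (@ev_identity (fun m => ~~ good m)) => [M|m].
  apply: contrapT => h; apply: nM; exists M => m Mm.
  by case: (boolP (good m)) => // bad; case: h; exists m.
rewrite negbK => /eqP g0; apply: tofrac_inj.
have /fpsP/(_ 1%N) := family_at m; rewrite [LHS]/= => ->.
have := wt_even m; have := wt_ge2 m; move: g0; rewrite /fps_map.
case: (wt m) => // j g0 _; rewrite oddS negbK => jo.
rewrite [LHS](_ : _ = ratQ3 (eisenstein j.+1 1%N)) //.
by rewrite coef1_eisenstein coef0_geis_zeta // g0 mulr0 invr0 mulr0 !rmorph0.
Qed.

Lemma fps_ev_eq (Q : nat -> Prop) (f g : {fps {fps Z3}}) :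
  (exists M, forall m, (M <= m)%N -> Q m) ->
  (forall m, Q m -> fps_map (ev (pt m)) f = fps_map (ev (pt m)) g) -> f = g.
Proof.
move=> [M QM] fg; apply/fpsP => n; apply/eqP; rewrite -subr_eq0; apply/eqP.
apply: (@ev_identity Q) => [N|m Qm].
  by exists (maxn M N); [rewrite leq_maxr|apply: QM; rewrite leq_maxl].
by have /fpsP/(_ n) /= e := fg m Qm; rewrite rmorphB /= e subrr.
Qed.

Lemma fps_map_tofrac_inj : injective (fps_map (@tofrac Z3)).
Proof. exact: fps_map_inj tofrac_inj. Qed.

Lemma family_tri : sec3 0 Er = V Er.
Proof.
apply: (fps_ev_eq good_weights) => m gm; apply: fps_map_tofrac_inj.
rewrite !fps_map_sec3 !fps_map_V family_at -fps_map_sec3 -fps_map_V.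
by rewrite eisenstein_tri // ?wt_even // (leq_trans _ (wt_ge2 m)).
Qed.

End Family.

(** * Series whose [n]-th coefficient is divisible by [3^n] *)

Section Graded.
Variable R : comNzRingType.
Implicit Types f g s : {fps R}.

Definition graded f := forall n, div3 n (f n).

Lemma gradedP f : graded f <-> exists h, f = rescale h.
Proof.
split=> [gf|[h ->] n]; last by rewrite coef_fps_comp_scale; apply/div3Ml/div3_exp.
exists (Fps (fun n => projT1 (cid (gf n)))); apply/fpsP => n.
by rewrite coef_fps_comp_scale; exact: projT2 (cid (gf n)).
Qed.

Lemma graded1 : graded 1.
Proof. by apply/gradedP; exists 1; rewrite /rescale fps_comp1. Qed.

Lemma gradedD f g : graded f -> graded g -> graded (f + g).
Proof. by move=> gf gg n; apply: div3D (gf n) (gg n). Qed.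

Lemma gradedM f g : graded f -> graded g -> graded (f * g).
Proof.
move=> /gradedP[h ->] /gradedP[k ->]; apply/gradedP; exists (h * k).
by rewrite /rescale comp_scaleM.
Qed.

Lemma gradedX f k : graded f -> graded (f ^+ k).
Proof.
move=> gf; elim: k => [|k IH]; first exact: graded1.
by rewrite exprS; apply: gradedM.
Qed.

Lemma gradedV f : f 0%N = 1 -> graded f -> graded f^-1.
Proof.
move=> f0 /gradedP[h fE]; have h0 : h 0%N = 1 by rewrite -f0 fE coef0_fps_comp.
apply/gradedP; exists h^-1.
by rewrite fE /rescale fps_compV ?fps_unit1 // coef0_scale.
Qed.

Lemma graded_X (c : R) : graded (fpsC (3%:R * c) * fpsX R).
Proof.
apply/gradedP; exists (fpsC c * fpsX R).
by rewrite /rescale comp_scaleM comp_scaleX fps_compC rmorphM; ring.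
Qed.

Lemma graded_euler f : graded f -> graded (euler f).
Proof. by move=> gf n; apply/div3Mr/gf. Qed.

Lemma graded_1D6X : graded (1 + 6%:R * fpsX R).
Proof.
apply: gradedD graded1 _; have := graded_X 2%:R.
by rewrite -natrM fpsC_nat.
Qed.

Lemma tfrac_graded : exists2 u, graded u & tfrac R = fpsX R * u.
Proof.
have c0 : (1 + 6%:R * fpsX R) 0%N = 1 by rewrite coef_1natD mulr0 addr0.
exists ((1 + 3%:R * fpsX R + 9%:R * fpsX R ^+ 2) / (1 + 6%:R * fpsX R) ^+ 3).
  apply: gradedM.
    have g3 : graded (3%:R * fpsX R).
      by have := graded_X 1; rewrite mulr1 fpsC_nat.
    rewrite (_ : 9%:R * _ = (3%:R * fpsX R) ^+ 2); last by ring.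
    by apply: gradedD; [apply: gradedD graded1 g3|apply: gradedX].
  apply: gradedV; first by rewrite coef0_fpsX c0 expr1n.
  exact/gradedX/graded_1D6X.
by rewrite /tfrac mulrA.
Qed.

(** The divisibility that survives in [beta], whose coefficients involve
    [6^n / n!]. *)
Definition semigraded f := forall n, div3 (uphalf n) (f n).

Lemma semigradedM f g : semigraded f -> graded g -> semigraded (f * g).
Proof.
move=> sf gg n; rewrite coef_fpsM; apply: div3_sum => i _.
apply: div3_le (div3M (sf i) (gg (n - i)%N)).
have := leq_ord i; lia.
Qed.

End Graded.

(** A graded series is a series in [3 X], and [3 tfrac] is again a series in
    [3 X] without constant term. *)
Lemma graded_comp_tfrac (R : comNzRingType) (f : {fps R}) :
  graded f -> graded (fps_comp (tfrac R) f).
Proof.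
move=> /gradedP[h ->]; have [u /gradedP[v ->] tE] := tfrac_graded R.
apply/gradedP; exists (fps_comp (fpsX R * v) h).
have s0 := @coef0_scale R 3%:R; have v0 : (fpsX R * v) 0%N = 0 by rewrite coef_fpsXM.
have key : fps_comp (tfrac R) (fpsC 3%:R * fpsX R)
    = fps_comp (fpsC 3%:R * fpsX R) (fpsX R * v).
  rewrite fps_compM ?coef0_tfrac // fps_compC fps_compX ?coef0_tfrac //.
  by rewrite comp_scaleM comp_scaleX tE mulrA.
by rewrite /rescale (fps_compA h (coef0_tfrac R) s0) key (fps_compA h s0 v0).
Qed.

Section Dwork.
Variables (kappa : {fps Z3}) (beta P : {fps {fps Z3}}).
Hypothesis beta_semi : semigraded beta.
Hypothesis beta_ode :
  (1 + 6%:R * fpsX _) * euler beta = fpsC (6%:R * kappa) * (fpsX _ * beta).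
Hypothesis P0 : P 0%N = 1.
Hypothesis P_decay : forall I n, exists J, forall j, (J <= j)%N ->
  forall i, (i < I)%N -> div3 n (P j i).

Let Q := fps_comp (tfrac _) P.
Let F := beta * Q.
Hypothesis F_tri : sec3 0 F = V P.

Let low I n (f : {fps Z3}) := forall i, (i < I)%N -> div3 n (f i).

Let low_le I m n f : (m <= n)%N -> low I n f -> low I m f.
Proof. by move=> mn lf i iI; apply: div3_le mn (lf i iI). Qed.

Let lowMl I n f g : low I n f -> low I n (f * g).
Proof.
move=> lf i iI; rewrite coef_fpsM; apply: div3_sum => k _; apply/div3Ml/lf.
by apply: leq_ltn_trans iI; rewrite -ltnS.
Qed.

(** The factor [tfrac ^+ i] has order [i], and at least [2 j] of the [3 j]
    exponents remain. *)
Lemma beta_tfrac_div3 i j : (i <= j)%N ->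
  div3 j ((beta * tfrac {fps Z3} ^+ i) (3 * j)%N).
Proof.
move=> ij; have [u gu ->] := tfrac_graded {fps Z3}.
rewrite exprMn mulrCA coef_fpsXnM ifT; last by lia.
by apply: div3_le (semigradedM beta_semi (gradedX i gu) _); lia.
Qed.

(** The coefficient of [X^(3j)] in [F_tri]. *)
Lemma P_rec j :
  P j = \sum_(i < (3 * j).+1) P i * (beta * tfrac _ ^+ i) (3 * j)%N.
Proof.
rewrite -(coef_mul_comp _ _ _ (coef0_tfrac _)) -/Q -/F -[LHS]coef_V3 -F_tri.
by rewrite coef_sec3 modnMr eqxx.
Qed.

(** Fix finitely many coefficients in [W]. For large [j] the divisibility of
    [P j] by a given power of 3 is [P_decay]; it then propagates to smaller [j]
    by [P_rec], where the terms with [i <= j] are divisible by [3^j] anyway. *)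
Lemma P_graded : graded P.
Proof.
suff h I s d j J : (forall i, (J <= i)%N -> low I s (P i)) ->
    (J <= j + d)%N -> low I (minn j s) (P j).
  move=> j; apply/div3_fps => i; have [J JP] := P_decay i.+1 j.
  have := @h i.+1 j J j J JP (leq_addl _ _) i (ltnSn i).
  by rewrite minnn.
move=> JP; elim: d j => [|d IH] j.
  by rewrite addn0 => Jj; apply: low_le (JP j Jj); exact: geq_minr.
move=> Jjd; rewrite P_rec => c cI; rewrite coef_fps_sum; apply: div3_sum => i _.
have [ij|ji] := leqP i j.
  apply: div3_le (geq_minl j s) _.
  have /div3_fps/(_ c) := div3Mr (P i) (beta_tfrac_div3 ij).
  by [].
apply: lowMl cI; apply: low_le (IH i _); lia.
Qed.

(** The quotient [H] has section 0 equal to 1 and satisfies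
    [X H' = (Rr - U) H], where [Rr] is the logarithmic derivative of [F], which
    is graded, and [U] that of [V P]. The section 0 of the equation says that
    [U] is the section 0 of [Rr H], so [U] is as divisible as the lower
    coefficients of [H] make it, and the equation can be solved: it is only
    divided by exponents prime to 3. *)
Lemma fps_ratio_graded : graded (F / V P).
Proof.
have gP := P_graded; have gQ : graded Q := graded_comp_tfrac gP.
have Q0 : Q 0%N = 1 by rewrite coef0_fps_comp.
have uQ : Q \is a GRing.unit := fps_unit1 Q0.
have K0 : V P 0%N = 1 by rewrite coef0_V.
have uK : V P \is a GRing.unit := fps_unit1 K0.
set H := F / V P; have FE : F = V P * H by rewrite mulrC divrK.
have H3 : sec3 0 H = 1.
  apply: (mulrI uK); rewrite mulr1 -[RHS]F_tri FE -[in RHS](addn0 0%N).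
  by rewrite sec3_mul ?sec3_V.
pose D := 1 + 6%:R * fpsX {fps Z3}.
have uD : D \is a GRing.unit := unit_1D6X _.
pose Rr := fpsC (6%:R * kappa) * fpsX _ / D + euler Q / Q.
have gR : graded Rr.
  apply: gradedD.
    apply: gradedM; last apply: gradedV (graded_1D6X _).
      rewrite (_ : 6%:R * kappa = 3%:R * (2%:R * kappa)); last by ring.
      exact: graded_X.
    by rewrite coef_1natD mulr0 addr0.
  by apply: gradedM; [exact: graded_euler|exact: gradedV].
have FR : euler F = Rr * F.
  rewrite eulerM /Rr /F mulrDl; congr (_ + _).
    have ode : D * euler beta = _ := beta_ode.
    apply: (mulrI uD); rewrite [LHS]mulrA ode.
    transitivity (fpsC (6%:R * kappa) * (fpsX _ * beta) * Q * (D / D)); last by ring.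
    by rewrite (divrr uD) mulr1.
  transitivity (beta * euler Q * (Q / Q)); last by ring.
  by rewrite (divrr uQ) mulr1.
pose U := euler (V P) / V P.
have HE : euler H = Rr * H - U * H.
  apply: (mulrI uK); move: FR; rewrite FE eulerM => e.
  rewrite mulrBr; transitivity (Rr * (V P * H) - euler (V P) * H).
    by rewrite -e; ring.
  rewrite /U; transitivity (V P * (Rr * H) - euler (V P) * H * (V P / V P)).
    by rewrite (divrr uK); ring.
  by ring.
have U3 : sec3 0 U = U.
  have V3 : sec3 0 (V P)^-1 = (V P)^-1.
    apply: (mulrI uK); rewrite (divrr uK) -(sec3_mul 0 _ (sec3_V P)).
    by rewrite (divrr uK) (sec3C 1).
  rewrite /U -[0%N]/(0 + 0)%N sec3_prod //.
  apply/fpsP => n; rewrite coef_sec3; case: eqP => // /eqP n3.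
  by rewrite /= /dvdn (negPf n3) mulr0.
have UE : U = sec3 0 (Rr * H).
  have := congr1 (sec3 0) HE; rewrite raddfB /= -[in sec3 0 (U * H)](addn0 0%N).
  rewrite sec3_mul // H3 mulr1.
  have -> : sec3 0 (euler H) = 0.
    apply/fpsP => n; rewrite coef_sec3 coef_fps0; case: eqP => // n3.
    have /fpsP/(_ n) := H3; rewrite coef_sec3 n3 eqxx coef_fps1 /= => ->.
    by case: n {n3} => [|n]; rewrite ?mul0r ?mulr0.
  by move/esym/eqP; rewrite subr_eq0 => /eqP.
have e0 (f : {fps {fps Z3}}) : euler f 0%N = 0 by exact: mul0r.
have X0 : fpsX {fps Z3} 0%N = 0 by [].
have R0 : Rr 0%N = 0.
  rewrite /Rr coef_fpsD [X in _ + X]coef0_fpsM e0 mul0r addr0.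
  by rewrite coef0_fpsM coef_fpsCM X0 mulr0 mul0r.
have U0 : U 0%N = 0 by rewrite /U coef0_fpsM e0 mul0r.
elim/ltn_ind => n IH.
have [->|n0] := posnP n; first exact: div30.
have RH i : (i <= n)%N -> div3 i ((Rr * H) i).
  move=> lei; rewrite coef_fpsM big_ord_recl R0 mul0r add0r.
  apply: div3_sum => k _; have lek : (lift ord0 k <= i)%N by rewrite -ltnS.
  rewrite -[X in div3 X _](subnKC lek); apply: div3M; first exact: gR.
  by apply: IH; rewrite lift0 in lek *; lia.
have [n3|n3] := boolP (3 %| n)%N.
  have /fpsP/(_ n) := H3; rewrite coef_sec3 mod0n -/(dvdn 3 n) n3.
  by rewrite coef_fps1 gtn_eqF // => ->; apply: div3_0.
have nH : div3 n (n%:R * H n).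
  rewrite -[_ * _]/(euler H n) HE coef_fpsB; apply: div3B; first exact: RH.
  rewrite coef_fpsM big_ord_recl U0 mul0r add0r.
  apply: div3_sum => k _; have lek : (lift ord0 k <= n)%N by rewrite -ltnS.
  rewrite -[X in div3 X _](subnKC lek); apply: div3M.
    rewrite UE coef_sec3; case: ifP => _; [exact: RH|exact: div3_0].
  by apply: IH; rewrite lift0 in lek *; lia.
have un := Z3_nat_unit n3.
have -> : H n = fpsC (n%:R^-1) * (n%:R * H n).
  by rewrite -fpsC_nat mulrA -rmorphM mulVr // rmorph1 mul1r.
exact: div3Mr.
Qed.

End Dwork.

(** * The quotient as a series in [3 y] *)

Lemma Z3_neq0_dvd (x : Z3) : x != 0 -> exists w u, x * u = 3%:R ^+ w.
Proof.
move=> x0; have [n nx] : exists n, ~ div3 n x.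
  apply/not_existsP => h; case/eqP: x0; apply: div3_all0 => n.
  exact: contrapT (h n).
elim: n nx => [|n IH] nx; first by case: nx; apply: div30.
have [[y xE]|] := pselect (div3 n x); last exact: IH.
have uy : y \is a GRing.unit.
  apply: Z3_unit => -[z yE]; apply: nx; exists z.
  by rewrite xE yE mulrA -exprD addn1.
by exists n, y^-1; rewrite xE -mulrA divrr ?mulr1.
Qed.

Lemma ev_iter_shift c (f : {fps Z3}) I :
  ev c f = \sum_(i < I) f i * (3%:R * c) ^+ i
    + (3%:R * c) ^+ I * ev c (iter I (@fps_shift Z3) f).
Proof.
elim: I => [|I IH]; first by rewrite big_ord0 add0r mul1r.
rewrite big_ord_recr {}IH {1}ev_shift coef_iter_shift exprSr /=; ring.
Qed.

(** Induction on the coefficient: once the coefficients below [I] are highly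
    divisible by 3, the vanishing of [f j] at [3 pt m] makes the coefficient [I]
    small together with [pt m], which tends to 0. *)
Lemma ev_decay (f : nat -> {fps Z3}) :
  (exists M, forall m, (M <= m)%N -> exists N, forall j, (N <= j)%N ->
    ev (pt m) (f j) = 0) ->
  forall I n, exists J, forall j, (J <= j)%N ->
    forall i, (i < I)%N -> div3 n (f j i).
Proof.
move=> [M fM]; elim=> [|I IH] n; first by exists 0%N.
pose m := maxn M n; have [N fN] := fM m (leq_maxl _ _).
have c0 : (3%:R * pt m) ^+ I != 0.
  by rewrite expf_neq0 // mulf_neq0 ?pt_neq0 // (Z3_nat_neq0 2).
have [w [u cu]] := Z3_neq0_dvd c0.
have [J JP] := IH (w + n)%N.
exists (maxn J N) => j; rewrite geq_max => /andP[Jj Nj] i.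
rewrite ltnS leq_eqVlt => /predU1P[->|iI]; last first.
  exact: div3_le (leq_addl _ _) (JP j Jj i iI).
have := fN j Nj; rewrite (ev_iter_shift _ _ I) ev_shift.
rewrite coef_iter_shift add0n; set r := ev _ _.
set s := \sum_(k < I) _ => e.
have [t sE] : div3 (w + n) s.
  by apply: div3_sum => k _; apply/div3Ml/JP.
have e2 : f j I + 3%:R * pt m * r = 3%:R ^+ n * (- (t * u)).
  apply: (mulfI (Z3_3neq0 w)).
  have {}e : (3%:R * pt m) ^+ I * (f j I + 3%:R * pt m * r) = - s.
    by apply/eqP; rewrite -addr_eq0 addrC e.
  by rewrite -{1}cu mulrAC e sE exprD; ring.
have -> : f j I = 3%:R ^+ n * (- (t * u)) - 3%:R * pt m * r.
  by rewrite -e2 addrK.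
apply: div3B; first exact/div3Ml/div3_exp.
apply/div3Ml/div3Mr; apply: div3_le (pt_div3 m); exact: leq_maxr.
Qed.

Lemma regroup_comp (R : comNzRingType) (u y b s f : {fps R}) :
  y 0%N = 0 -> s 0%N = 0 ->
  u * fps_comp y b * fps_comp (fps_comp y s) f
  = u * fps_comp y (b * fps_comp s f).
Proof. by move=> y0 s0; rewrite -mulrA (fps_compM _ _ y0) (fps_compA _ y0 s0). Qed.

Lemma V_M_comp (R : comNzRingType) (u y s f : {fps R}) :
  y 0%N = 0 -> s 0%N = 0 -> V s = y ^+ 3 ->
  V (u * fps_comp s f) = V u * fps_comp y (V f).
Proof.
move=> y0 s0 Vs; have X0 : (fpsX R ^+ 3) 0%N = 0 by rewrite coef_fpsXn.
rewrite rmorphM /= (V_fps_comp _ s0) Vs [V f]V_comp (fps_compA _ y0 X0).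
by rewrite (fps_compXn _ _ y0) (fps_compX y0).
Qed.

Lemma sec3_comp_pure (R : comNzRingType) (y f : {fps R}) r :
  y 0%N = 0 -> sec3 1 y = y ->
  sec3 r (fps_comp y f) = fps_comp y (sec3 r f).
Proof.
move=> y0 y3; apply/fpsP => n; rewrite coef_sec3 /=.
have yj j : (n %% 3 != j %% 3)%N -> (y ^+ j) n = 0.
  have : sec3 j (y ^+ j) = y ^+ j by apply: (@pure3X _ 1 j j); rewrite ?mul1n.
  by move/fpsP/(_ n); rewrite coef_sec3 => + /negPf nj; rewrite nj.
case: ifPn => nr.
  apply: eq_bigr => j _; case: ifPn => jr //.
  by rewrite mul0r yj ?mulr0 // (eqP nr) eq_sym.
rewrite big1 // => j _; case: ifPn => jr; last exact: mul0r.
by rewrite yj ?mulr0 // (eqP jr).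
Qed.

Lemma sec3_V_comp (R : comNzRingType) (y u f : {fps R}) :
  y 0%N = 0 -> sec3 1 y = y ->
  sec3 0 (V u * fps_comp y f) = V u * fps_comp y (sec3 0 f).
Proof.
move=> y0 y3; rewrite -(sec3_comp_pure _ _ y0 y3).
exact: (sec3_mul 0 _ (sec3_V u)).
Qed.

Lemma comp_div (R : comNzRingType) (u y f g : {fps R}) :
  y 0%N = 0 -> g \is a GRing.unit ->
  u * fps_comp y f = fps_comp y (f / g) * (u * fps_comp y g).
Proof. by move=> y0 ug; rewrite mulrCA -(fps_compM _ _ y0) (divrK ug). Qed.

Lemma fps_map_quot (R S : comNzRingType) (phi : {rmorphism R -> S}) (f : {fps R}) :
  V f \is a GRing.unit ->
  fps_map phi (f / V f) * V (fps_map phi f) = fps_map phi f.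
Proof. by move=> uf; rewrite -fps_map_V -rmorphM /= divrK. Qed.

Section Quotient.
Variable E : {fps {fps Z3}}.
Hypothesis hE : is_eisenstein_family E.

Local Notation A := {fps Z3}.
Let Er := fps_map (@rescale Z3) E.

(** [Th] interpolates the powers of theta and [P] the polynomials in the
    Hauptmodul; the substitution of [tfrac] turns both into series in [y]. *)
Lemma family_quotient : exists2 H : {fps A}, graded H &
  fps_map (@rescale Z3) (E / V E) = fps_comp (yser A) H.
Proof.
have [kappa [beta [beta0 beta_semi beta_ode betaE]]] := universal_power.
have y0 := coef0_yser A; have t0 := coef0_tser A; have tf0 := coef0_tfrac A.
have chi0 : chiser A 0%N = 0 by [].
have [Th [ThE Thy Th0]] : exists Th : {fps A},
    [/\ forall m, fps_map (ev (pt m)) Th = hexser Z3 ^+ wt m,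
      Th = V Th * fps_comp (yser A) beta & Th 0%N = 1].
  pose Th := fps_comp (chiser A) beta.
  exists Th.
  have ThE m : fps_map (ev (pt m)) Th = hexser Z3 ^+ wt m.
    rewrite fps_map_comp fps_map_chiser betaE fps_compXn //.
    rewrite raddfD /= fps_comp1 fps_compM // fps_comp_nat fps_compX //.
  have Thy : Th = V Th * fps_comp (yser A) beta.
    apply: (@fps_ev_eq (fun _ => True)) => [|m _]; first by exists 0%N.
    rewrite rmorphM.
    rewrite [X in _ = X * _]fps_map_V.
    rewrite ThE.
    rewrite [X in _ = _ * X]fps_map_comp.
    rewrite fps_map_yser.
    rewrite betaE.
    rewrite fps_compXn ?coef0_yser // raddfD /= fps_comp1 fps_compM ?coef0_yser //.
    rewrite fps_comp_nat fps_compX ?coef0_yser // rmorphXn /= -exprMn.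
    by rewrite -hexser_yser.
  by split=> //; rewrite coef0_fps_comp.
have uTh : Th \is a GRing.unit := fps_unit1 Th0.
have [P PE] := fps_comp_surj (Er / Th) t0 (coef1_tser A).
have ErE : Er = Th * fps_comp (tser A) P by rewrite PE mulrC divrK.
have E0 : E 0%N = 1 := hE.1.
have Er0 : Er 0%N = 1 by rewrite /= E0 rmorph1.
have P0 : P 0%N = 1.
  rewrite -[LHS]mul1r -{1}Th0 -(coef0_fps_comp (tser A) P) -coef0_fpsM.
  by rewrite -ErE.
have Pdecay : forall I n, exists J, forall j, (J <= j)%N ->
    forall i, (i < I)%N -> div3 n (P j i).
  apply: ev_decay; have [M gM] := good_weights hE; exists M => m Mm.
  have k0 : (0 < wt m)%N := leq_trans (isT : 0 < 2)%N (wt_ge2 m).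
  have [q qE] := eisenstein_poly k0 (wt_even m) (gM m Mm).
  have e1 : fps_map (@tofrac Z3) (fps_map (ev (pt m)) Er) = hexser Q3 ^+ wt m
      * fps_comp (tser Q3) (fps_map (@tofrac Z3) (fps_map (ev (pt m)) P)).
    rewrite ErE fps_map_M_comp ThE fps_map_tser fps_map_M_comp rmorphXn /=.
    by rewrite fps_map_hexser fps_map_tser.
  have e2 : fps_map ratQ3 (eisenstein (wt m)) = hexser Q3 ^+ wt m
      * fps_comp (tser Q3) (fps_map ratQ3 (Fps (fun n => q`_n))).
    by rewrite qE fps_map_M_comp rmorphXn /= fps_map_hexser fps_map_tser.
  have := family_at hE m; rewrite -/Er e1 e2.
  have uh : hexser Q3 ^+ wt m \is a GRing.unit by rewrite unitrX ?hexser_unit.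
  move/(mulrI uh)/(fps_comp_inj (coef0_tser _) (coef1_tser _)) => e.
  exists (size q) => j sj; apply: tofrac_inj; rewrite rmorph0.
  have /fpsP/(_ j) /= -> := e.
  by rewrite nth_default // rmorph0.
pose F := beta * fps_comp (tfrac A) P.
have ErF : Er = V Th * fps_comp (yser A) F.
  transitivity (V Th * fps_comp (yser A) beta * fps_comp (tser A) P).
    by rewrite -Thy -ErE.
  exact: (@regroup_comp _ (V Th) (yser A) beta (tfrac A) P y0 tf0).
have VErF : V Er = V Th * fps_comp (yser A) (V P).
  transitivity (V (Th * fps_comp (tser A) P)); first by rewrite -ErE.
  exact: (@V_M_comp _ Th (yser A) (tser A) P y0 t0 (V_tser A)).
have uVTh : V Th \is a GRing.unit by apply: fps_unit1; rewrite coef0_V.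
have F_tri : sec3 0 F = V P.
  apply: (fps_comp_inj y0 (coef1_yser A)); apply: (mulrI uVTh).
  rewrite -VErF -(@sec3_V_comp _ (yser A) Th F y0 (sec3_yser A)) -ErF.
  exact: family_tri.
exists (F / V P); first exact: (fps_ratio_graded beta_semi beta_ode P0 Pdecay F_tri).
have VP0 : V P 0%N = 1 by rewrite coef0_V.
have uVP : V P \is a GRing.unit := fps_unit1 VP0.
have uVE : V E \is a GRing.unit by apply: fps_unit1; rewrite coef0_V.
have uVEr : V Er \is a GRing.unit by apply: fps_unit1; rewrite coef0_V.
apply: (mulIr uVEr).
rewrite (@fps_map_quot _ _ (@rescale Z3) E uVE) -/Er VErF.
rewrite -(@comp_div _ (V Th) (yser A) F (V P) y0 uVP).
exact: ErF.
Qed.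

End Quotient.

(** The substitution [W = w / 3]. *)
Definition unscale (f : {fps Z3}) : {fps Q3} :=
  fps_comp (fpsC 3%:R^-1 * fpsX Q3) (fps_map (@tofrac Z3) f).

Fact unscale_is_zmod_morphism : zmod_morphism unscale.
Proof. by move=> f g; rewrite /unscale 2!raddfB. Qed.
HB.instance Definition _ := GRing.isZmodMorphism.Build {fps Z3} {fps Q3}
  unscale unscale_is_zmod_morphism.

Fact unscale_is_monoid_morphism : monoid_morphism unscale.
Proof.
split=> [|f g]; first by rewrite /unscale rmorph1 fps_comp1.
by rewrite /unscale rmorphM comp_scaleM.
Qed.
HB.instance Definition _ := GRing.isMonoidMorphism.Build {fps Z3} {fps Q3}
  unscale unscale_is_monoid_morphism.

Lemma Q3_3neq0 : 3%:R != 0 :> Q3.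
Proof. exact: (@Q3_int_neq0 3). Qed.

Lemma unscale_rescale f : unscale (rescale f) = fps_map (@tofrac Z3) f.
Proof.
apply/fpsP => n; rewrite /unscale coef_fps_comp_scale /fps_map.
rewrite [X in _ * X](_ : _ = tofrac (rescale f n)) // coef_rescale.
by rewrite rmorphM rmorphXn rmorph_nat /= exprVn mulKf ?expf_neq0 ?Q3_3neq0.
Qed.

Lemma w_var3E : w_var / 3%:R = fpsC (fpsC 3%:R^-1 * fpsX Q3).
Proof.
have u : fpsC (fpsC (3%:R^-1 : Q3)) * 3%:R = 1.
  by rewrite -!fpsC_nat -!rmorphM mulVf ?Q3_3neq0 // !rmorph1.
have u3 : (3%:R : {fps {fps Q3}}) \is a GRing.unit.
  by apply/unitrPr; exists (fpsC (fpsC 3%:R^-1)); rewrite mulrC.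
apply: (mulIr u3); rewrite divrK // rmorphM /= mulrAC u mul1r.
by [].
Qed.

Lemma y_varE : y_var = yser {fps Q3}.
Proof.
rewrite /y_var y_fps_yser.
exact: (fps_map_yser (@fpsC Q3 \o ratQ3)).
Qed.

Lemma fpsC_term (R : comNzRingType) (b c : R) (y : {fps R}) i j :
  fpsC b * fpsC c ^+ i * (3%:R * y) ^+ j = fpsC (3%:R ^+ j * (b * c ^+ i)) * y ^+ j.
Proof.
rewrite exprMn 2!(rmorphM (@fpsC R)) 2!(rmorphXn (@fpsC R)) rmorph_nat /=.
by rewrite mulrCA mulrA.
Qed.

Theorem theorem4p2 (E : {fps {fps Z3}}) (hE : is_eisenstein_family E) :
  exists b : nat -> nat -> Z3,
    fps_double_sum
      (fun i j => cst (b i j) * (w_var / 3%:R) ^+ i * (3%:R * y_var) ^+ j)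
      (incl (E / V E)).
Proof.
have [H /gradedP[h HE] quotE] := family_quotient hE.
pose c : {fps Q3} := fpsC 3%:R^-1 * fpsX Q3.
have c0 : c 0%N = 0 := coef0_scale _.
have y0 := coef0_yser {fps Q3}.
have inclE : incl (E / V E) = fps_comp (yser {fps Q3}) (fps_map unscale H).
  rewrite -(fps_map_yser unscale) -fps_map_comp -quotE.
  by apply/fpsP => n; rewrite /= unscale_rescale.
exists (fun i j => h j i) => n m; exists (maxn n m).+1 => M.
rewrite gtn_max => /andP[nM mM].
have -> : \sum_(i < M) \sum_(j < M)
      cst (h j i) * (w_var / 3%:R) ^+ i * (3%:R * y_var) ^+ j
    = \sum_(j < M) fpsC (3%:R ^+ j *
        \sum_(i < M) fpsC (tofrac (h j i)) * c ^+ i) * yser {fps Q3} ^+ j.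
  rewrite y_varE w_var3E exchange_big; apply: eq_bigr => j _.
  rewrite mulr_sumr rmorph_sum mulr_suml; apply: eq_bigr => i _.
  exact: fpsC_term.
rewrite inclE (coef_fps_comp _ y0 nM) !coef_fps_sum.
apply: eq_bigr => j _; rewrite coef_fpsCM.
have -> : fps_map unscale H j = 3%:R ^+ j * unscale (h j).
  rewrite [LHS](_ : _ = unscale (H j)) // HE coef_fps_comp_scale.
  by rewrite rmorphM rmorphXn rmorph_nat.
rewrite -!mulrA !coef_fpsM; apply: eq_bigr => k _; congr (_ * _).
rewrite !coef_fpsM; apply: eq_bigr => l _; congr (_ * _).
have lM : (l < M)%N.
  apply: leq_ltn_trans mM.
  by rewrite (leq_trans (leq_ord l)) // leq_subr.
rewrite /unscale (coef_fps_comp _ c0 lM) coef_fps_sum.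
by apply: eq_bigr => i _; rewrite coef_fpsCM.
Qed.
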